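(* Let $\mathcal{M}$ be the set of rotationally invariant magnetic systems on $\mathbb{T}^2$ with average $1$; namely, $(g,b)\in\mathcal{M}$ if and only if $g$ is a Riemannian metric of the form $g=\mathrm{d}x^2+a(x)^2\mathrm{d}y^2$ and $b=b(x)$ for some functions $a,b:\mathbb{T}\to\mathbb{R}$ such that $\int_{\mathbb{T}}ab\,\mathrm{d}x=\int_{\mathbb{T}}a\,\mathrm{d}x$. Let \[ R_*:=\{\xi\in(0,\infty) : J_1(\xi)=0\},\qquad R_{\mathbb{N}}:=\bigcup_{k\in\mathbb{N}}\tfrac1kR_*, \] where $J_1$ is the first Bessel function. The family $\mathcal{M}$ is (a) Zoll-rigid at every set $R\subset(0,\infty)$ which is unbounded from above and not contained in $R_{\mathbb{N}}$; (b) Zoll-flexible at each of the sets $\tfrac1kR_*$, $k\in\mathbb{N}$.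
   Context: All objects are smooth; $\mathbb{N}$ denotes the positive integers. $\mathbb{T}=\mathbb{R}/2\pi\mathbb{Z}$ and $\mathbb{T}^2=\mathbb{T}\times\mathbb{T}$ with angular coordinates $(x,y)$. A magnetic system on a closed oriented surface $M$ is a pair $(g,b)$ with $g$ a Riemannian metric and $b:M\to\mathbb{R}$ a function. A $(g,b)$-geodesic is a curve $\gamma:\mathbb{R}\to M$ parametrized by arc-length whose geodesic curvature satisfies $\kappa_\gamma(t)=b(\gamma(t))$ for all $t\in\mathbb{R}$. The tangent lifts $(\gamma,\dot\gamma)$ of $(g,b)$-geodesics are the trajectories of a flow $\Phi_{(g,b)}$ on the unit sphere bundle $SM$. The system $(g,b)$ is called Zoll if, up to reparametrization, the flow $\Phi_{(g,b)}$ induces a free circle action on $SM$. A metric $g$ is a Zoll metric if $(g,0)$ is Zoll. Let $\mathcal{M}$ be a family of magnetic systems on $M$ and $R\subset(0,\infty)$. $\mathcal{M}$ is Zoll-rigid at $R$ if the following holds: if $(g,b)\in\mathcal{M}$ is such that $(g,r^{-1}b)$ is Zoll for every $r\in R$, then either $g$ has constant curvature and $b$ is constant, or $M=S^2$, $g$ is a Zoll metric and $b$ is identically zero. If $\mathcal{M}$ is not Zoll-rigid at $R$, it is called Zoll-flexible at $R$. $J_1$ is the Bessel function of the first kind of order one, $J_1(x)=\frac{x}{\pi}\int_{-1}^1\sqrt{1-u^2}\,e^{-ixu}\,\mathrm{d}u$ for $x>0$. For $c>0$, $cR_*=\{c\xi : \xi\in R_*\}$. *)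

(* Defs.v *)
From Stdlib Require Import Reals ZArith.
From Coquelicot Require Import Coquelicot.

Open Scope R_scope.

(* Only used between finite-dimensional spaces, where this is the usual notion:
   the derivative is C^n as soon as each of its directional values is. *)
Fixpoint Ck (n : nat) {V W : NormedModule R_AbsRing} (f : V -> W) : Prop :=
  match n with
  | O => forall x, continuous f x
  | S m => exists df : V -> V -> W,
      (forall x, filterdiff f (locally x) (df x)) /\
      (forall v, Ck m (fun x => df x v))
  end.

Definition smooth {V W : NormedModule R_AbsRing} (f : V -> W) : Prop :=
  forall n, Ck n f.

(* The torus is R^2 modulo (2 pi Z)^2 with coordinates (x, y), oriented by
   dx /\ dy: functions on it are doubly periodic functions on R^2, and curves
   in it are given by their lifts to R^2. *)
Definition point : Type := (R * R)%type.
Definition vec : Type := (R * R)%type.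

Definition shift (m n : Z) (p : point) : point :=
  (fst p + 2 * PI * IZR m, snd p + 2 * PI * IZR n).

Definition circle_fun (f : R -> R) : Prop :=
  smooth f /\ forall x, f (x + 2 * PI) = f x.

Definition torus_fun (f : R * R -> R) : Prop :=
  smooth f /\ forall m n p, f (shift m n p) = f p.

Inductive axis := dir_x | dir_y.

Definition sum_axis (f : axis -> R) : R := f dir_x + f dir_y.

Definition coord (i : axis) (v : vec) : R :=
  match i with dir_x => fst v | dir_y => snd v end.

Definition partial (i : axis) (f : point -> R) (p : point) : R :=
  match i with
  | dir_x => Derive (fun t => f (t, snd p)) (fst p)
  | dir_y => Derive (fun t => f (fst p, t)) (snd p)
  end.

Definition bilin (h : axis -> axis -> point -> R) (p : point) (v w : vec) : R :=
  sum_axis (fun i => sum_axis (fun j => h i j p * coord i v * coord j w)).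

Record metric := Metric {
  comp : axis -> axis -> point -> R;
  comp_fun : forall i j, torus_fun (comp i j);
  comp_sym : forall i j p, comp i j p = comp j i p;
  comp_pos : forall p v, v <> (0, 0) -> 0 < bilin comp p v v
}.

Definition inner (g : metric) : point -> vec -> vec -> R := bilin (comp g).

Definition det_metric (g : metric) (p : point) : R :=
  comp g dir_x dir_x p * comp g dir_y dir_y p
  - comp g dir_x dir_y p * comp g dir_y dir_x p.

Definition inv_metric (g : metric) (i j : axis) (p : point) : R :=
  match i, j with
  | dir_x, dir_x => comp g dir_y dir_y p / det_metric g p
  | dir_y, dir_y => comp g dir_x dir_x p / det_metric g p
  | _, _ => - comp g i j p / det_metric g p
  end.

(* christoffel g k i j is Gamma^k_{ij}. *)
Definition christoffel (g : metric) (k i j : axis) (p : point) : R :=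
  / 2 * sum_axis (fun l => inv_metric g k l p *
    (partial i (comp g j l) p + partial j (comp g i l) p
     - partial l (comp g i j) p)).

(* R(d_i, d_j) d_k = sum_l (riemann g l k i j) d_l *)
Definition riemann (g : metric) (l k i j : axis) (p : point) : R :=
  partial i (christoffel g l j k) p - partial j (christoffel g l i k) p
  + sum_axis (fun m => christoffel g l i m p * christoffel g m j k p
                       - christoffel g l j m p * christoffel g m i k p).

(* K = g(R(d_x, d_y) d_y, d_x) / det g *)
Definition gauss_curvature (g : metric) (p : point) : R :=
  sum_axis (fun l => comp g dir_x l p * riemann g l dir_y dir_x dir_y p)
  / det_metric g p.

Definition area_form (g : metric) (p : point) (v w : vec) : R :=
  sqrt (det_metric g p) * (fst v * snd w - snd v * fst w).

Definition velocity (c : R -> point) (t : R) : vec :=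
  (Derive (fun s => fst (c s)) t, Derive (fun s => snd (c s)) t).

Definition cov_accel_coord (g : metric) (c : R -> point) (t : R) (k : axis) : R :=
  Derive (fun s => coord k (velocity c s)) t
  + sum_axis (fun i => sum_axis (fun j =>
      christoffel g k i j (c t)
      * coord i (velocity c t) * coord j (velocity c t))).

Definition cov_accel (g : metric) (c : R -> point) (t : R) : vec :=
  (cov_accel_coord g c t dir_x, cov_accel_coord g c t dir_y).

(* For a unit-speed curve c the curvature is g(D_t c', J c') with J the rotation
   by +pi/2, and g(w, J v) = area_form v w. *)
Definition geodesic_curvature (g : metric) (c : R -> point) (t : R) : R :=
  area_form g (c t) (velocity c t) (cov_accel g c t).

Definition magnetic_geodesic (g : metric) (b : point -> R) (c : R -> point) : Prop :=
  smooth c /\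
  (forall t, inner g (c t) (velocity c t) (velocity c t) = 1) /\
  (forall t, geodesic_curvature g c t = b (c t)).

Definition tangent : Type := ((R * R) * (R * R))%type.

Definition unit_tangent (g : metric) (v : tangent) : Prop :=
  inner g (fst v) (snd v) (snd v) = 1.

Definition tangent_lift (c : R -> point) (t : R) : tangent := (c t, velocity c t).

(* v and w represent the same tangent vector of the torus. *)
Definition same_tangent (v w : tangent) : Prop :=
  exists m n : Z, w = (shift m n (fst v), snd v).

Definition is_magnetic_flow (g : metric) (b : point -> R)
    (Phi : R -> tangent -> tangent) : Prop :=
  forall v, unit_tangent g v ->
    exists c, magnetic_geodesic g b c /\ tangent_lift c 0 = v /\
              forall t, Phi t v = tangent_lift c t.

(* Smooth maps on R x SM are written as restrictions of smooth maps on R x TM;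
   since SM is a closed submanifold of TM, every smooth map on R x SM is of this
   form.  The circle is R / 2 pi Z, and "free" is the left-to-right part of the
   last clause. *)
Definition free_circle_action (g : metric)
    (theta : R * ((R * R) * (R * R)) -> (R * R) * (R * R)) : Prop :=
  smooth theta /\
  (forall s v, unit_tangent g v -> unit_tangent g (theta (s, v))) /\
  (forall s v w, unit_tangent g v -> same_tangent v w ->
     same_tangent (theta (s, v)) (theta (s, w))) /\
  (forall v, unit_tangent g v -> same_tangent (theta (0, v)) v) /\
  (forall s t v, unit_tangent g v ->
     same_tangent (theta (s + t, v)) (theta (s, theta (t, v)))) /\
  (forall s v, unit_tangent g v ->
     (same_tangent (theta (s, v)) v <-> exists n : Z, s = 2 * PI * IZR n)).

Definition time_change (g : metric) (sigma : R * ((R * R) * (R * R)) -> R) : Prop :=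
  smooth sigma /\
  forall v, unit_tangent g v ->
    sigma (0, v) = 0 /\
    (forall s, 0 < Derive (fun s' => sigma (s', v)) s) /\
    (forall s w, same_tangent v w -> sigma (s, w) = sigma (s, v)).

Definition zoll (g : metric) (b : point -> R) : Prop :=
  exists Phi sigma theta,
    is_magnetic_flow g b Phi /\ time_change g sigma /\
    free_circle_action g theta /\
    forall s v, unit_tangent g v ->
      same_tangent (theta (s, v)) (Phi (sigma (s, v)) v).

(* The remaining alternative in the definition of rigidity concerns the sphere
   and is void on the torus. *)
Definition zoll_rigid (M : metric -> (point -> R) -> Prop) (Rs : R -> Prop) : Prop :=
  forall g b, M g b ->
    (forall r, Rs r -> zoll g (fun p => / r * b p)) ->
    (exists K, forall p, gauss_curvature g p = K) /\
    (exists B, forall p, b p = B).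

Definition zoll_flexible (M : metric -> (point -> R) -> Prop) (Rs : R -> Prop) : Prop :=
  ~ zoll_rigid M Rs.

Definition rot_invariant (g : metric) (b : point -> R) : Prop :=
  exists a b0 : R -> R,
    circle_fun a /\ circle_fun b0 /\
    (forall p, comp g dir_x dir_x p = 1 /\ comp g dir_x dir_y p = 0 /\
               comp g dir_y dir_y p = a (fst p) ^ 2) /\
    (forall p, b p = b0 (fst p)) /\
    RInt (fun x => a x * b0 x) 0 (2 * PI) = RInt a 0 (2 * PI).

(* exp (- i t) *)
Definition expmi (t : R) : C := (cos t, - sin t).

Definition J1 (x : R) : C :=
  Cmult (RtoC (x / PI))
    (RInt (V := C_R_CompleteNormedModule)
       (fun u => Cmult (RtoC (sqrt (1 - u ^ 2))) (expmi (x * u))) (-1) 1).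

Definition R_star (xi : R) : Prop := 0 < xi /\ J1 xi = RtoC 0.

Definition scale_set (c : R) (A : R -> Prop) (r : R) : Prop :=
  exists xi, A xi /\ r = c * xi.

Definition R_N (r : R) : Prop :=
  exists k : nat, (1 <= k)%nat /\ scale_set (/ INR k) R_star r.

(* Main.v *)
Require Import Defs.
From Stdlib Require Import Reals.
From Coquelicot Require Import Coquelicot.
From Stdlib Require Import Lra Lia ZArith FunctionalExtensionality ClassicalEpsilon.
Open Scope R_scope.

(* For g = dx^2 + a^2 dy^2 write u = x' and q = a y', so that (u, q) turns on the
   unit circle with angular velocity b - (a'/a) q.

   Along a Zoll flow the y-displacement of the closed orbits is a continuous
   multiple of 2 pi, hence constant. If a is not constant and r is large, b/r -
   a'/a and b/r + a'/a both vanish somewhere, which gives closed orbits x = const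
   winding in opposite y-directions; so a is constant, and for the same reason b
   has no zero. Then b = beta' > 0 for a diffeomorphism beta with inverse X, and
   the orbit with velocity angle s is x = X (z + r sin s). Its y-displacement over
   one turn is proportional to E(z) = int_0^{2 pi} sin s X'(z + r sin s) ds, which
   is the derivative of a periodic function; being of constant sign, E vanishes
   identically. The k-th Fourier coefficient of E is that of X' multiplied by a
   nonzero constant times J_1(k r), so X' is constant when r is not in R_N.

   Conversely, E = 0 makes the rotation of the velocity a free circle action with
   the same orbits as the flow, and X'(z) = 1 + cos(k z) / 2 satisfies E = 0 as
   soon as J_1(k r) = 0. *)

(** * Smooth functions *)

(* Coquelicot leaves equalities at the carrier of [R] seen as a normed module,
   where [ring] and [lra] do not apply. *)
Ltac real_eq := match goal with |- @eq _ ?a ?b => change (@eq R a b) end.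

(** The period of a closed orbit and its number of turns are not controlled, so the constancy of the
    y-displacement only fixes the sign of [E]; the periodic primitive of [E] is what turns a sign
    into vanishing. Large [r] serves once, to make [a] constant; a single [r] outside [R_N] then
    gives the rest of the rigidity. Once [a] is constant, the average condition makes [beta] commute
    with translation by 2 pi, so that [X'] is 2 pi-periodic with mean 1. Its frequencies are
    therefore integers, whence the factors 1/k in [R_N]; the weight [sin s] of the y-velocity is
    what selects J_1 among the Bessel functions. In the converse, the action and the time change
    must be restrictions of maps that are smooth on the whole tangent bundle, where no velocity
    angle exists. The orbits are therefore written through integrals over an auxiliary angle that
    depend smoothly on the velocity components, and these integrals have to be differentiated to
    every order. *)

Lemma Ck_ext {V W : NormedModule R_AbsRing} n (f g : V -> W) :
  (forall x, f x = g x) -> Ck n f -> Ck n g.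
Proof.
  intros E. replace g with f; [easy|]. now apply functional_extensionality.
Qed.

Lemma smooth_ext {V W : NormedModule R_AbsRing} (f g : V -> W) :
  (forall x, f x = g x) -> smooth f -> smooth g.
Proof. intros E H n. now apply Ck_ext with f. Qed.

Lemma Ck_continuous {V W : NormedModule R_AbsRing} n (f : V -> W) :
  Ck n f -> forall x, continuous f x.
Proof.
  destruct n as [|n]; [easy|]. intros [df [Hd _]] x.
  apply (filterdiff_continuous f x). now exists (df x).
Qed.

Lemma Ck_le {V W : NormedModule R_AbsRing} n (f : V -> W) : Ck (S n) f -> Ck n f.
Proof.
  revert f. induction n as [|n IH]; intros f H.
  - exact (Ck_continuous 1 f H).
  - destruct H as [df [Hd Hn]]. exists df. split; [easy|].
    intros v. now apply IH.
Qed.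

Lemma Ck_const {V W : NormedModule R_AbsRing} n (w : W) : Ck n (fun _ : V => w).
Proof.
  revert w. induction n as [|n IH]; intros w.
  - intros x. apply continuous_const.
  - exists (fun _ _ => zero). split; [|easy].
    intros x. apply filterdiff_const.
Qed.

Lemma Ck_linear {V W : NormedModule R_AbsRing} n (l : V -> W) :
  is_linear l -> Ck n l.
Proof.
  intros Hl. destruct n as [|n].
  - intros x. apply (filterdiff_continuous l x). exists l. now apply filterdiff_linear.
  - exists (fun _ => l). split.
    + intros x. now apply filterdiff_linear.
    + intros v. apply Ck_const.
Qed.

Lemma Ck_comp_linear {U V W : NormedModule R_AbsRing} n (l : V -> W) (f : U -> V) :
  is_linear l -> Ck n f -> Ck n (fun x => l (f x)).
Proof.
  intros Hl. revert f. induction n as [|n IH]; intros f.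
  - intros Hf x. apply (continuous_comp f l); [easy|].
    exact (Ck_linear 0 l Hl (f x)).
  - intros [df [Hd Hn]]. exists (fun x v => l (df x v)). split.
    + intros x. apply (filterdiff_comp' f l); [easy|]. now apply filterdiff_linear.
    + intros v. now apply IH.
Qed.

Lemma Ck_plus {V W : NormedModule R_AbsRing} n (f g : V -> W) :
  Ck n f -> Ck n g -> Ck n (fun x => plus (f x) (g x)).
Proof.
  revert f g. induction n as [|n IH]; intros f g Hf Hg.
  - intros x. now apply (continuous_plus f g).
  - destruct Hf as [df [Hf Hf']], Hg as [dg [Hg Hg']].
    exists (fun x v => plus (df x v) (dg x v)). split.
    + intros x. now apply (filterdiff_plus_fct f g (df x) (dg x)).
    + intros v. now apply IH.
Qed.

Lemma Ck_mult {V : NormedModule R_AbsRing} n (f g : V -> R) :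
  Ck n f -> Ck n g -> Ck n (fun x => f x * g x).
Proof.
  revert f g. induction n as [|n IH]; intros f g Hf Hg.
  - intros x. now apply (continuous_mult f g).
  - generalize (Ck_le n f Hf) (Ck_le n g Hg). intros Kf Kg.
    destruct Hf as [df [Hf Hf']], Hg as [dg [Hg Hg']].
    exists (fun x v => df x v * g x + f x * dg x v). split.
    + intros x. apply (filterdiff_mult_fct f g x (df x) (dg x)); try easy.
      exact Rmult_comm.
    + intros v. apply (Ck_plus n (fun x => df x v * g x) (fun x => f x * dg x v)).
      * now apply IH.
      * now apply IH.
Qed.

Lemma Ck_opp {V : NormedModule R_AbsRing} n (f : V -> R) :
  Ck n f -> Ck n (fun x => - f x).
Proof.
  intros H. apply Ck_ext with (fun x => (-1) * f x); [intros; real_eq; ring|].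
  apply Ck_mult; [apply Ck_const|easy].
Qed.

Lemma Ck_minus {V : NormedModule R_AbsRing} n (f g : V -> R) :
  Ck n f -> Ck n g -> Ck n (fun x => f x - g x).
Proof. intros Hf Hg. apply (Ck_plus n f); [easy|]. now apply Ck_opp. Qed.

Lemma Ck_pair {U V W : NormedModule R_AbsRing} n (f : U -> V) (g : U -> W) :
  Ck n f -> Ck n g -> Ck n (fun x => (f x, g x)).
Proof.
  intros Hf Hg.
  pose (f' := fun x => (f x, zero : W) : prod_NormedModule R_AbsRing V W).
  pose (g' := fun x => (zero : V, g x) : prod_NormedModule R_AbsRing V W).
  apply Ck_ext with (fun x => plus (f' x) (g' x)).
  - intros x. change ((plus (f x) (zero : V), plus (zero : W) (g x)) = (f x, g x)).
    now rewrite plus_zero_r, plus_zero_l.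
  - apply Ck_plus.
    + apply (Ck_comp_linear n (fun v : V => (v, zero : W))); [|easy].
      apply is_linear_prod; [apply is_linear_id|apply is_linear_zero].
    + apply (Ck_comp_linear n (fun w : W => (zero : V, w))); [|easy].
      apply is_linear_prod; [apply is_linear_zero|apply is_linear_id].
Qed.

(** The induction closes because the derivative of the inner map is the constant [l]. Slices and the
    exchange of two variables are instances. *)
Lemma Ck_precomp_affine {U V W : NormedModule R_AbsRing} n (l : U -> V) (a : V) (f : V -> W) :
  is_linear l -> Ck n f -> Ck n (fun x => f (plus (l x) a)).
Proof.
  intros Hl.
  assert (Ha : forall x, filterdiff (fun x => plus (l x) a) (locally x) l).
  { intros x. apply filterdiff_ext_lin with (fun y => plus (l y) zero).
    - apply (filterdiff_plus_fct l (fun _ => a) l (fun _ => zero)).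
      + now apply filterdiff_linear.
      + apply filterdiff_const.
    - intros y. apply plus_zero_r. }
  revert f. induction n as [|n IH]; intros f.
  - intros Hf x. apply (continuous_comp (fun x => plus (l x) a) f); [|easy].
    apply (filterdiff_continuous (fun x => plus (l x) a) x). now exists l.
  - intros [df [Hd Hn]]. exists (fun x v => df (plus (l x) a) (l v)). split.
    + intros x. now apply (filterdiff_comp' (fun x => plus (l x) a) f).
    + intros v. apply (IH (fun y => df y (l v))). apply Hn.
Qed.

Lemma Ck_slice {V W : NormedModule R_AbsRing} n (f : prod_NormedModule R_AbsRing R_NormedModule V -> W) (v : V) :
  Ck n f -> Ck n (fun s : R => f (s, v)).
Proof.
  intros Hf.
  set (P := prod_NormedModule R_AbsRing R_NormedModule V) in *.
  apply Ck_ext with (fun s : R => f (plus ((s, zero) : P) ((0, v) : P))).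
  - intros s. f_equal.
    change ((s + 0, plus zero v) = (s, v)). now rewrite Rplus_0_r, plus_zero_l.
  - apply (Ck_precomp_affine n (fun s : R => (s, zero) : P) ((0, v) : P) f); [|easy].
    apply is_linear_prod; [apply is_linear_id|apply is_linear_zero].
Qed.

(** A function with all its derivatives, indexed by order: an induction on regularity can pass from
    [d m] to [d (S m)] without naming derivatives. *)
Definition tower (d : nat -> R -> R) : Prop :=
  forall n x, is_derive (d n) x (d (S n) x).

Lemma Ck_comp_tower {V : NormedModule R_AbsRing} (d : nat -> R -> R) n m (f : V -> R) :
  tower d -> Ck n f -> Ck n (fun x => d m (f x)).
Proof.
  intros Hd. revert m. induction n as [|n IH]; intros m Hf.
  - intros x. apply (continuous_comp f (d m)); [easy|].
    apply (ex_derive_continuous (d m)). eexists. apply Hd.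
  - generalize (Ck_le n f Hf). intros Kf. destruct Hf as [df [Hf Hf']].
    exists (fun x v => df x v * d (S m) (f x)). split.
    + intros x.
      apply (filterdiff_comp' f (d m) x (df x) (fun y => scal y (d (S m) (f x)))).
      * easy.
      * apply Hd.
    + intros v. apply Ck_mult; [easy|]. now apply IH.
Qed.

Lemma smooth_tower (d : nat -> R -> R) m : tower d -> smooth (d m).
Proof.
  intros Hd n. apply (Ck_comp_tower d n m (fun x => x) Hd).
  apply Ck_linear, is_linear_id.
Qed.

Lemma Ck_derive n (f : R -> R) :
  Ck (S n) f -> (forall x, ex_derive f x) /\ Ck n (Derive f).
Proof.
  intros [df [Hd Hn]].
  assert (E : forall x, is_derive f x (df x 1)).
  { intros x. unfold is_derive. apply filterdiff_ext_lin with (df x); [apply Hd|].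
    intros y. destruct (Hd x) as [Hl _].
    rewrite <- (linear_scal (df x) Hl y 1). f_equal. change (y = y * 1). now rewrite Rmult_1_r. }
  split.
  - intros x. eexists. apply E.
  - apply Ck_ext with (fun x => df x 1); [|apply Hn].
    intros x. symmetry. apply is_derive_unique, E.
Qed.

Lemma Ck_of_derive n (f df : R -> R) :
  (forall x, is_derive f x (df x)) -> Ck n df -> Ck (S n) f.
Proof.
  intros Hd Hn. exists (fun x v => v * df x). split; [exact Hd|].
  intros v. apply Ck_mult; [apply Ck_const|easy].
Qed.

Lemma smooth_derive (f : R -> R) : smooth f -> smooth (Derive f).
Proof. intros H n. apply (Ck_derive n f (H (S n))). Qed.

Lemma smooth_is_derive (f : R -> R) x : smooth f -> is_derive f x (Derive f x).
Proof. intros H. apply Derive_correct, (Ck_derive 0 f (H 1%nat)). Qed.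

Lemma smooth_continuous {V W : NormedModule R_AbsRing} (f : V -> W) x :
  smooth f -> continuous f x.
Proof. intros H. apply (H O). Qed.

Lemma tower_Derive_n (f : R -> R) : smooth f -> tower (Derive_n f).
Proof.
  intros H n x. apply smooth_is_derive.
  induction n as [|n IH]; [easy|]. now apply smooth_derive.
Qed.

Lemma Ck_comp {V : NormedModule R_AbsRing} n (h : R -> R) (f : V -> R) :
  smooth h -> Ck n f -> Ck n (fun x => h (f x)).
Proof.
  intros Hh Hf. apply (Ck_comp_tower (Derive_n h) n 0 f); [|easy].
  now apply tower_Derive_n.
Qed.

(** The derivative [- df / f^2] contains the inverse only to the order already reached, so
    regularity bootstraps. *)
Lemma Ck_inv {V : NormedModule R_AbsRing} n (f : V -> R) :
  (forall x, f x <> 0) -> Ck n f -> Ck n (fun x => / f x).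
Proof.
  intros Nz. induction n as [|n IH]; intros Hf.
  - intros x. apply (continuous_comp f Rinv); [apply Hf|]. now apply continuous_Rinv.
  - generalize (IH (Ck_le n f Hf)). intros K. destruct Hf as [df [Hf Hf']].
    exists (fun x v => df x v * - (/ f x * / f x)). split.
    + intros x.
      apply (filterdiff_comp' f Rinv x (df x) (fun y => scal y (- (/ f x * / f x)))).
      * easy.
      * replace (- (/ f x * / f x)) with (- 1 / f x ^ 2) by (field; apply Nz).
        apply (is_derive_inv (fun y => y)); [|apply Nz].
        exact (is_derive_id (f x : R_AbsRing)).
    + intros v. apply Ck_mult; [easy|]. apply Ck_opp. now apply Ck_mult.
Qed.

Lemma smooth_sin_cos : smooth sin /\ smooth cos.
Proof.
  assert (H : forall n, Ck n sin /\ Ck n cos).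
  { induction n as [|n [IHs IHc]].
    - split; intros x; [apply continuous_sin|apply continuous_cos].
    - split.
      + apply Ck_of_derive with cos; [|easy]. intros x. apply is_derive_sin.
      + apply Ck_of_derive with (fun x => - sin x); [|now apply Ck_opp].
        intros x. apply is_derive_cos. }
  split; intros n; apply H.
Qed.

(** * Inverse functions on the line *)

Lemma increment_ge (h : R -> R) m :
  (forall x, ex_derive h x) -> (forall x, m <= Derive h x) ->
  forall x y, x <= y -> m * (y - x) <= h y - h x.
Proof.
  intros Hd Hm x y Hxy.
  destruct (MVT_gen h x y (Derive h)) as [c [_ E]].
  - intros t _. now apply Derive_correct.
  - intros t _. apply continuity_pt_filterlim, (ex_derive_continuous h t), Hd.
  - rewrite E. apply Rmult_le_compat_r; [lra|apply Hm].
Qed.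

(** The lower bound [m] gives injectivity, surjectivity and the Lipschitz constant [1 / m] for the
    inverse [k]. A difference quotient of [k] is exactly [/ Derive h c] at a mean value point [c],
    which the Lipschitz bound forces close to [k y]. Smoothness then bootstraps from the formula for
    the derivative of [k]. *)
Lemma smooth_inverse (h : R -> R) m :
  0 < m -> smooth h -> (forall x, m <= Derive h x) ->
  exists k : R -> R, (forall x, k (h x) = x) /\ (forall y, h (k y) = y) /\
    (forall y, is_derive k y (/ Derive h (k y))) /\ smooth k.
Proof.
  intros Hm Hs Hd.
  assert (Dh : forall x, is_derive h x (Derive h x)) by (intros; now apply smooth_is_derive).
  assert (Inc : forall x y, x <= y -> m * (y - x) <= h y - h x).
  { apply increment_ge; [|easy]. intros x. eexists. apply Dh. }
  assert (Ch : continuity h).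
  { intros x. apply continuity_pt_filterlim. now apply (smooth_continuous h x). }
  assert (Sur : forall y, { x | h x = y }).
  { intros y. set (a := Rabs (y - h 0) / m).
    assert (Ha : m * a = Rabs (y - h 0)) by (unfold a; field; lra).
    assert (0 <= a) by (apply Rdiv_le_0_compat; [apply Rabs_pos|easy]).
    destruct (IVT_gen h (- a) a y Ch) as [x [_ Hx]]; [|now exists x].
    pose proof (Inc (- a) 0 ltac:(lra)). pose proof (Inc 0 a ltac:(lra)).
    assert (h (- a) <= y <= h a) by (unfold Rabs in Ha; destruct Rcase_abs; nra).
    rewrite Rmin_left, Rmax_right; lra. }
  pose (k := fun y => proj1_sig (Sur y)).
  assert (Hk : forall y, h (k y) = y) by (intros y; unfold k; now destruct (Sur y)).
  assert (Kh : forall x, k (h x) = x).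
  { intros x. pose proof (Hk (h x)) as E.
    destruct (Rle_dec (k (h x)) x).
    - pose proof (Inc (k (h x)) x ltac:(lra)). nra.
    - pose proof (Inc x (k (h x)) ltac:(lra)). nra. }
  assert (Nz : forall x, Derive h x <> 0) by (intros x; specialize (Hd x); lra).
  assert (Dk : forall y, is_derive k y (/ Derive h (k y))).
  { intros y. apply is_derive_Reals. intros eps Heps.
    pose proof (Ck_inv 0 (Derive h) Nz (smooth_derive h Hs O) (k y)) as C.
    apply (proj1 (filterlim_locally (fun x => / Derive h x) _)) with (eps := mkposreal eps Heps) in C.
    destruct C as [del Hdel].
    assert (Hd' : 0 < m * del) by (apply Rmult_lt_0_compat; [easy|apply cond_pos]).
    exists (mkposreal _ Hd'). simpl. intros d Hd0 Hd1.
    destruct (MVT_gen h (k y) (k (y + d)) (Derive h)) as [c [Hc E]].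
    { intros; apply Dh. } { intros; apply Ch. }
    rewrite !Hk in E. ring_simplify (y + d - y) in E.
    assert (Ke : k (y + d) - k y = d / Derive h c) by (apply Rmult_eq_reg_l with (Derive h c); [rewrite <- E; field|]; apply Nz).
    rewrite Ke. replace (d / Derive h c / d) with (/ Derive h c) by (field; auto).
    apply (Hdel c).
    assert (Rabs (c - k y) <= Rabs (k (y + d) - k y)).
    { revert Hc. unfold Rmin, Rmax, Rabs. repeat destruct Rle_dec; repeat destruct Rcase_abs; lra. }
    assert (Rabs (k (y + d) - k y) * m <= Rabs d).
    { replace (Rabs d) with (Rabs (k (y + d) - k y) * Rabs (Derive h c)).
      - apply Rmult_le_compat_l; [apply Rabs_pos|]. apply Rle_trans with (2 := Rle_abs _), Hd.
      - rewrite <- Rabs_mult, Rmult_comm, <- E. reflexivity. }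
    change (Rabs (c - k y) < del).
    apply Rmult_lt_reg_l with m; [easy|]. nra. }
  exists k. do 3 (split; [easy|]).
  intros n. induction n as [|n IH].
  - intros y. apply (ex_derive_continuous k). eexists. apply Dk.
  - apply Ck_of_derive with (fun y => / Derive h (k y)); [easy|].
    apply Ck_inv; [easy|]. apply Ck_comp; [now apply smooth_derive|easy].
Qed.

Lemma Ck_Rplus {V : NormedModule R_AbsRing} n (f g : V -> R) :
  Ck n f -> Ck n g -> Ck n (fun x => f x + g x).
Proof. exact (Ck_plus n f g). Qed.

Lemma Ck_sin {V : NormedModule R_AbsRing} n (f : V -> R) : Ck n f -> Ck n (fun x => sin (f x)).
Proof. apply (Ck_comp n _ f), smooth_sin_cos. Qed.

Lemma Ck_cos {V : NormedModule R_AbsRing} n (f : V -> R) : Ck n f -> Ck n (fun x => cos (f x)).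
Proof. apply (Ck_comp n _ f), smooth_sin_cos. Qed.

Lemma Ck_id n : Ck n (fun x : R => x).
Proof. apply Ck_linear, is_linear_id. Qed.

Ltac ck :=
  intros;
  first [ assumption
        | match goal with H : smooth ?f |- Ck _ ?f => exact (H _) end
        | apply Ck_const
        | apply Ck_id
        | apply Ck_Rplus; ck
        | apply Ck_minus; ck
        | apply Ck_mult; ck
        | apply Ck_opp; ck
        | apply Ck_sin; ck
        | apply Ck_cos; ck
        | match goal with H : smooth ?f |- Ck _ (fun x => ?f (@?g x)) =>
            apply (Ck_comp _ f g H); ck end
        | match goal with H : tower ?d |- Ck _ (fun x => ?d ?m (@?g x)) =>
            apply (Ck_comp_tower d _ m g H); ck end
        | idtac ].

Lemma Ck0_ex_RInt (f : R -> R) a b : Ck 0 f -> ex_RInt f a b.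
Proof. intros H. apply (ex_RInt_continuous f a b). intros z _. apply H. Qed.

Lemma bounded_on (f : R -> R) a b :
  Ck 0 f -> exists M, 0 <= M /\ forall x, a <= x <= b -> Rabs (f x) <= M.
Proof.
  intros Hf. destruct (Rle_dec a b) as [Hab|Hab].
  - destruct (continuity_ab_maj (fun x => Rabs (f x)) a b Hab) as [x [Hx _]].
    + intros c _. apply (continuity_pt_comp f Rabs); [|apply Rcontinuity_abs].
      apply continuity_pt_filterlim, (Hf c).
    + exists (Rabs (f x)). split; [apply Rabs_pos|easy].
  - exists 0. split; [lra|]. intros; lra.
Qed.

Lemma taylor_bound (d : nat -> R -> R) m a e K M :
  tower d -> Rabs a <= K -> Rabs (a + e) <= K ->
  (forall x, - K <= x <= K -> Rabs (d (S (S m)) x) <= M) ->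
  Rabs (d m (a + e) - d m a - e * d (S m) a) <= M * e ^ 2.
Proof.
  intros Hd Ha Hae HM.
  assert (C : forall n x, continuity_pt (d n) x).
  { intros n x. apply continuity_pt_filterlim, (ex_derive_continuous (d n) x). eexists. apply Hd. }
  destruct (MVT_gen (d m) a (a + e) (d (S m))) as [c [Hc E]]; [intros; apply Hd|intros; apply C|].
  destruct (MVT_gen (d (S m)) a c (d (S (S m)))) as [c' [Hc' E']]; [intros; apply Hd|intros; apply C|].
  replace (d m (a + e) - d m a - e * d (S m) a) with (d (S (S m)) c' * ((c - a) * e)).
  2: { replace (d m (a + e)) with (d (S m) c * e + d m a) by lra.
       replace (d (S m) c) with (d (S (S m)) c' * (c - a) + d (S m) a) by lra. ring. }
  assert (Hcc : Rabs (c - a) <= Rabs e /\ - K <= c' <= K).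
  { revert Ha Hae Hc Hc'. unfold Rmin, Rmax, Rabs.
    repeat destruct Rle_dec; repeat destruct Rcase_abs; lra. }
  destruct Hcc as [Hca Hck].
  rewrite Rabs_mult, Rabs_mult. replace (e ^ 2) with (Rabs e * Rabs e) by (rewrite <- Rabs_mult, Rabs_pos_eq; nra).
  apply Rmult_le_compat; try apply Rabs_pos; [|now apply HM|].
  - apply Rmult_le_pos; apply Rabs_pos.
  - apply Rmult_le_compat_r; [apply Rabs_pos|easy].
Qed.

(** * Integrals over the circle *)

(* With [g t = t / (2 PI)] this extends the primitives of zero-mean functions of
   the angle to functions that are smooth in (U, W) on the whole plane, which is
   how maps on the unit tangent bundle have to be written. *)
Definition circle_int (g f : R -> R) (A U W : R) : R :=
  RInt (fun t => g t * f (A + (W * cos t + U * sin t))) 0 (2 * PI).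

Notation R3 := (prod_NormedModule R_AbsRing R_NormedModule
  (prod_NormedModule R_AbsRing R_NormedModule R_NormedModule)).

Lemma is_linear_R3 (a b c : R) :
  is_linear (fun q : R3 => fst q * a + fst (snd q) * b + snd (snd q) * c : R_NormedModule).
Proof.
  split.
  - intros [x [y z]] [x' [y' z']]. real_eq. cbn. unfold plus; cbn. ring.
  - intros k [x [y z]]. real_eq. cbn. unfold scal; cbn. unfold mult; cbn. ring.
  - exists (Rabs a + Rabs b + Rabs c + 1). split.
    + pose proof (Rabs_pos a). pose proof (Rabs_pos b). pose proof (Rabs_pos c). lra.
    + intros q.
      pose proof (norm_le_prod_norm_1 q). pose proof (norm_le_prod_norm_2 q).
      pose proof (norm_le_prod_norm_1 (snd q)). pose proof (norm_le_prod_norm_2 (snd q)).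
      pose proof (norm_ge_0 q).
      set (N := norm q) in *.
      change (norm (fst q)) with (Rabs (fst q)) in *.
      change (norm (fst (snd q))) with (Rabs (fst (snd q))) in *.
      change (norm (snd (snd q))) with (Rabs (snd (snd q))) in *.
      change (Rabs (fst q * a + fst (snd q) * b + snd (snd q) * c) <= (Rabs a + Rabs b + Rabs c + 1) * N).
      eapply Rle_trans; [apply Rabs_triang|].
      eapply Rle_trans; [apply Rplus_le_compat_r, Rabs_triang|].
      rewrite !Rabs_mult.
      pose proof (Rabs_pos a). pose proof (Rabs_pos b). pose proof (Rabs_pos c).
      assert (Rabs (fst (snd q)) <= N) by (eapply Rle_trans; eassumption).
      assert (Rabs (snd (snd q)) <= N) by (eapply Rle_trans; eassumption).
      nra.
Qed.

Lemma Rabs_wave A U W t : Rabs (A + (W * cos t + U * sin t)) <= Rabs A + Rabs U + Rabs W.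
Proof.
  pose proof (COS_bound t). pose proof (SIN_bound t).
  eapply Rle_trans; [apply Rabs_triang|].
  eapply Rle_trans; [apply Rplus_le_compat_l, Rabs_triang|].
  rewrite !Rabs_mult.
  assert (Rabs (cos t) <= 1) by (apply Rabs_le; lra).
  assert (Rabs (sin t) <= 1) by (apply Rabs_le; lra).
  pose proof (Rabs_pos U). pose proof (Rabs_pos W). nra.
Qed.

(** A quadratic remainder, uniform in [t], integrates to a quadratic remainder: this differentiates
    under the integral sign in all three variables at once. *)
Lemma circle_int_taylor (g : R -> R) (d : nat -> R -> R) m A U W :
  Ck 0 g -> tower d -> exists C, 0 < C /\ forall A' U' W' N,
  Rabs A' <= N -> Rabs U' <= N -> Rabs W' <= N -> N <= 1 ->
  Rabs (circle_int g (d m) (A + A') (U + U') (W + W') - circle_int g (d m) A U W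
    - (A' * circle_int g (d (S m)) A U W
       + U' * circle_int (fun t => g t * sin t) (d (S m)) A U W
       + W' * circle_int (fun t => g t * cos t) (d (S m)) A U W)) <= C * N ^ 2.
Proof.
  intros Hg Hd. pose proof PI_RGT_0.
  (* For [N <= 1] the perturbation moves the argument of [d m] by at most [3 * N <= 3], hence the
     margin in [K]; the square of this 3 is the 9 in the constant below, and the added 1 makes that
     constant positive. *)
  set (K := Rabs A + Rabs U + Rabs W + 3).
  destruct (bounded_on (d (S (S m))) (- K) K) as [M [HM0 HM]].
  { apply smooth_tower; easy. }
  destruct (bounded_on g 0 (2 * PI) Hg) as [G [HG0 HG]].
  exists (2 * PI * (G * (M * 9)) + 1). split.
  { assert (0 <= G * (M * 9)) by (apply Rmult_le_pos; lra). nra. }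
  intros A' U' W' N HA HU HW HN.
  set (w := fun t => A + (W * cos t + U * sin t)).
  set (e := fun t => A' + (W' * cos t + U' * sin t)).
  set (f0 := fun t => g t * d m (w t + e t)).
  set (f1 := fun t => g t * d m (w t)).
  set (f2 := fun t => g t * d (S m) (w t)).
  set (f3 := fun t => g t * sin t * d (S m) (w t)).
  set (f4 := fun t => g t * cos t * d (S m) (w t)).
  assert (I : forall f, Ck 0 f -> ex_RInt f 0 (2 * PI)) by (intros; now apply Ck0_ex_RInt).
  assert (C0 : Ck 0 f0) by (unfold f0, w, e; ck).
  assert (C1 : Ck 0 f1) by (unfold f1, w; ck).
  assert (C2 : Ck 0 f2) by (unfold f2, w; ck).
  assert (C3 : Ck 0 f3) by (unfold f3, w; ck).
  assert (C4 : Ck 0 f4) by (unfold f4, w; ck).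
  assert (E : circle_int g (d m) (A + A') (U + U') (W + W') - circle_int g (d m) A U W
    - (A' * circle_int g (d (S m)) A U W
       + U' * circle_int (fun t => g t * sin t) (d (S m)) A U W
       + W' * circle_int (fun t => g t * cos t) (d (S m)) A U W)
    = RInt (fun t => f0 t - f1 t - (A' * f2 t + U' * f3 t + W' * f4 t)) 0 (2 * PI)).
  { symmetry. apply is_RInt_unique.
    assert (P0 : is_RInt f0 0 (2 * PI) (circle_int g (d m) (A + A') (U + U') (W + W'))).
    { unfold circle_int. rewrite (RInt_ext _ f0); [now apply (RInt_correct f0), I|].
      intros t _. unfold f0, w, e. do 2 f_equal. ring. }
    assert (P1 := RInt_correct f1 0 (2 * PI) (I _ C1)).
    assert (P2 := RInt_correct f2 0 (2 * PI) (I _ C2)).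
    assert (P3 := RInt_correct f3 0 (2 * PI) (I _ C3)).
    assert (P4 := RInt_correct f4 0 (2 * PI) (I _ C4)).
    apply (is_RInt_minus (fun t => f0 t - f1 t) (fun t => A' * f2 t + U' * f3 t + W' * f4 t)).
    - apply (is_RInt_minus f0 f1); easy.
    - apply (is_RInt_plus (fun t => A' * f2 t + U' * f3 t) (fun t => W' * f4 t)).
      + apply (is_RInt_plus (fun t => A' * f2 t) (fun t => U' * f3 t)).
        * now apply (is_RInt_scal f2).
        * now apply (is_RInt_scal f3).
      + now apply (is_RInt_scal f4). }
  rewrite E. clear E.
  apply Rle_trans with ((2 * PI - 0) * (G * (M * (3 * N) ^ 2))).
  2: { assert (0 <= N ^ 2) by nra. nra. }
  apply abs_RInt_le_const; [lra| |].
  - apply I. ck.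
  - intros t Ht.
    replace (f0 t - f1 t - (A' * f2 t + U' * f3 t + W' * f4 t))
      with (g t * (d m (w t + e t) - d m (w t) - e t * d (S m) (w t)))
      by (unfold f0, f1, f2, f3, f4, e; ring).
    assert (He : Rabs (e t) <= 3 * N).
    { eapply Rle_trans; [apply Rabs_wave|lra]. }
    assert (Hw : Rabs (w t) <= K - 3).
    { eapply Rle_trans; [apply Rabs_wave|unfold K; lra]. }
    rewrite Rabs_mult. apply Rmult_le_compat; try apply Rabs_pos; [now apply HG|].
    eapply Rle_trans; [apply (taylor_bound d m (w t) (e t) K M Hd)|].
    + lra.
    + eapply Rle_trans; [apply Rabs_triang|lra].
    + easy.
    + apply Rmult_le_compat_l; [easy|]. apply pow_maj_Rabs with (n := 2%nat) in He. easy.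
Qed.

Lemma filterdiff_circle_int (g : R -> R) (d : nat -> R -> R) m (p : R3) :
  Ck 0 g -> tower d ->
  filterdiff (fun q : R3 => circle_int g (d m) (fst q) (fst (snd q)) (snd (snd q)) : R_NormedModule)
    (locally p) (fun q : R3 =>
      fst q * circle_int g (d (S m)) (fst p) (fst (snd p)) (snd (snd p))
      + fst (snd q) * circle_int (fun t => g t * sin t) (d (S m)) (fst p) (fst (snd p)) (snd (snd p))
      + snd (snd q) * circle_int (fun t => g t * cos t) (d (S m)) (fst p) (fst (snd p)) (snd (snd p))).
Proof.
  intros Hg Hd. split; [apply is_linear_R3|].
  intros p' Hp'. apply is_filter_lim_locally_unique in Hp'. subst p'. intros eps.
  apply locally_le_locally_norm.
  destruct (circle_int_taylor g d m (fst p) (fst (snd p)) (snd (snd p)) Hg Hd) as [C [HC H]].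
  assert (Hd' : 0 < Rmin 1 (eps / C)).
  { apply Rmin_pos; [lra|]. apply Rdiv_lt_0_compat; [apply cond_pos|easy]. }
  exists (mkposreal _ Hd'). intros q Hq. unfold ball_norm in Hq. simpl in Hq.
  set (v := minus q p) in *.
  replace q with (plus p v).
  2: { unfold v. clear. destruct p as [p1 [p2 p3]], q as [q1 [q2 q3]].
       apply injective_projections; [|apply injective_projections]; cbn;
         unfold minus, plus, opp; cbn; ring. }
  pose proof (norm_le_prod_norm_1 v). pose proof (norm_le_prod_norm_2 v).
  pose proof (norm_le_prod_norm_1 (snd v)). pose proof (norm_le_prod_norm_2 (snd v)).
  pose proof (norm_ge_0 v).
  pose proof (Rmin_l 1 (eps / C)). pose proof (Rmin_r 1 (eps / C)).
  specialize (H (fst v) (fst (snd v)) (snd (snd v)) (norm v)).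
  eapply Rle_trans.
  { apply H; [easy| | |lra].
    - eapply Rle_trans; eassumption.
    - eapply Rle_trans; eassumption. }
  assert (norm v * C <= eps).
  { apply Rle_trans with (eps / C * C); [apply Rmult_le_compat_r; lra|]. right. field. lra. }
  nra.
Qed.

(** Differentiation raises [m] and multiplies the weight by 1, [sin] or [cos]. The family of
    integrals over all weights is closed under it, so the induction is general in [g] and [m]. *)
Lemma Ck_circle_int {V : NormedModule R_AbsRing} n m (g : R -> R) (d : nat -> R -> R)
    (A U W : V -> R) :
  Ck 0 g -> tower d -> Ck n A -> Ck n U -> Ck n W ->
  Ck n (fun x => circle_int g (d m) (A x) (U x) (W x)).
Proof.
  intros Hg Hd. revert m g Hg. induction n as [|n IH]; intros m g Hg HA HU HW.
  - intros x.
    apply (continuous_comp (fun x => (A x, (U x, W x)) : R3)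
      (fun q => circle_int g (d m) (fst q) (fst (snd q)) (snd (snd q)))).
    + apply (Ck_pair 0 A (fun x => (U x, W x))); [easy|]. now apply Ck_pair.
    + eapply (filterdiff_continuous (fun q : R3 => circle_int g (d m) (fst q) (fst (snd q)) (snd (snd q)))).
      eexists. now apply filterdiff_circle_int.
  - assert (HP : Ck (S n) (fun x => (A x, (U x, W x)) : R3)).
    { apply (Ck_pair (S n) A (fun x => (U x, W x))); [easy|]. now apply Ck_pair. }
    pose proof (Ck_le n A HA) as KA. pose proof (Ck_le n U HU) as KU.
    pose proof (Ck_le n W HW) as KW. clear HA HU HW.
    destruct HP as [dp [Hp Hp']].
    exists (fun x v => fst (dp x v) * circle_int g (d (S m)) (A x) (U x) (W x)
      + fst (snd (dp x v)) * circle_int (fun t => g t * sin t) (d (S m)) (A x) (U x) (W x)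
      + snd (snd (dp x v)) * circle_int (fun t => g t * cos t) (d (S m)) (A x) (U x) (W x)).
    split.
    + intros x.
      apply (filterdiff_comp' (fun x => (A x, (U x, W x)) : R3)
        (fun q => circle_int g (d m) (fst q) (fst (snd q)) (snd (snd q))) x (dp x) _ (Hp x)
        (filterdiff_circle_int g d m (A x, (U x, W x)) Hg Hd)).
    + intros v. specialize (Hp' v).
      assert (Ck n (fun x => fst (dp x v))).
      { apply (Ck_comp_linear n (fun q : R3 => fst q) (fun x => dp x v)); [apply is_linear_fst|easy]. }
      assert (K2 : Ck n (fun x => snd (dp x v))).
      { apply (Ck_comp_linear n (fun q : R3 => snd q) (fun x => dp x v)); [apply is_linear_snd|easy]. }
      assert (Ck n (fun x => fst (snd (dp x v)))).
      { refine (Ck_comp_linear n (fun q => fst q) (fun x => snd (dp x v)) _ K2). apply is_linear_fst. }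
      assert (Ck n (fun x => snd (snd (dp x v)))).
      { refine (Ck_comp_linear n (fun q => snd q) (fun x => snd (dp x v)) _ K2). apply is_linear_snd. }
      apply Ck_Rplus; [apply Ck_Rplus|]; apply Ck_mult; try easy; apply IH; try easy; ck.
Qed.

Lemma RInt_Rmult (c : R) (f : R -> R) a b :
  Ck 0 f -> RInt (fun t => c * f t) a b = c * RInt f a b.
Proof. intros Hf. apply (RInt_scal f a b c). now apply Ck0_ex_RInt. Qed.

Lemma RInt_Rplus (f g : R -> R) a b :
  Ck 0 f -> Ck 0 g -> RInt (fun t => f t + g t) a b = RInt f a b + RInt g a b.
Proof. intros Hf Hg. apply (RInt_plus f g a b); now apply Ck0_ex_RInt. Qed.

Lemma RInt_Rminus (f g : R -> R) a b :
  Ck 0 f -> Ck 0 g -> RInt (fun t => f t - g t) a b = RInt f a b - RInt g a b.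
Proof. intros Hf Hg. apply (RInt_minus f g a b); now apply Ck0_ex_RInt. Qed.

Lemma derive_zero_const (f df : R -> R) :
  (forall x, is_derive f x (df x)) -> (forall x, df x = 0) -> forall x y, f x = f y.
Proof.
  intros Hf H0 x y. destruct (MVT_gen f x y df) as [c [_ E]].
  - intros; apply Hf.
  - intros t _. apply continuity_pt_filterlim, (ex_derive_continuous f t). now exists (df t).
  - rewrite H0 in E. lra.
Qed.

Lemma is_derive_primitive (h : R -> R) a x :
  Ck 0 h -> is_derive (fun x => RInt h a x) x (h x).
Proof.
  intros Hh. apply is_derive_RInt with a; [|apply Hh].
  apply filter_forall. intros y. now apply (RInt_correct h), Ck0_ex_RInt.
Qed.

Lemma primitive_sub (h : R -> R) a b :
  Ck 0 h -> RInt h a b = RInt h 0 b - RInt h 0 a.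
Proof.
  intros Hh.
  pose proof (RInt_Chasles h 0 a b (Ck0_ex_RInt _ _ _ Hh) (Ck0_ex_RInt _ _ _ Hh)) as E.
  change (RInt h 0 a + RInt h a b = RInt h 0 b) in E. lra.
Qed.

Lemma RInt_translate (h : R -> R) c a b :
  Ck 0 h -> RInt (fun t => h (c + t)) a b = RInt h (c + a) (c + b).
Proof.
  intros Hh. pose proof (RInt_comp_lin h 1 c a b (Ck0_ex_RInt _ _ _ Hh)) as E.
  replace (1 * a + c) with (c + a) in E by ring.
  replace (1 * b + c) with (c + b) in E by ring.
  rewrite <- E. apply RInt_ext. intros t _.
  change (h (c + t) = 1 * h (1 * t + c)). rewrite !Rmult_1_l. now rewrite Rplus_comm.
Qed.

Lemma is_derive_shift (f : R -> R) c x l :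
  is_derive f (x + c) l -> is_derive (fun y => f (y + c)) x l.
Proof.
  intros H. rewrite <- (Rmult_1_l l). apply (is_derive_comp f (fun y => y + c)); [easy|].
  auto_derive; [easy|ring].
Qed.

Lemma RInt_periodic (h : R -> R) c :
  Ck 0 h -> (forall x, h (x + 2 * PI) = h x) ->
  RInt (fun t => h (c + t)) 0 (2 * PI) = RInt h 0 (2 * PI).
Proof.
  intros Hh Hp. rewrite RInt_translate by easy. rewrite (primitive_sub h (c + 0)) by easy.
  rewrite Rplus_0_r.
  replace (RInt h 0 (2 * PI)) with (RInt h 0 (0 + 2 * PI) - RInt h 0 0).
  2: { rewrite RInt_point, Rplus_0_l. change (RInt h 0 (2 * PI) - 0 = RInt h 0 (2 * PI)). ring. }
  apply (derive_zero_const (fun c => RInt h 0 (c + 2 * PI) - RInt h 0 c)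
    (fun x => h (x + 2 * PI) - h x)); intros x; [|rewrite Hp; ring].
  apply (is_derive_minus (fun x => RInt h 0 (x + 2 * PI)) (fun x => RInt h 0 x)).
  - apply (is_derive_shift (fun x => RInt h 0 x)). now apply is_derive_primitive.
  - now apply is_derive_primitive.
Qed.

(* The sawtooth [t / (2 PI)] is a convolution inverse of the derivative modulo
   constants. *)
Lemma is_derive_sawtooth (h : R -> R) x :
  Ck 0 h -> (forall x, h (x + 2 * PI) = h x) ->
  is_derive (fun a => RInt (fun t => t / (2 * PI) * h (a + t)) 0 (2 * PI)) x
    (h x - / (2 * PI) * RInt h 0 (2 * PI)).
Proof.
  intros Hh Hp. pose proof PI_RGT_0 as Hpi.
  set (h1 := fun t => t * h t).
  assert (Hh1 : Ck 0 h1) by (unfold h1; ck).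
  set (H1 := fun x => RInt h1 0 x).
  (* Moving the variable by [a] turns the integral into one of [(t - a) * h t / (2 PI)] over
     [[a, a + 2 PI]], where [a] occurs only in the bounds and as a factor. The jump of [t * h t]
     across a period is [2 PI * h]. *)
  apply (is_derive_ext (fun a =>
    / (2 * PI) * ((H1 (a + 2 * PI) - H1 a) - a * RInt h 0 (2 * PI)))).
  - intros a. real_eq.
    assert (E0 : RInt h 0 (2 * PI) = RInt h a (a + 2 * PI)).
    { rewrite <- (RInt_periodic h a Hh Hp), RInt_translate by easy. now rewrite Rplus_0_r. }
    assert (E1 : H1 (a + 2 * PI) - H1 a = RInt h1 a (a + 2 * PI)).
    { symmetry. now apply primitive_sub. }
    rewrite E0, E1.
    rewrite <- RInt_Rmult by easy. rewrite <- RInt_Rminus by ck.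
    set (k := fun t => h1 t - a * h t). assert (Hk : Ck 0 k) by (unfold k; ck).
    assert (Hka : Ck 0 (fun t => k (a + t))).
    { intros t. apply (continuous_comp (fun t => a + t) k); [|apply Hk].
      apply (Ck_Rplus 0 (fun _ => a) (fun t => t)); ck. }
    replace (RInt k a (a + 2 * PI)) with (RInt k (a + 0) (a + 2 * PI)) by now rewrite Rplus_0_r.
    rewrite <- (RInt_translate k a 0 (2 * PI)) by easy.
    rewrite <- RInt_Rmult by easy.
    apply RInt_ext. intros t _. real_eq. unfold k, h1. field. lra.
  - replace (h x - / (2 * PI) * RInt h 0 (2 * PI)) with
      (/ (2 * PI) * ((h1 (x + 2 * PI) - h1 x) - 1 * RInt h 0 (2 * PI))).
    2: { unfold h1. rewrite Hp. field. lra. }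
    apply (is_derive_scal (fun a => (H1 (a + 2 * PI) - H1 a) - a * RInt h 0 (2 * PI))).
    apply (is_derive_minus (fun a => H1 (a + 2 * PI) - H1 a) (fun a => a * RInt h 0 (2 * PI))).
    + apply (is_derive_minus (fun a => H1 (a + 2 * PI)) H1).
      * apply (is_derive_shift H1). now apply is_derive_primitive.
      * now apply is_derive_primitive.
    + generalize (RInt h 0 (2 * PI)); intros M. auto_derive; [easy|ring].
Qed.

Lemma quasi_periodic_Z (f : R -> R) T c (k : Z) x :
  (forall x, f (x + T) = f x + c) -> f (x + T * IZR k) = f x + c * IZR k.
Proof.
  intros Hf.
  assert (Hn : forall n x, f (x + T * INR n) = f x + c * INR n).
  { induction n as [|n IH]; intros y.
    - simpl. replace (y + T * 0) with y by ring. ring.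
    - rewrite S_INR. replace (y + T * (INR n + 1)) with (y + T * INR n + T) by ring.
      rewrite Hf, IH. ring. }
  destruct (Z_le_gt_dec 0 k) as [Hk|Hk].
  - rewrite <- (Z2Nat.id k Hk), <- INR_IZR_INZ. apply Hn.
  - replace (IZR k) with (- INR (Z.to_nat (- k))).
    2: { rewrite INR_IZR_INZ, Z2Nat.id by lia. rewrite opp_IZR. ring. }
    pose proof (Hn (Z.to_nat (- k)) (x + T * - INR (Z.to_nat (- k)))) as E.
    replace (x + T * - INR (Z.to_nat (- k)) + T * INR (Z.to_nat (- k))) with x in E by ring.
    lra.
Qed.

Lemma unit_circle_angle u w : u ^ 2 + w ^ 2 = 1 -> exists phi, u = cos phi /\ w = sin phi.
Proof.
  intros H. assert (Hu : -1 <= u <= 1) by nra.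
  assert (S : sqrt (1 - u²) = Rabs w).
  { replace (1 - u²) with (w²) by (unfold Rsqr; lra). apply sqrt_Rsqr_abs. }
  destruct (Rle_dec 0 w).
  - exists (acos u). rewrite cos_acos, sin_acos, S, Rabs_pos_eq by lra. easy.
  - exists (- acos u). rewrite cos_neg, sin_neg, cos_acos, sin_acos, S, Rabs_left by lra.
    split; ring.
Qed.

Lemma cos_eq_1_iff s : cos s = 1 <-> exists n : Z, s = 2 * PI * IZR n.
Proof.
  replace (cos s) with (1 - 2 * sin (s / 2) * sin (s / 2)).
  2: { rewrite <- cos_2a_sin. f_equal. field. }
  split.
  - intros H. assert (E : sin (s / 2) = 0) by nra.
    apply sin_eq_0_0 in E. destruct E as [k E]. exists k. lra.
  - intros [n ->]. replace (2 * PI * IZR n / 2) with (IZR n * PI) by field.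
    rewrite (sin_eq_0_1 (IZR n * PI)); [ring|]. now exists n.
Qed.

(** * Flat Zoll systems *)

Definition flat_comp (i j : axis) (_ : point) : R :=
  match i, j with dir_x, dir_x | dir_y, dir_y => 1 | _, _ => 0 end.

Lemma flat_comp_fun i j : torus_fun (flat_comp i j).
Proof.
  split; [|easy]. intros n.
  exact (Ck_const n (flat_comp i j (0, 0))).
Qed.

Lemma flat_comp_sym i j p : flat_comp i j p = flat_comp j i p.
Proof. now destruct i, j. Qed.

Lemma flat_comp_pos p v : v <> (0, 0) -> 0 < bilin flat_comp p v v.
Proof.
  destruct v as [v w]. unfold bilin, sum_axis; simpl. intros H.
  destruct (Req_dec v 0) as [->|]; [|nra].
  destruct (Req_dec w 0) as [->|]; [easy|nra].
Qed.

Definition flat : metric := Metric flat_comp flat_comp_fun flat_comp_sym flat_comp_pos.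

Lemma unit_tangent_flat x y u w : unit_tangent flat ((x, y), (u, w)) <-> u ^ 2 + w ^ 2 = 1.
Proof.
  unfold unit_tangent, inner, bilin, sum_axis; simpl.
  replace (_ + _ + _) with (u * (u * 1) + w * (w * 1)) by ring. easy.
Qed.

Lemma christoffel_const (g : metric) :
  (forall i j p q, Defs.comp g i j p = Defs.comp g i j q) ->
  forall k i j p, christoffel g k i j p = 0.
Proof.
  intros H k i j p.
  assert (E : forall i j l, partial l (Defs.comp g i j) p = 0).
  { intros i' j' l. unfold partial. destruct l.
    - rewrite (Derive_ext _ (fun _ => Defs.comp g i' j' p)); [apply Derive_const|]. intros; apply H.
    - rewrite (Derive_ext _ (fun _ => Defs.comp g i' j' p)); [apply Derive_const|]. intros; apply H. }
  unfold christoffel, sum_axis. rewrite !E. ring.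
Qed.

Lemma magnetic_geodesic_flat (b : point -> R) (x y u w du dw : R -> R) :
  smooth x -> smooth y ->
  (forall t, is_derive x t (u t)) -> (forall t, is_derive y t (w t)) ->
  (forall t, is_derive u t (du t)) -> (forall t, is_derive w t (dw t)) ->
  (forall t, u t ^ 2 + w t ^ 2 = 1) ->
  (forall t, u t * dw t - w t * du t = b (x t, y t)) ->
  magnetic_geodesic flat b (fun t => (x t, y t)) /\
  forall t, velocity (fun t => (x t, y t)) t = (u t, w t).
Proof.
  intros Sx Sy Dx Dy Du Dw Huw Hb.
  assert (Ev : forall t, velocity (fun t => (x t, y t)) t = (u t, w t)).
  { intros t. unfold velocity; simpl. f_equal; apply is_derive_unique; [apply Dx|apply Dy]. }
  split; [split; [|split]|easy].
  - intros n. now apply Ck_pair.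
  - intros t. rewrite Ev. now apply (unit_tangent_flat (x t) (y t)).
  - intros t. rewrite <- Hb. unfold geodesic_curvature, area_form, cov_accel, cov_accel_coord.
    replace (sqrt (det_metric flat (x t, y t))) with 1.
    2: { symmetry. replace (det_metric _ _) with 1; [apply sqrt_1|]. unfold det_metric; simpl. ring. }
    unfold sum_axis. rewrite !(christoffel_const flat) by (intros [] []; easy).
    assert (Eu : Derive (fun s => coord dir_x (velocity (fun t => (x t, y t)) s)) t = du t).
    { rewrite <- (is_derive_unique _ _ _ (Du t)). apply Derive_ext. intros s. now rewrite Ev. }
    assert (Ew : Derive (fun s => coord dir_y (velocity (fun t => (x t, y t)) s)) t = dw t).
    { rewrite <- (is_derive_unique _ _ _ (Dw t)). apply Derive_ext. intros s. now rewrite Ev. }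
    rewrite Eu, Ew, Ev. simpl. ring.
Qed.

(** * Rotation of the velocity as a circle action *)

Definition rot_u (s u w : R) : R := u * cos s - w * sin s.
Definition rot_w (s u w : R) : R := w * cos s + u * sin s.

Lemma rot_angle s phi :
  rot_u s (cos phi) (sin phi) = cos (phi + s) /\ rot_w s (cos phi) (sin phi) = sin (phi + s).
Proof. unfold rot_u, rot_w. rewrite cos_plus, sin_plus. split; ring. Qed.

(** The mean of [X' (z + r sin t)] over a turn. Along an orbit the time increment is [r X'] times
    the increment of the velocity angle, so [r] times this is the mean time per radian. *)
Definition mean_speed (X : R -> R) (r z : R) : R :=
  circle_int (fun _ => / (2 * PI)) (Derive X) z r 0.

(** At [(u, w) = (cos a, sin a)] the argument of [X'] is [z + r sin (a + t)], so this is a periodic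
    primitive in [a] of [X' (z + r sin a)] minus its mean. *)
Definition time_primitive (X : R -> R) (r z u w : R) : R :=
  circle_int (fun t => t / (2 * PI)) (Derive X) z (r * u) (r * w).

(** The same primitive for [sin a * X' (z + r sin a)], with [sin (a + t)] expanded so that the angle
    enters only through [u = cos a] and [w = sin a]. *)
Definition y_primitive (X : R -> R) (r z u w : R) : R :=
  w * circle_int (fun t => t / (2 * PI) * cos t) (Derive X) z (r * u) (r * w)
  + u * circle_int (fun t => t / (2 * PI) * sin t) (Derive X) z (r * u) (r * w).

(* The y-displacement over one turn of the velocity vanishes on all orbits. *)
Definition resonant (X : R -> R) (r : R) : Prop :=
  forall z, RInt (fun t => sin t * Derive X (z + r * sin t)) 0 (2 * PI) = 0.

(* Conserved along the orbits: beta (x) - r sin s, where s is the velocity angle. *)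
Definition center (beta : R -> R) (r : R) (v : tangent) : R :=
  beta (fst (fst v)) - r * snd (snd v).

(** The parameter is the rotation [s] of the velocity instead of time. The rotation is linear in
    [v], hence smooth off the unit circle as well; subtracting [y_primitive] at [v] makes the orbit
    start at height [y0]. *)
Definition orbit (X : R -> R) (r z y0 : R) (v : vec) (s : R) : tangent :=
  let u := rot_u s (fst v) (snd v) in
  let w := rot_w s (fst v) (snd v) in
  ((X (z + r * w), y0 + r * (y_primitive X r z u w - y_primitive X r z (fst v) (snd v))),
   (u, w)).

Definition rotation_action (X beta : R -> R) (r : R) (q : R * tangent) : tangent :=
  orbit X r (center beta r (snd q)) (snd (fst (snd q))) (snd (snd q)) (fst q).

(** A function with periodic derivative is its mean slope times [s] plus a periodic part;
    [mean_speed] gives the first and [time_primitive] the second. *)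
Definition rotation_time (X beta : R -> R) (r : R) (q : R * tangent) : R :=
  let z := center beta r (snd q) in
  let v := snd (snd q) in
  r * (fst q * mean_speed X r z
       + (time_primitive X r z (rot_u (fst q) (fst v) (snd v)) (rot_w (fst q) (fst v) (snd v))
          - time_primitive X r z (fst v) (snd v))).

Lemma Ck_mean_speed {V : NormedModule R_AbsRing} n (X : R -> R) r (z : V -> R) :
  smooth X -> Ck n z -> Ck n (fun q => mean_speed X r (z q)).
Proof.
  intros HX Hz.
  apply (Ck_circle_int n 0 (fun _ => / (2 * PI)) (Derive_n (Derive X)) z (fun _ => r) (fun _ => 0)).
  - ck.
  - now apply tower_Derive_n, smooth_derive.
  - easy.
  - ck.
  - ck.
Qed.

Lemma Ck_time_primitive {V : NormedModule R_AbsRing} n (X : R -> R) r (z u w : V -> R) :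
  smooth X -> Ck n z -> Ck n u -> Ck n w ->
  Ck n (fun q => time_primitive X r (z q) (u q) (w q)).
Proof.
  intros HX Hz Hu Hw.
  apply (Ck_circle_int n 0 (fun t => t / (2 * PI)) (Derive_n (Derive X)) z
    (fun q => r * u q) (fun q => r * w q)); try easy.
  - apply (Ck_mult 0 (fun t => t)); ck.
  - now apply tower_Derive_n, smooth_derive.
  - ck.
  - ck.
Qed.

Lemma Ck_y_primitive {V : NormedModule R_AbsRing} n (X : R -> R) r (z u w : V -> R) :
  smooth X -> Ck n z -> Ck n u -> Ck n w ->
  Ck n (fun q => y_primitive X r (z q) (u q) (w q)).
Proof.
  intros HX Hz Hu Hw. assert (HT := tower_Derive_n _ (smooth_derive X HX)).
  assert (HI : Ck 0 (fun t => t / (2 * PI))) by (apply (Ck_mult 0 (fun t => t)); ck).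
  apply Ck_Rplus; apply Ck_mult; try easy.
  - apply (Ck_circle_int n 0 (fun t => t / (2 * PI) * cos t) (Derive_n (Derive X)) z
      (fun q => r * u q) (fun q => r * w q)); try easy; ck.
  - apply (Ck_circle_int n 0 (fun t => t / (2 * PI) * sin t) (Derive_n (Derive X)) z
      (fun q => r * u q) (fun q => r * w q)); try easy; ck.
Qed.

Notation tangent_space := (prod_NormedModule R_AbsRing
  (prod_NormedModule R_AbsRing R_NormedModule R_NormedModule)
  (prod_NormedModule R_AbsRing R_NormedModule R_NormedModule)).

Lemma Ck_flow_coordinates n :
  let V := prod_NormedModule R_AbsRing R_NormedModule tangent_space in
  Ck n (fun q : V => fst q : R) /\ Ck n (fun q : V => fst (fst (snd q)) : R) /\
  Ck n (fun q : V => snd (fst (snd q)) : R) /\ Ck n (fun q : V => fst (snd (snd q)) : R) /\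
  Ck n (fun q : V => snd (snd (snd q)) : R).
Proof.
  intros V.
  assert (L1 : is_linear (fun q : V => fst q)) by apply is_linear_fst.
  assert (L2 : is_linear (fun q : V => snd q)) by apply is_linear_snd.
  assert (L3 := is_linear_comp _ _ L2 is_linear_fst).
  assert (L4 := is_linear_comp _ _ L2 is_linear_snd).
  repeat split; apply Ck_linear; try easy.
  - exact (is_linear_comp _ _ L3 is_linear_fst).
  - exact (is_linear_comp _ _ L3 is_linear_snd).
  - exact (is_linear_comp _ _ L4 is_linear_fst).
  - exact (is_linear_comp _ _ L4 is_linear_snd).
Qed.

Lemma smooth_rotation (X beta : R -> R) r :
  smooth X -> smooth beta ->
  smooth (rotation_action X beta r) /\ smooth (rotation_time X beta r).
Proof.
  intros HX Hb.
  assert (H : forall n, Ck n (rotation_action X beta r) /\ Ck n (rotation_time X beta r)).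
  2: { split; intros n; apply H. }
  intros n. destruct (Ck_flow_coordinates n) as [Hs [Hx [Hy [Hu Hw]]]].
  set (V := prod_NormedModule R_AbsRing R_NormedModule tangent_space) in *.
  set (z := fun q : V => center beta r (snd q)).
  set (u := fun q : V => rot_u (fst q) (fst (snd (snd q))) (snd (snd (snd q)))).
  set (w := fun q : V => rot_w (fst q) (fst (snd (snd q))) (snd (snd (snd q)))).
  assert (Hz : Ck n z).
  { apply (Ck_minus n (fun q : V => beta (fst (fst (snd q)))) (fun q => r * snd (snd (snd q)))).
    - now apply (Ck_comp n beta (fun q : V => fst (fst (snd q)))).
    - apply Ck_mult; [apply Ck_const|easy]. }
  assert (Hu' : Ck n u).
  { apply Ck_minus; apply Ck_mult; try easy; [now apply Ck_cos|now apply Ck_sin]. }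
  assert (Hw' : Ck n w).
  { apply Ck_Rplus; apply Ck_mult; try easy; [now apply Ck_cos|now apply Ck_sin]. }
  split.
  - apply (Ck_pair n (fun q : V => (X (z q + r * w q), snd (fst (snd q)) +
      r * (y_primitive X r (z q) (u q) (w q)
           - y_primitive X r (z q) (fst (snd (snd q))) (snd (snd (snd q))))))
      (fun q => (u q, w q))); [|now apply Ck_pair].
    apply (Ck_pair n (fun q : V => X (z q + r * w q))).
    + apply (Ck_comp n X); [easy|]. apply Ck_Rplus; [easy|]. apply Ck_mult; [apply Ck_const|easy].
    + apply Ck_Rplus; [easy|]. apply Ck_mult; [apply Ck_const|].
      apply Ck_minus; now apply Ck_y_primitive.
  - apply (Ck_mult n (fun _ : V => r)); [apply Ck_const|].
    apply Ck_Rplus.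
    + apply Ck_mult; [easy|]. now apply (Ck_mean_speed n X r z).
    + apply Ck_minus; now apply Ck_time_primitive.
Qed.

Lemma mean_speed_eq (X : R -> R) r z :
  smooth X ->
  mean_speed X r z = / (2 * PI) * RInt (fun t => Derive X (z + r * sin t)) 0 (2 * PI).
Proof.
  intros HX. pose proof (smooth_derive X HX).
  unfold mean_speed, circle_int. rewrite <- RInt_Rmult by ck.
  apply RInt_ext. intros t _. do 3 f_equal. ring.
Qed.

Lemma time_primitive_angle (X : R -> R) r z a :
  time_primitive X r z (cos a) (sin a)
  = RInt (fun t => t / (2 * PI) * Derive X (z + r * sin (a + t))) 0 (2 * PI).
Proof.
  unfold time_primitive, circle_int. apply RInt_ext. intros t _.
  rewrite sin_plus. do 3 f_equal. ring.
Qed.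

Lemma y_primitive_angle (X : R -> R) r z a :
  smooth X ->
  y_primitive X r z (cos a) (sin a)
  = RInt (fun t => t / (2 * PI) * (sin (a + t) * Derive X (z + r * sin (a + t)))) 0 (2 * PI).
Proof.
  intros HX. pose proof (smooth_derive X HX) as HX'.
  assert (HI : Ck 0 (fun t => t / (2 * PI))) by (apply (Ck_mult 0 (fun t => t)); ck).
  unfold y_primitive, circle_int.
  rewrite <- !RInt_Rmult, <- RInt_Rplus by ck.
  apply RInt_ext. intros t _. real_eq.
  rewrite sin_plus.
  replace (z + (r * sin a * cos t + r * cos a * sin t))
    with (z + r * (sin a * cos t + cos a * sin t)) by ring. ring.
Qed.

Lemma sin_periodic x : sin (x + 2 * PI) = sin x.
Proof. rewrite sin_plus, sin_2PI, cos_2PI. ring. Qed.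

Lemma is_derive_time_primitive (X : R -> R) r z phi s :
  smooth X ->
  is_derive (fun s => time_primitive X r z (cos (phi + s)) (sin (phi + s))) s
    (Derive X (z + r * sin (phi + s)) - mean_speed X r z).
Proof.
  intros HX. pose proof (smooth_derive X HX) as HX'.
  set (h := fun a => Derive X (z + r * sin a)).
  apply (is_derive_ext (fun s => RInt (fun t => t / (2 * PI) * h (s + phi + t)) 0 (2 * PI))).
  - intros t. rewrite time_primitive_angle. now rewrite (Rplus_comm phi).
  - rewrite mean_speed_eq by easy. rewrite (Rplus_comm phi s).
    apply (is_derive_shift (fun a => RInt (fun t => t / (2 * PI) * h (a + t)) 0 (2 * PI))).
    apply (is_derive_sawtooth h); unfold h; [ck|]. intros x. now rewrite sin_periodic.
Qed.

(** Resonance enters here: the sawtooth integral is a primitive up to the mean of the integrand, and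
    resonance says that this mean is zero. *)
Lemma is_derive_y_primitive (X : R -> R) r z phi s :
  smooth X -> resonant X r ->
  is_derive (fun s => y_primitive X r z (cos (phi + s)) (sin (phi + s))) s
    (sin (phi + s) * Derive X (z + r * sin (phi + s))).
Proof.
  intros HX Hr. pose proof (smooth_derive X HX) as HX'.
  set (h := fun a => sin a * Derive X (z + r * sin a)).
  apply (is_derive_ext (fun s => RInt (fun t => t / (2 * PI) * h (s + phi + t)) 0 (2 * PI))).
  - intros t. rewrite y_primitive_angle by easy. now rewrite (Rplus_comm phi).
  - rewrite (Rplus_comm phi s).
    replace (sin (s + phi) * Derive X (z + r * sin (s + phi)))
      with (h (s + phi) - / (2 * PI) * RInt h 0 (2 * PI)).
    2: { unfold h at 2. rewrite Hr. unfold h. ring. }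
    apply (is_derive_shift (fun a => RInt (fun t => t / (2 * PI) * h (a + t)) 0 (2 * PI))).
    apply (is_derive_sawtooth h); unfold h; [ck|]. intros x. now rewrite sin_periodic.
Qed.

Lemma is_derive_rotation_time (X beta : R -> R) r x y phi s :
  smooth X ->
  is_derive (fun s => rotation_time X beta r (s, ((x, y), (cos phi, sin phi)))) s
    (r * Derive X (beta x - r * sin phi + r * sin (phi + s))).
Proof.
  intros HX. set (z := beta x - r * sin phi).
  apply (is_derive_ext (fun s => r * (s * mean_speed X r z
    + (time_primitive X r z (cos (phi + s)) (sin (phi + s))
       - time_primitive X r z (cos phi) (sin phi))))).
  - intros t. unfold rotation_time, center; cbn [fst snd].
    destruct (rot_angle t phi) as [-> ->]. reflexivity.
  - apply (is_derive_scal (fun s => s * mean_speed X r z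
      + (time_primitive X r z (cos (phi + s)) (sin (phi + s))
         - time_primitive X r z (cos phi) (sin phi)))).
    replace (Derive X (z + r * sin (phi + s))) with
      (mean_speed X r z + (Derive X (z + r * sin (phi + s)) - mean_speed X r z - 0)) by ring.
    apply (is_derive_plus (fun s => s * mean_speed X r z)).
    + generalize (mean_speed X r z); intros M. auto_derive; [easy|ring].
    + apply (is_derive_minus (fun s => time_primitive X r z (cos (phi + s)) (sin (phi + s)))
        (fun _ => time_primitive X r z (cos phi) (sin phi))).
      * now apply is_derive_time_primitive.
      * apply (is_derive_const (time_primitive X r z (cos phi) (sin phi))).
Qed.

Lemma circle_int_shift (g f : R -> R) A U W T :
  (forall x, f (x + T) = f x) -> circle_int g f (A + T) U W = circle_int g f A U W.
Proof.
  intros Hf. unfold circle_int. apply RInt_ext. intros t _. f_equal.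
  rewrite <- (Hf (A + (W * cos t + U * sin t))). f_equal. ring.
Qed.

Lemma derive_quasi_periodic (X : R -> R) T c x :
  (forall x, X (x + T) = X x + c) -> smooth X -> Derive X (x + T) = Derive X x.
Proof.
  intros HT HX. symmetry. apply is_derive_unique.
  apply (is_derive_ext (fun y => X (y + T) - c)).
  - intros t. real_eq. rewrite HT. ring.
  - replace (Derive X (x + T)) with (Derive X (x + T) - 0) by ring.
    apply (is_derive_minus (fun y => X (y + T)) (fun _ => c)).
    + apply (is_derive_shift X). now apply smooth_is_derive.
    + apply (is_derive_const c).
Qed.

Lemma rot_0 u w : rot_u 0 u w = u /\ rot_w 0 u w = w.
Proof. unfold rot_u, rot_w. rewrite sin_0, cos_0. split; ring. Qed.

Lemma same_tangent_eq v w : v = w -> same_tangent v w.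
Proof.
  intros <-. exists 0%Z, 0%Z. destruct v as [[x y] w]. unfold Defs.shift; cbn [fst snd].
  now rewrite Rmult_0_r, !Rplus_0_r.
Qed.

Lemma rotation_shift (X beta : R -> R) r s x y u w (i j : Z) :
  smooth X ->
  (forall x, beta (x + 2 * PI) = beta x + 2 * PI) ->
  (forall z, X (z + 2 * PI) = X z + 2 * PI) ->
  rotation_action X beta r (s, (Defs.shift i j (x, y), (u, w))) =
    (Defs.shift i j (fst (rotation_action X beta r (s, ((x, y), (u, w))))),
     snd (rotation_action X beta r (s, ((x, y), (u, w))))) /\
  rotation_time X beta r (s, (Defs.shift i j (x, y), (u, w))) =
    rotation_time X beta r (s, ((x, y), (u, w))).
Proof.
  intros HX Hb HXp.
  assert (Ez : center beta r (Defs.shift i j (x, y), (u, w))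
    = center beta r ((x, y), (u, w)) + 2 * PI * IZR i).
  { unfold center, Defs.shift; cbn [fst snd]. rewrite (quasi_periodic_Z beta _ _ i x Hb). ring. }
  assert (HD : forall z, Derive X (z + 2 * PI * IZR i) = Derive X z).
  { intros z. rewrite (quasi_periodic_Z (Derive X) (2 * PI) 0).
    - ring.
    - intros t. rewrite (derive_quasi_periodic X _ _ t HXp HX). ring. }
  unfold rotation_action, rotation_time, orbit. cbn [fst snd]. rewrite Ez.
  set (z := center beta r ((x, y), (u, w))). cbn [fst snd].
  unfold mean_speed, time_primitive, y_primitive. rewrite !circle_int_shift by easy.
  split; [|easy].
  unfold Defs.shift; cbn [fst snd].
  replace (z + 2 * PI * IZR i + r * rot_w s u w) with (z + r * rot_w s u w + 2 * PI * IZR i) by ring.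
  rewrite (quasi_periodic_Z X _ _ i _ HXp).
  apply injective_projections; [|easy]. apply injective_projections; [easy|].
  cbn [fst snd]. ring.
Qed.

(** The group law holds because [center] is constant along an orbit and the differences of
    [y_primitive] telescope. Freeness is read off from the velocity, which is rotated by [s]. *)
Lemma rotation_action_free (X beta : R -> R) r :
  smooth X -> smooth beta ->
  (forall x, X (beta x) = x) -> (forall z, beta (X z) = z) ->
  (forall z, X (z + 2 * PI) = X z + 2 * PI) ->
  (forall x, beta (x + 2 * PI) = beta x + 2 * PI) ->
  free_circle_action flat (rotation_action X beta r).
Proof.
  intros HX Hb Xb bX HXp Hbp.
  assert (id_at : forall s v, cos s = 1 -> sin s = 0 -> rotation_action X beta r (s, v) = v).
  { intros s [[x y] [u w]] Hc Hs.
    unfold rotation_action, orbit, center; cbn [fst snd].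
    replace (rot_u s u w) with u by (unfold rot_u; rewrite Hc, Hs; ring).
    replace (rot_w s u w) with w by (unfold rot_w; rewrite Hc, Hs; ring).
    replace (beta x - r * w + r * w) with (beta x) by ring.
    rewrite Xb. do 2 f_equal. ring. }
  split; [|split; [|split; [|split; [|split]]]].
  - now apply smooth_rotation.
  - intros s [[x y] [u w]] H. apply unit_tangent_flat in H.
    apply unit_tangent_flat. cbn [fst snd]. unfold rot_u, rot_w.
    pose proof (sin2_cos2 s) as E. unfold Rsqr in E.
    replace (_ + _) with ((u ^ 2 + w ^ 2) * (sin s * sin s + cos s * cos s)) by ring.
    rewrite H, E. ring.
  - intros s [[x y] [u w]] v' _ [i [j ->]]. exists i, j. cbn [fst snd].
    now apply rotation_shift.
  - intros v _. apply same_tangent_eq, id_at; [apply cos_0|apply sin_0].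
  - intros s t [[x y] [u w]] _.
    apply same_tangent_eq.
    set (z := beta x - r * w).
    assert (Ez : center beta r (rotation_action X beta r (t, ((x, y), (u, w)))) = z).
    { unfold center, rotation_action, orbit; cbn [fst snd]. rewrite bX.
      unfold center; cbn [fst snd]. fold z. ring. }
    set (v := rotation_action X beta r (t, ((x, y), (u, w)))) in *.
    change (orbit X r z y (u, w) (s + t) = orbit X r (center beta r v) (snd (fst v)) (snd v) s).
    rewrite Ez. unfold v, rotation_action, orbit, center; cbn [fst snd]. fold z.
    replace (rot_u (s + t) u w) with (rot_u s (rot_u t u w) (rot_w t u w))
      by (unfold rot_u, rot_w; rewrite cos_plus, sin_plus; ring).
    replace (rot_w (s + t) u w) with (rot_w s (rot_u t u w) (rot_w t u w))
      by (unfold rot_u, rot_w; rewrite cos_plus, sin_plus; ring).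
    do 2 f_equal. ring.
  - intros s [[x y] [u w]] H. apply unit_tangent_flat in H. split.
    + intros [i [j E]]. apply cos_eq_1_iff.
      apply (f_equal snd) in E. cbn [fst snd] in E.
      unfold rotation_action, orbit in E; cbn [fst snd] in E.
      pose proof (f_equal fst E) as E1. pose proof (f_equal snd E) as E2.
      cbn [fst snd] in E1, E2. unfold rot_u in E1. unfold rot_w in E2.
      (* The scalar product of a unit vector with its rotation by [s] is [cos s]. *)
      replace (cos s) with (u * (u * cos s - w * sin s) + w * (w * cos s + u * sin s)).
      * rewrite <- E1, <- E2. lra.
      * transitivity ((u ^ 2 + w ^ 2) * cos s); [ring|]. rewrite H. ring.
    + intros Hs. assert (Hc : cos s = 1) by now apply cos_eq_1_iff.
      apply same_tangent_eq, id_at; [easy|].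
      pose proof (sin2_cos2 s) as E. unfold Rsqr in E. nra.
Qed.

Lemma rotation_time_change (X beta : R -> R) r m :
  0 < r -> smooth X -> smooth beta -> 0 < m -> (forall z, m <= Derive X z) ->
  (forall z, X (z + 2 * PI) = X z + 2 * PI) ->
  (forall x, beta (x + 2 * PI) = beta x + 2 * PI) ->
  time_change flat (rotation_time X beta r).
Proof.
  intros Hr HX Hb Hm HXm HXp Hbp. split; [now apply smooth_rotation|].
  intros [[x y] [u w]] H. apply unit_tangent_flat in H. split; [|split].
  - unfold rotation_time; cbn [fst snd]. destruct (rot_0 u w) as [-> ->]. ring.
  - intros s. destruct (unit_circle_angle u w H) as [phi [-> ->]].
    eapply Rlt_le_trans.
    2: { right. symmetry. apply (is_derive_unique _ _ _ (is_derive_rotation_time X beta r x y phi s HX)). }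
    apply Rmult_lt_0_compat; [easy|]. eapply Rlt_le_trans; [exact Hm|apply HXm].
  - intros s v' [i [j ->]]. cbn [fst snd]. now apply rotation_shift.
Qed.

Lemma smooth_rotation_time_angle (X beta : R -> R) r x y phi :
  smooth X -> smooth (fun s => rotation_time X beta r (s, ((x, y), (cos phi, sin phi)))).
Proof.
  intros HX. set (z := beta x - r * sin phi). intros n.
  apply (Ck_ext n (fun s => r * (s * mean_speed X r z
    + (time_primitive X r z (cos (phi + s)) (sin (phi + s))
       - time_primitive X r z (cos phi) (sin phi))))).
  - intros t. unfold rotation_time, center; cbn [fst snd].
    destruct (rot_angle t phi) as [-> ->]. reflexivity.
  - apply Ck_mult; [apply Ck_const|].
    apply Ck_Rplus; [apply Ck_mult; [apply Ck_id|apply Ck_const]|].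
    apply Ck_minus; [|apply Ck_const].
    apply (Ck_time_primitive n X r (fun _ => z)); ck.
Qed.

(** Slowing the rotation by the factor [r X'] makes [(u, w)] the true velocity of the orbit and
    [1 / (r X')] its turning rate, which is the prescribed curvature. The flow is thus the rotation
    action run along the inverse of the time change. *)
Lemma zoll_flat (X beta : R -> R) r m :
  0 < r -> smooth X -> smooth beta ->
  (forall x, X (beta x) = x) -> (forall z, beta (X z) = z) ->
  0 < m -> (forall z, m <= Derive X z) ->
  (forall z, X (z + 2 * PI) = X z + 2 * PI) ->
  resonant X r -> zoll flat (fun p => / r * / Derive X (beta (fst p))).
Proof.
  intros Hr HX Hb Xb bX Hm HXm HXp Hres.
  assert (Hbp : forall x, beta (x + 2 * PI) = beta x + 2 * PI).
  { intros x. rewrite <- (Xb x) at 1. now rewrite <- HXp, bX. }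
  set (T := rotation_time X beta r).
  (* The inverse of [T] in its first variable, picked by choice for all [v] at once. On unit vectors
     the derivative of [T] is at least [r * m], so this is a genuine smooth inverse; for other
     vectors the value is arbitrary. *)
  set (S := fun t v => epsilon (inhabits 0) (fun s => T (s, v) = t)).
  assert (HS : forall v, unit_tangent flat v -> exists phi,
    snd v = (cos phi, sin phi) /\ (forall t, T (S t v, v) = t) /\
    (forall s, S (T (s, v)) v = s) /\ smooth (fun t => S t v) /\
    forall t, is_derive (fun t => S t v) t
      (/ (r * Derive X (center beta r v + r * sin (phi + S t v))))).
  { intros [[x y] [u w]] H. apply unit_tangent_flat in H.
    destruct (unit_circle_angle u w H) as [phi [-> ->]].
    pose proof (fun s => is_derive_rotation_time X beta r x y phi s HX) as DT.
    fold T in DT.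
    exists phi. split; [easy|].
    set (v := ((x, y), (cos phi, sin phi)) : tangent).
    destruct (smooth_inverse (fun s => T (s, v)) (r * m)) as [k [kT [Tk [Dk Sk]]]].
    - now apply Rmult_lt_0_compat.
    - now apply smooth_rotation_time_angle.
    - intros s. eapply Rle_trans.
      2: { right. symmetry. apply (is_derive_unique _ _ _ (DT s)). }
      apply Rmult_le_compat_l; [lra|apply HXm].
    - assert (ES : forall t, S t v = k t).
      { intros t. rewrite <- (kT (S t v)). f_equal.
        apply (epsilon_spec (inhabits 0) (fun s => T (s, v) = t)). exists (k t). apply Tk. }
      split; [|split; [|split]].
      + intros t. rewrite ES. apply Tk.
      + intros s. rewrite ES. apply kT.
      + apply smooth_ext with k; [|easy]. intros t. symmetry. apply ES.
      + intros t. apply (is_derive_ext k); [intros; symmetry; apply ES|].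
        rewrite ES. specialize (Dk t).
        replace (Derive (fun s => T (s, v)) (k t)) with
          (r * Derive X (center beta r v + r * sin (phi + k t))) in Dk; [exact Dk|].
        symmetry. apply (is_derive_unique _ _ _ (DT (k t))). }
  exists (fun t v => rotation_action X beta r (S t v, v)), T, (rotation_action X beta r).
  split; [|split; [|split]].
  - intros v Hv. destruct (HS v Hv) as [phi [Ev [TS [ST [SS DS]]]]].
    destruct v as [[x0 y0] v]. simpl in Ev. subst v.
    set (v := ((x0, y0), (cos phi, sin phi)) : tangent) in *.
    set (z := center beta r v) in *.
    set (k := fun t => S t v) in *.
    set (x := fun t => X (z + r * sin (phi + k t))).
    set (y := fun t => y0 + r * (y_primitive X r z (cos (phi + k t)) (sin (phi + k t))
      - y_primitive X r z (cos phi) (sin phi))).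
    set (u := fun t => cos (phi + k t)). set (w := fun t => sin (phi + k t)).
    set (dk := fun t => / (r * Derive X (z + r * sin (phi + k t)))).
    assert (Dk : forall t, is_derive (fun t => phi + k t) t (dk t)).
    { intros t. rewrite <- (Rplus_0_l (dk t)).
      apply (is_derive_plus (fun _ => phi) k); [apply (is_derive_const phi)|apply DS]. }
    assert (Nz : forall z, Derive X z <> 0) by (intros z'; specialize (HXm z'); lra).
    assert (Du : forall t, is_derive u t (- w t * dk t)).
    { intros t. rewrite Rmult_comm.
      apply (is_derive_comp cos (fun t => phi + k t)); [apply is_derive_cos|apply Dk]. }
    assert (Dw : forall t, is_derive w t (u t * dk t)).
    { intros t. rewrite Rmult_comm.
      apply (is_derive_comp sin (fun t => phi + k t)); [apply is_derive_sin|apply Dk]. }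
    destruct (magnetic_geodesic_flat (fun p => / r * / Derive X (beta (fst p)))
      x y u w (fun t => - w t * dk t) (fun t => u t * dk t)) as [G1 G2]; try easy.
    + intros n. unfold x. ck.
    + intros n. unfold y. apply Ck_Rplus; [apply Ck_const|]. apply Ck_mult; [apply Ck_const|].
      apply Ck_minus; [|apply Ck_const].
      apply (Ck_y_primitive n X r (fun _ => z)); ck.
    + intros t. replace (u t) with ((0 + r * (u t * dk t)) * Derive X (z + r * w t)).
      2: { unfold dk. fold (w t). field. split; [apply Nz|lra]. }
      apply (is_derive_comp X (fun t => z + r * w t)).
      * now apply smooth_is_derive.
      * apply (is_derive_plus (fun _ => z) (fun t => r * w t)); [apply (is_derive_const z)|].
        now apply (is_derive_scal w).
    + intros t.
      replace (w t) with (0 + r * (dk t * (sin (phi + k t) * Derive X (z + r * sin (phi + k t))) - 0)).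
      2: { unfold dk. fold (w t). field. split; [apply Nz|lra]. }
      apply (is_derive_plus (fun _ => y0)); [apply (is_derive_const y0)|].
      apply (is_derive_scal (fun t => y_primitive X r z (cos (phi + k t)) (sin (phi + k t))
        - y_primitive X r z (cos phi) (sin phi))).
      apply (is_derive_minus (fun t => y_primitive X r z (cos (phi + k t)) (sin (phi + k t)))
        (fun _ => y_primitive X r z (cos phi) (sin phi))).
      2: apply (is_derive_const (y_primitive X r z (cos phi) (sin phi))).
      apply (is_derive_comp (fun s => y_primitive X r z (cos (phi + s)) (sin (phi + s))) k).
      * now apply is_derive_y_primitive.
      * apply DS.
    + intros t. unfold u, w. pose proof (sin2_cos2 (phi + k t)) as E. unfold Rsqr in E. lra.
    + intros t. cbn [fst]. unfold x. rewrite bX.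
      pose proof (sin2_cos2 (phi + k t)) as E. unfold Rsqr in E.
      transitivity ((sin (phi + k t) * sin (phi + k t) + cos (phi + k t) * cos (phi + k t)) * dk t).
      { unfold u, w. ring. }
      rewrite E. unfold dk. field. split; [apply Nz|lra].
    + exists (fun t => (x t, y t)). split; [exact G1|].
      assert (GT : forall t, rotation_action X beta r (S t v, v)
        = tangent_lift (fun t => (x t, y t)) t).
      { intros t. unfold tangent_lift. rewrite G2.
        change (rotation_action X beta r (S t v, v)) with (orbit X r z y0 (cos phi, sin phi) (k t)).
        unfold orbit; cbn [fst snd].
        destruct (rot_angle (k t) phi) as [-> ->]. reflexivity. }
      split; [|exact GT].
      rewrite <- GT.
      assert (S0 : S 0 v = 0).
      { rewrite <- (ST 0) at 2. f_equal. unfold T, rotation_time, v; cbn [fst snd].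
        destruct (rot_0 (cos phi) (sin phi)) as [-> ->]. ring. }
      rewrite S0.
      change (orbit X r z y0 (cos phi, sin phi) 0 = v). unfold orbit; cbn [fst snd].
      destruct (rot_0 (cos phi) (sin phi)) as [-> ->].
      replace (z + r * sin phi) with (beta x0) by (unfold z, center, v; cbn [fst snd]; ring).
      rewrite Xb. apply injective_projections; [|easy].
      apply injective_projections; cbn [fst snd v]; ring.
  - now apply rotation_time_change with m.
  - now apply rotation_action_free.
  - intros s v Hv. destruct (HS v Hv) as [phi [_ [_ [ST _]]]].
    rewrite ST. now apply same_tangent_eq.
Qed.

(** * The Bessel function *)

(** Translation by half a period preserves the integral and changes its sign. *)
Lemma RInt_antiperiodic (h : R -> R) :
  Ck 0 h -> (forall t, h (t + PI) = - h t) -> RInt h 0 (2 * PI) = 0.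
Proof.
  intros Hh Ha.
  assert (Hp : forall t, h (t + 2 * PI) = h t).
  { intros t. replace (t + 2 * PI) with (t + PI + PI) by ring. rewrite !Ha. ring. }
  pose proof (RInt_periodic h PI Hh Hp) as E.
  rewrite (RInt_ext _ (fun t => -1 * h t)) in E.
  - rewrite RInt_Rmult in E by easy. lra.
  - intros t _. rewrite Rplus_comm, Ha. real_eq. ring.
Qed.

Definition bessel_re (x : R) : R := RInt (fun u => sqrt (1 - u ^ 2) * cos (x * u)) (-1) 1.

Lemma Ck0_semicircle : Ck 0 (fun u => sqrt (1 - u ^ 2)).
Proof.
  intros u. apply (continuous_comp (fun u => 1 - u ^ 2) sqrt); [|apply continuous_sqrt].
  apply (ex_derive_continuous (fun u => 1 - u ^ 2)). auto_derive. easy.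
Qed.

Lemma sin_shift_PI t : sin (t + PI) = - sin t.
Proof. rewrite sin_plus, sin_PI, cos_PI. ring. Qed.

(** The substitution [u = sin t] on the half circle turns [bessel_re] into the integral of
    [cos^2 t * cos (x sin t)], and an integration by parts produces the integrand on the left. Its
    period [PI] accounts for the factor 2. *)
Lemma RInt_sin_sin (x : R) :
  RInt (fun t => sin t * sin (x * sin t)) 0 (2 * PI) = 2 * (x * bessel_re x).
Proof.
  pose proof PI_RGT_0 as Hpi.
  set (h := fun t => sin t * sin (x * sin t)).
  assert (Hh : Ck 0 h) by (unfold h; ck).
  assert (HPI : forall t, h (t + PI) = h t).
  { intros t. unfold h. rewrite sin_shift_PI. replace (x * - sin t) with (- (x * sin t)) by ring.
    rewrite sin_neg. ring. }
  set (c := fun t => cos t * cos t * cos (x * sin t)).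
  assert (Hc : Ck 0 c) by (unfold c; ck).
  assert (Half : RInt h (- (PI / 2)) (PI / 2) = x * bessel_re x).
  { assert (Eb : bessel_re x = RInt c (- (PI / 2)) (PI / 2)).
    { unfold bessel_re. set (f := fun u => sqrt (1 - u ^ 2) * cos (x * u)).
      pose proof (RInt_comp f sin cos (- (PI / 2)) (PI / 2)) as E.
      rewrite sin_neg, sin_PI2 in E. replace (- (1)) with (-1) in E by ring. rewrite <- E; clear E.
      - apply RInt_ext. intros t Ht. rewrite Rmin_left, Rmax_right in Ht by lra.
        change (cos t * (sqrt (1 - sin t ^ 2) * cos (x * sin t)) = c t).
        replace (sqrt (1 - sin t ^ 2)) with (cos t); [unfold c; ring|].
        symmetry. replace (1 - sin t ^ 2) with (Rsqr (cos t)).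
        + apply sqrt_Rsqr. apply cos_ge_0; lra.
        + rewrite cos2. unfold Rsqr. ring.
      - intros t _. unfold f. apply (Ck_mult 0 (fun u => sqrt (1 - u ^ 2)) (fun u => cos (x * u))).
        + apply Ck0_semicircle.
        + ck.
      - intros t _. split; [apply is_derive_sin|apply continuous_cos]. }
    rewrite Eb, <- RInt_Rmult by easy.
    (* The integrand is the derivative of [cos t * sin (x * sin t)], which vanishes at both ends. *)
    assert (Z : RInt (fun t => x * c t - h t) (- (PI / 2)) (PI / 2) = 0).
    { apply is_RInt_unique.
      replace 0 with (minus (cos (PI / 2) * sin (x * sin (PI / 2)))
        (cos (- (PI / 2)) * sin (x * sin (- (PI / 2))))).
      - apply (is_RInt_derive (fun t => cos t * sin (x * sin t))).
        + intros t _. unfold c, h. auto_derive; [easy|ring].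
        + intros t _. apply (Ck_minus 0 (fun t => x * c t) h); ck.
      - rewrite cos_neg, cos_PI2. unfold minus, plus, opp; simpl. ring. }
    rewrite RInt_Rminus in Z by ck. lra. }
  rewrite <- Half.
  rewrite <- (RInt_periodic h (- (PI / 2))) by
    (try easy; intros t; replace (t + 2 * PI) with (t + PI + PI) by ring; now rewrite !HPI).
  rewrite RInt_translate by easy.
  rewrite (primitive_sub h (- (PI / 2) + 0)) by easy.
  rewrite (primitive_sub h (- (PI / 2))) by easy.
  assert (E : RInt h (PI + - (PI / 2)) (PI + PI / 2) = RInt h (- (PI / 2)) (PI / 2)).
  { rewrite <- (RInt_translate h PI) by easy. apply RInt_ext. intros t _.
    rewrite Rplus_comm. apply HPI. }
  rewrite (primitive_sub h (PI + - (PI / 2))), (primitive_sub h (- (PI / 2))) in E by easy.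
  replace (PI + - (PI / 2)) with (PI / 2) in E by field.
  replace (PI + PI / 2) with (- (PI / 2) + 2 * PI) in E by field.
  rewrite Rplus_0_r. lra.
Qed.

Lemma bessel_im_zero (x : R) : RInt (fun u => sqrt (1 - u ^ 2) * - sin (x * u)) (-1) 1 = 0.
Proof.
  set (f := fun u => sqrt (1 - u ^ 2) * - sin (x * u)).
  assert (Hf : Ck 0 f).
  { apply (Ck_mult 0 (fun u => sqrt (1 - u ^ 2)) (fun u => - sin (x * u))); [apply Ck0_semicircle|ck]. }
  pose proof (RInt_comp_lin f (-1) 0 (-1) 1 (Ck0_ex_RInt _ _ _ Hf)) as E.
  replace (-1 * -1 + 0) with 1 in E by ring. replace (-1 * 1 + 0) with (-1) in E by ring.
  rewrite (RInt_ext _ f) in E.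
  - rewrite (primitive_sub f (-1)), (primitive_sub f 1) in * by easy. real_eq. lra.
  - intros u _. change (-1 * f (-1 * u + 0) = f u). unfold f.
    replace ((-1 * u + 0) ^ 2) with (u ^ 2) by ring.
    replace (x * (-1 * u + 0)) with (- (x * u)) by ring. rewrite sin_neg. ring.
Qed.

(** Bessel's integral representation, with the kernel that appears in the Fourier coefficients of
    the displacement. *)
Lemma J1_eq (x : R) :
  J1 x = RtoC (/ (2 * PI) * RInt (fun t => sin t * sin (x * sin t)) 0 (2 * PI)).
Proof.
  rewrite RInt_sin_sin. pose proof PI_RGT_0.
  unfold J1.
  rewrite (is_RInt_unique (V := C_R_CompleteNormedModule) _ (-1) 1 (bessel_re x, 0)).
  - apply injective_projections; simpl; field; lra.
  - rewrite <- (bessel_im_zero x).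
    apply (is_RInt_fct_extend_pair (U := R_NormedModule) (V := R_NormedModule)); simpl.
    + apply (is_RInt_ext (fun u => sqrt (1 - u ^ 2) * cos (x * u))).
      { intros u _. simpl. real_eq. ring. }
      apply (RInt_correct (fun u => sqrt (1 - u ^ 2) * cos (x * u))).
      apply Ck0_ex_RInt. apply Ck_mult; [apply Ck0_semicircle|ck].
    + apply (is_RInt_ext (fun u => sqrt (1 - u ^ 2) * - sin (x * u))).
      { intros u _. simpl. real_eq. ring. }
      apply (RInt_correct (fun u => sqrt (1 - u ^ 2) * - sin (x * u))).
      apply Ck0_ex_RInt. apply Ck_mult; [apply Ck0_semicircle|ck].
Qed.

Lemma J1_eq_0_iff (x : R) :
  J1 x = RtoC 0 <-> RInt (fun t => sin t * sin (x * sin t)) 0 (2 * PI) = 0.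
Proof.
  pose proof PI_RGT_0. rewrite J1_eq. split.
  - intros E. apply RtoC_inj in E. apply Rmult_integral in E. destruct E as [E|E]; [|easy].
    exfalso. revert E. apply Rinv_neq_0_compat. lra.
  - intros E. rewrite E. f_equal. ring.
Qed.

(** * Flexibility *)

(** A primitive of [1 + cos (k z) / 2]. The amplitude 1/2 keeps the derivative at least 1/2, so this
    lifts a diffeomorphism of the circle. *)
Definition sine_chart (k : nat) (z : R) : R := z + / (2 * INR k) * sin (INR k * z).

Lemma smooth_sine_chart k : smooth (sine_chart k).
Proof. intros n. unfold sine_chart. ck. Qed.

Lemma Derive_sine_chart k z :
  (1 <= k)%nat -> Derive (sine_chart k) z = 1 + / 2 * cos (INR k * z).
Proof.
  intros Hk. apply le_INR in Hk. simpl in Hk. apply is_derive_unique. unfold sine_chart.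
  auto_derive; [easy|]. field. lra.
Qed.

Lemma sine_chart_shift k z :
  (1 <= k)%nat -> sine_chart k (z + 2 * PI) = sine_chart k z + 2 * PI.
Proof.
  intros Hk. unfold sine_chart.
  replace (INR k * (z + 2 * PI)) with (INR k * z + 2 * INR k * PI) by ring.
  rewrite sin_period. ring.
Qed.

(** At radius [xi / k] the oscillating part is [cos (k z + xi sin t)]. Its expansion leaves the
    terms [f] and [g], which change sign under [t -> t + PI], and a multiple of the Bessel integral
    at [xi]. *)
Lemma sine_chart_resonant k xi :
  (1 <= k)%nat -> J1 xi = RtoC 0 -> resonant (sine_chart k) (/ INR k * xi).
Proof.
  intros Hk HJ z. pose proof (le_INR _ _ Hk) as Hk'. simpl in Hk'.
  apply J1_eq_0_iff in HJ.
  pose (f := fun t => sin t). set (g := fun t => sin t * cos (xi * sin t)).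
  set (h := fun t => sin t * sin (xi * sin t)). fold h in HJ.
  assert (Cf : Ck 0 f) by (unfold f; ck).
  assert (Cg : Ck 0 g) by (unfold g; ck).
  assert (Ch : Ck 0 h) by (unfold h; ck).
  rewrite (RInt_ext _ (fun t => f t + / 2 * (cos (INR k * z) * g t - sin (INR k * z) * h t))).
  2: { intros t _. real_eq. rewrite Derive_sine_chart by easy.
       replace (INR k * (z + / INR k * xi * sin t)) with (INR k * z + xi * sin t) by (field; lra).
       rewrite cos_plus. unfold f, g, h. ring. }
  rewrite RInt_Rplus, RInt_Rmult, RInt_Rminus, !RInt_Rmult by ck.
  assert (If : RInt f 0 (2 * PI) = 0) by (apply RInt_antiperiodic; [easy|apply sin_shift_PI]).
  assert (Ig : RInt g 0 (2 * PI) = 0).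
  { apply RInt_antiperiodic; [easy|]. intros t. unfold g. rewrite sin_shift_PI.
    replace (xi * - sin t) with (- (xi * sin t)) by ring. rewrite cos_neg. ring. }
  rewrite HJ, If, Ig. real_eq. ring.
Qed.

Lemma flexible_at_scaled_zeros (k : nat) :
  (1 <= k)%nat -> zoll_flexible rot_invariant (scale_set (/ INR k) R_star).
Proof.
  intros Hk Hrigid. pose proof (le_INR _ _ Hk) as Hk'. simpl in Hk'. pose proof PI_RGT_0.
  set (X := sine_chart k) in *.
  assert (HX : smooth X) by apply smooth_sine_chart.
  assert (HXm : forall z, / 2 <= Derive X z).
  { intros z. unfold X. rewrite Derive_sine_chart by easy.
    pose proof (COS_bound (INR k * z)). lra. }
  assert (HXp : forall z, X (z + 2 * PI) = X z + 2 * PI) by (intros; now apply sine_chart_shift).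
  destruct (smooth_inverse X (/ 2) ltac:(lra) HX HXm) as [beta [bX [Xb [Db Sb]]]].
  assert (Hbp : forall x, beta (x + 2 * PI) = beta x + 2 * PI).
  { intros x. rewrite <- (Xb x) at 1. now rewrite <- HXp, bX. }
  set (b := fun x => / Derive X (beta x)).
  assert (Nz : forall x, Derive X (beta x) <> 0) by (intros x; specialize (HXm (beta x)); lra).
  assert (Hb : smooth b).
  { intros n. apply (Ck_inv n (fun x => Derive X (beta x))); [easy|].
    apply Ck_comp; [now apply smooth_derive|apply Sb]. }
  destruct (Hrigid flat (fun p => b (fst p))) as [_ [B HB]].
  - exists (fun _ => 1), b. split; [|split; [|split; [|split]]].
    + split; [intros n; apply Ck_const|easy].
    + split; [easy|]. intros x. unfold b. rewrite Hbp.
      now rewrite (derive_quasi_periodic X (2 * PI) (2 * PI)).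
    + intros p. simpl. repeat split; ring.
    + easy.
    (* The average condition: [b] is the derivative of [beta], which increases by 2 pi over a
       period. *)
    + transitivity (2 * PI).
      * rewrite (RInt_ext _ b) by (intros; real_eq; ring).
        apply is_RInt_unique.
        replace (2 * PI) with (minus (beta (2 * PI)) (beta 0)) at 2.
        { apply (is_RInt_derive beta b); [intros; apply Db|].
          intros x _. now apply (smooth_continuous b x). }
        change (beta (2 * PI) - beta 0 = 2 * PI).
        rewrite <- (Rplus_0_l (2 * PI)) at 1. rewrite Hbp. ring.
      * rewrite RInt_const. real_eq. unfold scal; simpl. unfold mult; simpl. ring.
  - intros r [xi [[Hxi HJ] ->]].
    apply (zoll_flat X beta (/ INR k * xi) (/ 2)); try easy; [|lra|].
    + apply Rmult_lt_0_compat; [|easy]. apply Rinv_0_lt_compat. lra.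
    + now apply sine_chart_resonant.
  (* At these two points [cos (k z)] is 1 and -1, so [b] takes the values 2/3 and 2. *)
  - pose proof (HB (X 0, 0)) as E0. pose proof (HB (X (PI / INR k), 0)) as E1.
    cbn [fst] in E0, E1. unfold b in E0, E1. rewrite bX in E0, E1.
    unfold X in E0, E1. rewrite Derive_sine_chart in E0, E1 by easy.
    rewrite Rmult_0_r, cos_0 in E0.
    replace (INR k * (PI / INR k)) with PI in E1 by (field; lra). rewrite cos_PI in E1.
    assert (/ (1 + / 2 * 1) = 2 / 3) by field. assert (/ (1 + / 2 * -1) = 2) by field. lra.
Qed.

(** * Closed orbits of a Zoll system *)

Lemma integer_valued_constant (f : R -> R) :
  Ck 0 f -> (forall t, exists n : Z, f t = 2 * PI * IZR n) -> forall s t, f s = f t.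
Proof.
  intros Hf Hn. pose proof PI_RGT_0.
  assert (C : continuity f) by (intros x; apply continuity_pt_filterlim, (Hf x)).
  assert (L : forall s t, ~ f s < f t).
  { intros s t Hlt. destruct (Hn s) as [m Hm], (Hn t) as [n Hn'].
    assert (IZR m < IZR n) by (apply Rmult_lt_reg_l with (2 * PI); lra).
    assert (Hmn : (m + 1 <= n)%Z) by (apply lt_IZR in H0; lia).
    apply IZR_le in Hmn. rewrite plus_IZR in Hmn.
    (* [f s + PI] is an odd multiple of [PI]: it lies between the values [f s] and [f t] but cannot
       be attained, by parity. *)
    destruct (IVT_gen f s t (f s + PI) C) as [x [_ Hx]].
    - rewrite Rmin_left, Rmax_right by lra. split; [lra|].
      rewrite Hm, Hn'. nra.
    - destruct (Hn x) as [k Hk].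
      assert (E : 2 * IZR m + 1 = 2 * IZR k).
      { apply Rmult_eq_reg_l with PI; lra. }
      rewrite <- !mult_IZR, <- plus_IZR in E. apply eq_IZR in E. lia. }
  intros s t. destruct (Rtotal_order (f s) (f t)) as [|[|]]; [|easy|]; exfalso; eapply L; eassumption.
Qed.

(* The y-displacement D over a period is continuous in the orbit and a multiple
   of 2 pi, hence constant along paths of unit tangent vectors. *)
Lemma zoll_displacement (g : metric) (b : point -> R) :
  zoll g b -> exists T D : tangent -> R,
    (forall v, unit_tangent g v -> 0 < T v /\
      exists c, magnetic_geodesic g b c /\ tangent_lift c 0 = v /\
        snd (c (T v)) = snd (fst v) + D v /\ velocity c (T v) = snd v) /\
    forall v : R -> tangent_space, (forall s, continuous v s) ->
      (forall s, unit_tangent g (v s)) -> forall s t, D (v s) = D (v t).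
Proof.
  intros [Phi [sigma [theta [HPhi [[Ssig Hsig] [[Sth [H1 [H2 [H3 [H4 H5]]]]] Hconj]]]]]].
  pose proof PI_RGT_0 as Hpi.
  assert (H2pi : forall v, unit_tangent g v -> same_tangent (theta (2 * PI, v)) v).
  { intros v Hv. apply H5; [easy|]. exists 1%Z. ring. }
  assert (Cth : forall w : R -> prod_NormedModule R_AbsRing R_NormedModule tangent_space,
    (forall s, continuous w s) -> Ck 0 (fun s => snd (fst (theta (w s))))).
  { intros w Hw.
    assert (C0 : Ck 0 (fun s => theta (w s) : tangent_space)).
    { intros s. apply (continuous_comp w theta); [apply Hw|]. now apply (smooth_continuous theta). }
    refine (Ck_comp_linear 0 (fun q => snd q) (fun s => fst (theta (w s))) is_linear_snd _).
    refine (Ck_comp_linear 0 (fun q => fst q) (fun s => theta (w s)) is_linear_fst C0). }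
  exists (fun v => sigma (2 * PI, v)).
  (* [D] is read off from [theta], which is jointly smooth, because no continuity of [Phi] in [v] is
     given. The value at parameter 0 is subtracted since [theta (0, v)] equals [v] only modulo the
     lattice. *)
  exists (fun v => snd (fst (theta (2 * PI, v))) - snd (fst (theta (0, v)))).
  split.
  - intros v Hv. destruct (Hsig v Hv) as [S0 [S1 _]]. change (sigma (0, v) = 0) in S0. split.
    + assert (K : Ck 1 (fun s => sigma (s, v))) by (apply (Ck_slice (V := tangent_space) 1 sigma v), Ssig).
      destruct (Ck_derive 0 _ K) as [Ex _].
      destruct (MVT_gen (fun s => sigma (s, v)) 0 (2 * PI) (Derive (fun s => sigma (s, v)))) as [s [_ E]].
      * intros; now apply Derive_correct.
      * intros s _. apply continuity_pt_filterlim, (ex_derive_continuous _ s (Ex s)).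
      * assert (P : 0 < sigma (2 * PI, v) - sigma (0, v)).
        { eapply Rlt_le_trans; [|right; symmetry; exact E].
          apply Rmult_lt_0_compat; [apply S1|lra]. }
        rewrite S0, Rminus_0_r in P. exact P.
    + destruct (HPhi v Hv) as [c [Hc [c0 Ec]]]. exists c. split; [easy|]. split; [easy|].
      assert (Cc : Ck 0 (fun t => snd (c t))).
      { refine (Ck_comp_linear 0 (fun q => snd q) c is_linear_snd _). apply Hc. }
      (* [theta] and the lifted geodesic agree up to lattice translations only, but along one orbit
         the translation in y is continuous in [s], hence the same at 0 and at 2 pi. *)
      assert (Hs : forall s, exists n : Z,
        snd (c (sigma (s, v))) - snd (fst (theta (s, v))) = 2 * PI * IZR n).
      { intros s. destruct (Hconj s v Hv) as [m [n E]]. exists n.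
        rewrite Ec in E. apply (f_equal fst) in E. cbn [fst snd tangent_lift] in E.
        rewrite E. unfold Defs.shift; cbn [fst snd]. ring. }
      assert (Cs : Ck 0 (fun s => snd (c (sigma (s, v))) - snd (fst (theta (s, v))))).
      { apply Ck_minus.
        - intros s. apply (continuous_comp (fun s => sigma (s, v)) (fun t => snd (c t))); [|apply Cc].
          apply (Ck_slice (V := tangent_space) 0 sigma v), Ssig.
        - apply (Cth (fun s => (s, v))). apply (Ck_pair 0 (fun s : R => s) (fun _ => v : tangent_space)).
          + apply Ck_id.
          + apply Ck_const. }
      assert (E : snd (c (sigma (2 * PI, v))) - snd (fst (theta (2 * PI, v)))
        = snd (c (sigma (0, v))) - snd (fst (theta (0, v))))
        by exact (integer_valued_constant _ Cs Hs (2 * PI) 0).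
      rewrite S0 in E. split.
      * apply (f_equal fst) in c0. cbn [fst tangent_lift] in c0. rewrite c0 in E.
        assert (K : forall p q p' q', p - q = p' - q' -> p = p' + (q - q')) by (intros; lra).
        exact (K _ _ _ _ E).
      * destruct (Hconj (2 * PI) v Hv) as [m [n E']]. rewrite Ec in E'.
        destruct (H2pi v Hv) as [m' [n' E'']].
        apply (f_equal snd) in E'. apply (f_equal snd) in E''.
        exact (eq_trans E' (eq_sym E'')).
  - intros v Cv Hv. apply integer_valued_constant.
    + apply Ck_minus.
      * apply (Cth (fun s => (2 * PI, v s))). apply (Ck_pair 0 (fun _ => 2 * PI) v); [apply Ck_const|easy].
      * apply (Cth (fun s => (0, v s))). apply (Ck_pair 0 (fun _ => 0) v); [apply Ck_const|easy].
    + intros t. destruct (H2pi (v t) (Hv t)) as [m [n E]]. destruct (H3 (v t) (Hv t)) as [m' [n' E']].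
      apply (f_equal (fun q => snd (fst q))) in E, E'.
      exists (n' - n)%Z. rewrite minus_IZR.
      assert (K : forall p q q' N N', p = q + 2 * PI * N -> p = q' + 2 * PI * N' ->
        q - q' = 2 * PI * (N' - N)) by (intros; lra).
      exact (K _ _ _ _ _ E E').
Qed.

(** * Rotationally invariant metrics *)

Definition warped (g : metric) (a : R -> R) : Prop :=
  forall p, Defs.comp g dir_x dir_x p = 1 /\ Defs.comp g dir_x dir_y p = 0 /\
            Defs.comp g dir_y dir_y p = a (fst p) ^ 2.

Lemma unit_tangent_warped (g : metric) a p u w :
  warped g a -> (unit_tangent g (p, (u, w)) <-> u ^ 2 + (a (fst p) * w) ^ 2 = 1).
Proof.
  intros Hg. destruct (Hg p) as [E1 [E2 E3]]. pose proof (comp_sym g dir_x dir_y p) as E4.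
  unfold unit_tangent, inner, bilin, sum_axis; cbn [fst snd coord].
  rewrite <- E4, E1, E2, E3.
  replace (_ + _ + _) with (u ^ 2 + (a (fst p) * w) ^ 2) by ring. easy.
Qed.

Lemma christoffel_warped (g : metric) (a : R -> R) p :
  warped g a -> smooth a -> 0 < a (fst p) ->
  let a0 := a (fst p) in let da := Derive a (fst p) in
  forall k i j, christoffel g k i j p =
    match k, i, j with
    | dir_x, dir_y, dir_y => - (a0 * da)
    | dir_y, dir_x, dir_y | dir_y, dir_y, dir_x => da / a0
    | _, _, _ => 0
    end.
Proof.
  intros Hg Ha Hpos a0 da.
  assert (E4 : forall p, Defs.comp g dir_y dir_x p = 0).
  { intros q. rewrite (comp_sym g dir_y dir_x q). apply Hg. }
  assert (Pc : forall i j l c, (forall q, Defs.comp g i j q = c) -> partial l (Defs.comp g i j) p = 0).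
  { intros i j l c Hc. unfold partial.
    destruct l; rewrite (Derive_ext _ (fun _ => c)) by (intros; apply Hc); apply Derive_const. }
  assert (Pxx : forall l, partial l (Defs.comp g dir_x dir_x) p = 0) by (intros l; apply (Pc _ _ l 1), Hg).
  assert (Pxy : forall l, partial l (Defs.comp g dir_x dir_y) p = 0) by (intros l; apply (Pc _ _ l 0), Hg).
  assert (Pyx : forall l, partial l (Defs.comp g dir_y dir_x) p = 0) by (intros l; apply (Pc _ _ l 0), E4).
  assert (Pyyx : partial dir_x (Defs.comp g dir_y dir_y) p = 2 * (a0 * da)).
  { unfold partial. rewrite (Derive_ext _ (fun t => a t * a t)).
    - apply is_derive_unique. replace (2 * (a0 * da)) with (da * a0 + a0 * da) by ring.
      pose proof (smooth_is_derive a (fst p) Ha) as D.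
      apply (is_derive_mult a a); [exact D|exact D|exact Rmult_comm].
    - intros t. rewrite (proj2 (proj2 (Hg _))). cbn [fst]. ring. }
  assert (Pyyy : partial dir_y (Defs.comp g dir_y dir_y) p = 0).
  { unfold partial. rewrite (Derive_ext _ (fun t => a0 ^ 2)) by (intros; apply Hg). apply Derive_const. }
  destruct (Hg p) as [Ex [Ey Ez]]. fold a0 in Ez, Hpos.
  assert (Det : det_metric g p = a0 ^ 2) by (unfold det_metric; rewrite Ex, Ey, Ez, E4; ring).
  intros [] [] []; unfold christoffel, sum_axis; rewrite ?Pxx, ?Pxy, ?Pyx, ?Pyyx, ?Pyyy;
    unfold inv_metric; rewrite Det, ?Ex, ?Ey, ?Ez, ?E4; field; lra.
Qed.

(* With u = x' and q = a y' the geodesic equation says that (u, q) turns on the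
   unit circle with angular velocity b - (a'/a) q. *)
Lemma warped_geodesic_ode (g : metric) (a : R -> R) (b : point -> R) (c : R -> point) :
  warped g a -> smooth a -> (forall x, 0 < a x) -> magnetic_geodesic g b c ->
  let x := fun t => fst (c t) in
  let u := fun t => fst (velocity c t) in
  let q := fun t => a (x t) * snd (velocity c t) in
  let F := fun t => b (c t) - Derive a (x t) / a (x t) * q t in
  forall t, is_derive x t (u t) /\ is_derive (fun t => snd (c t)) t (q t / a (x t)) /\
    is_derive u t (- q t * F t) /\ is_derive q t (u t * F t) /\ u t ^ 2 + q t ^ 2 = 1.
Proof.
  intros Hg Ha Hpos [Sc [H1 Hk]] x u q F.
  set (y := fun t => snd (c t)). set (w := fun t => snd (velocity c t)).
  assert (Sx : smooth x).
  { intros n. refine (Ck_comp_linear n (fun q => fst q) c is_linear_fst (Sc n)). }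
  assert (Sy : smooth y).
  { intros n. refine (Ck_comp_linear n (fun q => snd q) c is_linear_snd (Sc n)). }
  assert (Dx : forall t, is_derive x t (u t)) by (intros; now apply smooth_is_derive).
  assert (Dy : forall t, is_derive y t (w t)) by (intros; now apply smooth_is_derive).
  assert (Su : smooth u) by (apply (smooth_derive x Sx)).
  assert (Sw : smooth w) by (apply (smooth_derive y Sy)).
  assert (Du : forall t, is_derive u t (Derive u t)) by (intros; now apply smooth_is_derive).
  assert (Dw : forall t, is_derive w t (Derive w t)) by (intros; now apply smooth_is_derive).
  assert (Dax : forall t, is_derive (fun t => a (x t)) t (u t * Derive a (x t))).
  { intros t. apply (is_derive_comp a x); [now apply smooth_is_derive|apply Dx]. }
  assert (Dq : forall t, is_derive q t (u t * Derive a (x t) * w t + a (x t) * Derive w t)).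
  { intros t. apply (is_derive_mult (fun t => a (x t)) w); [apply Dax|apply Dw|exact Rmult_comm]. }
  assert (N : forall t, u t ^ 2 + q t ^ 2 = 1).
  { intros t. apply (unit_tangent_warped g a (c t) (u t) (w t) Hg). apply (H1 t). }
  intros t.
  (* [E2] and [E1] are two linear equations for the derivatives of the velocity: [E2] is the
     derivative of the unit-speed relation and [E1] the curvature equation. Together they determine
     both derivatives. *)
  assert (E2 : u t * Derive u t + q t * (u t * Derive a (x t) * w t + a (x t) * Derive w t) = 0).
  { assert (D : is_derive (fun t => u t ^ 2 + q t ^ 2) t
      (2 * (u t * Derive u t + q t * (u t * Derive a (x t) * w t + a (x t) * Derive w t)))).
    { apply (is_derive_ext (fun t => u t * u t + q t * q t)); [intros; real_eq; ring|].
      set (dq := u t * Derive a (x t) * w t + a (x t) * Derive w t).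
      replace (2 * (u t * Derive u t + q t * dq)) with
        ((Derive u t * u t + u t * Derive u t) + (dq * q t + q t * dq)) by ring.
      apply (is_derive_plus (fun t => u t * u t) (fun t => q t * q t)).
      - apply (is_derive_mult u u); [apply Du|apply Du|exact Rmult_comm].
      - apply (is_derive_mult q q); [apply Dq|apply Dq|exact Rmult_comm]. }
    assert (D0 : is_derive (fun t => u t ^ 2 + q t ^ 2) t 0).
    { apply (is_derive_ext (fun _ => 1)); [intros s; symmetry; apply N|]. apply (is_derive_const 1). }
    apply is_derive_unique in D. apply is_derive_unique in D0. rewrite D0 in D. lra. }
  assert (E1 : a (x t) * (u t * (Derive w t + 2 * (Derive a (x t) / a (x t)) * (u t * w t))
    - w t * (Derive u t - a (x t) * Derive a (x t) * w t ^ 2)) = b (c t)).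
  { rewrite <- Hk. unfold geodesic_curvature, area_form, cov_accel, cov_accel_coord.
    cbn [fst snd]. unfold sum_axis.
    rewrite !(christoffel_warped g a (c t) Hg Ha (Hpos _)).
    replace (sqrt (det_metric g (c t))) with (a (x t)).
    2: { symmetry. destruct (Hg (c t)) as [Ex [Ey Ez]].
         unfold det_metric. rewrite (comp_sym g dir_y dir_x), Ex, Ey, Ez.
         replace (1 * a (fst (c t)) ^ 2 - 0 * 0) with (Rsqr (a (x t))) by (unfold Rsqr, x; ring).
         apply sqrt_Rsqr, Rlt_le, Hpos. }
    change (fst (c t)) with (x t).
    change (coord dir_x (velocity c t)) with (u t). change (coord dir_y (velocity c t)) with (w t).
    change (fst (velocity c t)) with (u t). change (snd (velocity c t)) with (w t).
    change (Derive (fun s => coord dir_x (velocity c s)) t) with (Derive u t).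
    change (Derive (fun s => coord dir_y (velocity c s)) t) with (Derive w t).
    field. apply Rgt_not_eq, Hpos. }
  specialize (N t). pose proof (Hpos (x t)) as Ht.
  split; [apply Dx|]. split; [|split; [|split; [|easy]]].
  - replace (q t / a (x t)) with (w t); [apply Dy|]. unfold q. fold (w t). field. lra.
  - replace (- q t * F t) with (Derive u t); [apply Du|].
    unfold F. rewrite <- E1. unfold q in *. fold (w t) in *.
    revert E2 N Ht. clear.
    generalize (a (x t)) (Derive a (x t)) (u t) (w t) (Derive u t) (Derive w t).
    intros A A' U W dU dW E2 N Ht.
    transitivity (- (A * W) * (A * U * dW + 2 * A' * U ^ 2 * W - A * W * dU + A ^ 2 * A' * W ^ 3 - A' * W));
      [|field; lra].
    (* The identity is a combination of [N] and [E2] with polynomial coefficients; these products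
       supply the combination, after which it is linear. *)
    pose proof (f_equal (Rmult dU) N). pose proof (f_equal (Rmult U) E2).
    pose proof (f_equal (Rmult (A * A' * W ^ 2)) N). lra.
  - replace (u t * F t) with (u t * Derive a (x t) * w t + a (x t) * Derive w t); [apply Dq|].
    unfold F. rewrite <- E1. unfold q in *. fold (w t) in *.
    revert E2 N Ht. clear.
    generalize (a (x t)) (Derive a (x t)) (u t) (w t) (Derive u t) (Derive w t).
    intros A A' U W dU dW E2 N Ht.
    transitivity (U * (A * U * dW + 2 * A' * U ^ 2 * W - A * W * dU + A ^ 2 * A' * W ^ 3 - A' * W));
      [|field; lra].
    pose proof (f_equal (Rmult (A * dW)) N). pose proof (f_equal (Rmult (A * W)) E2).
    pose proof (f_equal (Rmult (2 * U * A' * W)) N). lra.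
Qed.

(** * Circles x = const as closed orbits *)

Lemma circle_fun_lipschitz (f : R -> R) :
  circle_fun f -> exists L, 0 <= L /\ forall x y, Rabs (f x - f y) <= L * Rabs (x - y).
Proof.
  intros [Sf Pf]. pose proof PI_RGT_0 as Hpi.
  destruct (bounded_on (Derive f) 0 (2 * PI)) as [L [HL0 HL]]; [apply smooth_derive; easy|].
  assert (B : forall x, Rabs (Derive f x) <= L).
  { intros x.
    assert (Pd : forall x, Derive f (x + 2 * PI) = Derive f x + 0).
    { intros z. rewrite (derive_quasi_periodic f (2 * PI) 0); [ring| |easy].
      intros z'. rewrite Pf. ring. }
    destruct (archimed (x / (2 * PI))) as [A1 A2]. set (n := up (x / (2 * PI))) in *.
    replace (Derive f x) with (Derive f (x + 2 * PI * IZR (1 - n))).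
    2: { rewrite (quasi_periodic_Z (Derive f) (2 * PI) 0 _ _ Pd). ring. }
    apply HL. rewrite minus_IZR.
    assert (x / (2 * PI) * (2 * PI) = x) by (field; lra). nra. }
  exists L. split; [easy|]. intros x y.
  destruct (MVT_gen f y x (Derive f)) as [c [_ E]].
  - intros; now apply smooth_is_derive.
  - intros z _. apply continuity_pt_filterlim. now apply (smooth_continuous f z).
  - rewrite E, Rabs_mult. apply Rmult_le_compat_r; [apply Rabs_pos|apply B].
Qed.

(** [E t * exp (- K * t)] is nonincreasing, nonnegative and starts at 0. *)
Lemma gronwall_zero (E dE : R -> R) K :
  (forall t, is_derive E t (dE t)) -> (forall t, dE t <= K * E t) -> (forall t, 0 <= E t) ->
  E 0 = 0 -> forall t, 0 <= t -> E t = 0.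
Proof.
  intros HD HK Hpos H0 t Ht.
  assert (De : forall s, is_derive (fun s => E s * exp (- K * s)) s
    (dE s * exp (- K * s) + E s * (- K * exp (- K * s)))).
  { intros s. apply (is_derive_mult E (fun s => exp (- K * s))); [apply HD| |exact Rmult_comm].
    auto_derive; [easy|]. ring. }
  destruct (MVT_gen _ 0 t _ (fun s _ => De s)) as [c [_ Hc]].
  { intros s _. apply continuity_pt_filterlim, (ex_derive_continuous (fun s => E s * exp (- K * s)) s).
    eexists. apply De. }
  rewrite H0 in Hc.
  assert (0 < exp (- K * c)) by apply exp_pos. assert (0 < exp (- K * t)) by apply exp_pos.
  specialize (HK c). specialize (Hpos t).
  assert ((dE c - K * E c) * exp (- K * c) * t <= 0).
  { assert ((dE c - K * E c) * exp (- K * c) <= 0) by nra. nra. }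
  assert (E t * exp (- K * t) <= 0) by lra. nra.
Qed.

(** The initial state is an equilibrium of the system in [(x, u, q)]. Uniqueness comes from
    Gronwall's inequality for the squared distance [E] to it: the turning rate [F] vanishes at the
    equilibrium and is bounded by a multiple of the distance. It is applied with [al = a' / a]. *)
Lemma stationary_orbit (al be x u q : R -> R) (e : R) :
  circle_fun al -> circle_fun be -> e ^ 2 = 1 ->
  (forall t, is_derive x t (u t)) ->
  (forall t, is_derive u t (- q t * (be (x t) - al (x t) * q t))) ->
  (forall t, is_derive q t (u t * (be (x t) - al (x t) * q t))) ->
  (forall t, u t ^ 2 + q t ^ 2 = 1) ->
  be (x 0) = al (x 0) * e -> u 0 = 0 -> q 0 = e ->
  forall t, 0 <= t -> x t = x 0 /\ q t = e.
Proof.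
  intros Ha Hb He Dx Du Dq N H0 U0 Q0.
  destruct (circle_fun_lipschitz al Ha) as [La [La0 HLa]].
  destruct (circle_fun_lipschitz be Hb) as [Lb [Lb0 HLb]].
  set (x0 := x 0) in *. set (F := fun t => be (x t) - al (x t) * q t) in *.
  set (L := La + Lb + Rabs (al x0)).
  assert (HL0 : 0 <= Rabs (al x0)) by apply Rabs_pos.
  assert (HF : forall t, Rabs (F t) <= L * (Rabs (x t - x0) + Rabs (q t - e))).
  { intros t.
    replace (F t) with ((be (x t) - be x0) + (- ((al (x t) - al x0) * q t) + - (al x0 * (q t - e))))
      by (unfold F; rewrite H0; ring).
    eapply Rle_trans; [apply Rabs_triang|].
    eapply Rle_trans; [apply Rplus_le_compat_l, Rabs_triang|].
    rewrite !Rabs_Ropp, !Rabs_mult.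
    assert (Rabs (q t) <= 1) by (apply Rabs_le; specialize (N t); nra).
    specialize (HLa (x t) x0). specialize (HLb (x t) x0).
    pose proof (Rabs_pos (q t)). pose proof (Rabs_pos (q t - e)). pose proof (Rabs_pos (x t - x0)).
    assert (Rabs (al (x t) - al x0) * Rabs (q t) <= La * Rabs (x t - x0)).
    { pose proof (Rabs_pos (al (x t) - al x0)). nra. }
    unfold L. nra. }
  set (E := fun t => (x t - x0) * (x t - x0) + (u t * u t + (q t - e) * (q t - e))).
  (* Since [u^2 + q^2 = 1] and [e^2 = 1], the last two squares of [E] add up to [2 - 2 e q], so only
     one term with [F] remains. *)
  set (dE := fun t => 2 * ((x t - x0) * u t) - 2 * e * (u t * F t)).
  assert (DE : forall t, is_derive E t (dE t)).
  { intros t.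
    replace (dE t) with ((u t * (x t - x0) + (x t - x0) * u t)
      + ((- q t * F t * u t + u t * (- q t * F t))
         + ((u t * F t) * (q t - e) + (q t - e) * (u t * F t)))) by (unfold dE; ring).
    assert (D1 : is_derive (fun t => x t - x0) t (u t)).
    { rewrite <- (Rminus_0_r (u t)).
      apply (is_derive_minus x (fun _ => x0)); [apply Dx|apply (is_derive_const x0)]. }
    assert (D2 : is_derive (fun t => q t - e) t (u t * F t)).
    { rewrite <- (Rminus_0_r (u t * F t)).
      apply (is_derive_minus q (fun _ => e)); [apply Dq|apply (is_derive_const e)]. }
    apply (is_derive_plus (fun t => (x t - x0) * (x t - x0))).
    - apply (is_derive_mult (fun t => x t - x0) (fun t => x t - x0)); [easy|easy|exact Rmult_comm].
    - apply (is_derive_plus (fun t => u t * u t) (fun t => (q t - e) * (q t - e))).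
      + apply (is_derive_mult u u); [apply Du|apply Du|exact Rmult_comm].
      + apply (is_derive_mult (fun t => q t - e) (fun t => q t - e)); [easy|easy|exact Rmult_comm]. }
  assert (HE : forall t, dE t <= (1 + 2 * L) * E t).
  { intros t. specialize (HF t). unfold dE, E.
    set (X := x t - x0) in *. set (U := u t). set (Q := q t - e) in *. set (f := F t) in *.
    assert (AG : forall p q, 2 * (p * q) <= p * p + q * q).
    { intros p1 p2. pose proof (Rle_0_sqr (p1 - p2)) as S. unfold Rsqr in S. lra. }
    pose proof (AG X U) as P1.
    assert (P2 : - 2 * e * (U * f) <= 2 * (Rabs U * Rabs f)).
    { apply Rle_trans with (Rabs (- 2 * e * (U * f))); [apply Rle_abs|].
      rewrite !Rabs_mult. assert (Rabs e = 1).
      { assert (K : Rabs e * Rabs e = 1) by (rewrite <- Rabs_mult, Rabs_pos_eq; nra).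
        pose proof (Rabs_pos e). nra. }
      rewrite H, (Rabs_left (-2)) by lra. lra. }
    assert (HU : Rabs U * Rabs U = U * U) by (rewrite <- Rabs_mult, Rabs_pos_eq; nra).
    assert (HX : Rabs X * Rabs X = X * X) by (rewrite <- Rabs_mult, Rabs_pos_eq; nra).
    assert (HQ : Rabs Q * Rabs Q = Q * Q) by (rewrite <- Rabs_mult, Rabs_pos_eq; nra).
    assert (P3 : Rabs U * Rabs f <= Rabs U * (L * (Rabs X + Rabs Q))).
    { apply Rmult_le_compat_l; [apply Rabs_pos|easy]. }
    assert (P4 : Rabs U * (Rabs X + Rabs Q) <= X * X + (U * U + Q * Q)).
    { pose proof (AG (Rabs U) (Rabs X)). pose proof (AG (Rabs U) (Rabs Q)).
      pose proof (Rle_0_sqr X). pose proof (Rle_0_sqr Q). unfold Rsqr in *. lra. }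
    assert (HL : 0 <= L) by (unfold L; lra).
    assert (P5 : L * (Rabs U * (Rabs X + Rabs Q)) <= L * (X * X + (U * U + Q * Q)))
      by now apply Rmult_le_compat_l.
    assert (0 <= Q * Q) by nra. lra. }
  intros t Ht.
  assert (Z : E t = 0).
  { apply (gronwall_zero E dE (1 + 2 * L)); try easy.
    - intros s. pose proof (Rle_0_sqr (x s - x0)). pose proof (Rle_0_sqr (u s)).
      pose proof (Rle_0_sqr (q s - e)). unfold E, Rsqr in *. lra.
    - unfold E. fold x0. rewrite U0, Q0. ring. }
  pose proof (Rle_0_sqr (x t - x0)). pose proof (Rle_0_sqr (u t)).
  pose proof (Rle_0_sqr (q t - e)). unfold E in Z.
  split; apply Rminus_diag_uniq, Rsqr_0_uniq; unfold Rsqr in *; lra.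
Qed.

Lemma circle_fun_log_derive (a : R -> R) :
  circle_fun a -> (forall x, 0 < a x) -> circle_fun (fun x => Derive a x / a x).
Proof.
  intros [Sa Pa] Hpos. split.
  - intros n. apply (Ck_mult n (Derive a) (fun x => / a x)); [now apply smooth_derive|].
    apply Ck_inv; [intros x; apply Rgt_not_eq, Hpos|easy].
  - intros x. rewrite Pa, (derive_quasi_periodic a (2 * PI) 0); [easy| |easy].
    intros z. rewrite Pa. ring.
Qed.

Lemma stationary_displacement (g : metric) (a be : R -> R) (c : R -> point) x0 e T :
  warped g a -> circle_fun a -> (forall x, 0 < a x) -> circle_fun be -> e ^ 2 = 1 ->
  magnetic_geodesic g (fun p => be (fst p)) c ->
  tangent_lift c 0 = ((x0, 0), (0, e / a x0)) -> be x0 = Derive a x0 / a x0 * e ->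
  0 < T -> snd (c T) = e / a x0 * T.
Proof.
  intros Hg Ha Hpos Hb He Hc Hc0 H0 HT.
  pose proof (warped_geodesic_ode g a _ c Hg (proj1 Ha) Hpos Hc) as Hode. cbv zeta in Hode.
  set (x := fun t => fst (c t)) in *. set (u := fun t => fst (velocity c t)) in *.
  set (q := fun t => a (x t) * snd (velocity c t)) in *.
  pose proof (f_equal (fun v => fst (fst v)) Hc0) as X0.
  pose proof (f_equal (fun v => snd (fst v)) Hc0) as Y0.
  pose proof (f_equal (fun v => fst (snd v)) Hc0) as U0.
  pose proof (f_equal (fun v => snd (snd v)) Hc0) as W0.
  cbn [fst snd tangent_lift] in Y0.
  assert (X0' : x 0 = x0) by exact X0. clear X0.
  assert (Hst : forall t, 0 <= t -> x t = x 0 /\ q t = e).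
  { apply (stationary_orbit (fun x => Derive a x / a x) be x u q e); try easy.
    - now apply circle_fun_log_derive.
    - intros t. exact (proj1 (Hode t)).
    - intros t. exact (proj1 (proj2 (proj2 (Hode t)))).
    - intros t. exact (proj1 (proj2 (proj2 (proj2 (Hode t))))).
    - intros t. exact (proj2 (proj2 (proj2 (proj2 (Hode t))))).
    - now rewrite X0'.
    - unfold q. rewrite X0'. transitivity (a x0 * (e / a x0)); [f_equal; exact W0|].
      field. apply Rgt_not_eq, Hpos. }
  destruct (MVT_gen (fun t => snd (c t)) 0 T (fun t => q t / a (x t))) as [s [Hs E]].
  - intros t _. exact (proj1 (proj2 (Hode t))).
  - intros t _. apply continuity_pt_filterlim, (ex_derive_continuous (fun t => snd (c t)) t).
    eexists. exact (proj1 (proj2 (Hode t))).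
  - rewrite Rmin_left, Rmax_right in Hs by lra. destruct (Hst s (proj1 Hs)) as [-> ->] in E.
    rewrite X0' in E. assert (Y0' : snd (c 0) = 0) by exact Y0. rewrite Y0' in E. lra.
Qed.

(* The closed orbits x = x1 and x = x2 below wind in opposite y-directions. *)
Lemma zoll_no_opposite_circles (g : metric) (a be : R -> R) x1 x2 :
  warped g a -> circle_fun a -> (forall x, 0 < a x) -> circle_fun be ->
  zoll g (fun p => be (fst p)) ->
  be x1 = Derive a x1 / a x1 -> be x2 = - (Derive a x2 / a x2) -> False.
Proof.
  intros Hg Ha Hpos Hb Hz H1 H2.
  destruct (zoll_displacement g _ Hz) as [T [D [HT HD]]].
  (* A path of unit vectors from the upward direction at [x1] to the downward direction at [x2],
     along which [D] is constant. *)
  set (v := fun t => ((x1 + t * (x2 - x1), 0),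
    (sin (PI * t), cos (PI * t) * / a (x1 + t * (x2 - x1)))) : tangent).
  assert (Hv : forall t, unit_tangent g (v t)).
  { intros t. apply (unit_tangent_warped g a _ _ _ Hg). cbn [fst].
    pose proof (sin2_cos2 (PI * t)) as E. unfold Rsqr in E.
    replace (a (x1 + t * (x2 - x1)) * (cos (PI * t) * / a (x1 + t * (x2 - x1)))) with (cos (PI * t)).
    - lra.
    - field. apply Rgt_not_eq, Hpos. }
  assert (Sa := proj1 Ha).
  assert (ED : D (v 0) = D (v 1)).
  { apply (HD v); [|easy].
    apply (Ck_pair 0 (fun t => (x1 + t * (x2 - x1), 0))
      (fun t => (sin (PI * t), cos (PI * t) * / a (x1 + t * (x2 - x1))))).
    - apply (Ck_pair 0 (fun t => x1 + t * (x2 - x1)) (fun _ => 0)); ck.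
    - apply (Ck_pair 0 (fun t => sin (PI * t)) (fun t => cos (PI * t) * / a (x1 + t * (x2 - x1)))).
      + ck.
      + apply Ck_mult; [ck|]. apply Ck_inv; [intros t; apply Rgt_not_eq, Hpos|]. ck. }
  assert (E0 : v 0 = ((x1, 0), (0, 1 / a x1))).
  { unfold v. replace (x1 + 0 * (x2 - x1)) with x1 by ring.
    rewrite Rmult_0_r, sin_0, cos_0. easy. }
  assert (E1 : v 1 = ((x2, 0), (0, -1 / a x2))).
  { unfold v. replace (x1 + 1 * (x2 - x1)) with x2 by ring.
    rewrite Rmult_1_r, sin_PI, cos_PI. easy. }
  destruct (HT (v 0) (Hv 0)) as [T0 [c [Hc [Hc0 [Hc1 _]]]]].
  destruct (HT (v 1) (Hv 1)) as [T1 [c' [Hc' [Hc0' [Hc1' _]]]]].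
  rewrite E0 in Hc0. rewrite E1 in Hc0'.
  rewrite (stationary_displacement g a be c x1 1 (T (v 0))) in Hc1; try easy; try lra.
  rewrite (stationary_displacement g a be c' x2 (-1) (T (v 1))) in Hc1'; try easy; try lra.
  change (snd (fst (v 0))) with 0 in Hc1. change (snd (fst (v 1))) with 0 in Hc1'.
  assert (P1 : 0 < 1 / a x1 * T (v 0)).
  { apply Rmult_lt_0_compat; [|easy]. apply Rdiv_lt_0_compat; [lra|apply Hpos]. }
  assert (P2 : 0 < 1 / a x2 * T (v 1)).
  { apply Rmult_lt_0_compat; [|easy]. apply Rdiv_lt_0_compat; [lra|apply Hpos]. }
  replace (-1 / a x2) with (- (1 / a x2)) in Hc1' by (field; apply Rgt_not_eq, Hpos). lra.
Qed.

Lemma zero_between (f : R -> R) p q : Ck 0 f -> f p < 0 -> 0 < f q -> exists x, f x = 0.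
Proof.
  intros Hf Hp Hq. destruct (IVT_gen f p q 0) as [x [_ Hx]]; [| |now exists x].
  - intros x. apply continuity_pt_filterlim, (Hf x).
  - rewrite Rmin_left, Rmax_right; lra.
Qed.

Lemma translate_into_period s t : exists k : Z, s <= t + 2 * PI * IZR k < s + 2 * PI.
Proof.
  pose proof PI_RGT_0 as Hpi.
  destruct (archimed ((t - s) / (2 * PI))) as [A1 A2]. set (n := up ((t - s) / (2 * PI))) in *.
  exists (1 - n)%Z. rewrite minus_IZR.
  assert ((t - s) / (2 * PI) * (2 * PI) = t - s) by (field; lra). nra.
Qed.

(** If [a s < a t], move [t] by a multiple of the period into [(s, s + 2 PI)]: [a] rises on the
    first part of this interval and falls back on the second. *)
Lemma circle_fun_derive_signs (a : R -> R) :
  circle_fun a -> (forall x, Derive a x = 0) \/ exists p q, 0 < Derive a p /\ Derive a q < 0.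
Proof.
  intros [Sa Pa].
  destruct (excluded_middle_informative (exists s t, a s < a t)) as [[s [t Hst]]|Hn].
  - right. destruct (translate_into_period s t) as [k [K1 K2]].
    assert (Et : a (t + 2 * PI * IZR k) = a t).
    { rewrite (quasi_periodic_Z a (2 * PI) 0); [ring|]. intros x. rewrite Pa. ring. }
    assert (MVT' : forall x y, x < y -> exists z, a y - a x = Derive a z * (y - x)).
    { intros x y _. destruct (MVT_gen a x y (Derive a)) as [z [_ E]].
      - intros; now apply smooth_is_derive.
      - intros z _. apply continuity_pt_filterlim. now apply (smooth_continuous a z).
      - now exists z. }
    set (t' := t + 2 * PI * IZR k) in *.
    assert (Hlt : s < t').
    { destruct K1 as [K1|K1]; [easy|]. rewrite <- K1 in Et. lra. }
    destruct (MVT' s t' Hlt) as [p Hp]. destruct (MVT' t' (s + 2 * PI) K2) as [q Hq].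
    rewrite Pa in Hq. exists p, q. split; nra.
  - left. intros x. rewrite (Derive_ext _ (fun _ => a 0)); [apply Derive_const|].
    intros t. destruct (Rtotal_order (a t) (a 0)) as [H|[H|H]]; [|easy|];
      exfalso; apply Hn; eauto.
Qed.

Lemma unbounded_above (Rs : R -> Prop) : ~ bound Rs -> forall K, exists r, Rs r /\ K < r.
Proof.
  intros Hb K. destruct (excluded_middle_informative (exists r, Rs r /\ K < r)) as [H|H]; [easy|].
  exfalso. apply Hb. exists K. intros r Hr. destruct (Rle_dec r K); [easy|].
  exfalso. apply H. exists r. split; [easy|lra].
Qed.

Lemma zoll_weak_field_constant (g : metric) (a b0 : R -> R) (Rs : R -> Prop) :
  warped g a -> circle_fun a -> (forall x, 0 < a x) -> circle_fun b0 ->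
  (forall r, Rs r -> 0 < r) -> ~ bound Rs ->
  (forall r, Rs r -> zoll g (fun p => / r * b0 (fst p))) ->
  forall x, Derive a x = 0.
Proof.
  intros Hg Ha Hpos [Sb Pb] HRs Hub Hz.
  destruct (circle_fun_derive_signs a Ha) as [H|[p [q [Hp Hq]]]]; [easy|exfalso].
  set (al := fun x => Derive a x / a x).
  assert (Sal : smooth al) by (apply (circle_fun_log_derive a Ha Hpos)).
  assert (Ap : 0 < al p) by now apply Rdiv_lt_0_compat.
  assert (Aq : al q < 0).
  { unfold al, Rdiv. rewrite <- (Ropp_involutive (Derive a q)), Ropp_mult_distr_l_reverse.
    apply Ropp_lt_gt_0_contravar, Rdiv_lt_0_compat; [lra|apply Hpos]. }
  (* Both summands are nonnegative, so this [r] exceeds each of them and [b0 / r] is smaller than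
     [a' / a] in absolute value at both [p] and [q]. *)
  destruct (unbounded_above Rs Hub (Rabs (b0 p) / al p + Rabs (b0 q) / - al q)) as [r [Hr Hlt]].
  assert (Hr0 := HRs r Hr).
  assert (Bp : 0 <= Rabs (b0 p) / al p) by (apply Rdiv_le_0_compat; [apply Rabs_pos|easy]).
  assert (Bq : 0 <= Rabs (b0 q) / - al q) by (apply Rdiv_le_0_compat; [apply Rabs_pos|lra]).
  assert (small : forall z c, 0 < c -> Rabs z / c < r -> Rabs (/ r * z) < c).
  { intros z c Hc H. rewrite Rabs_mult, (Rabs_pos_eq (/ r)) by (apply Rlt_le, Rinv_0_lt_compat; easy).
    apply Rmult_lt_reg_l with (r / c); [now apply Rdiv_lt_0_compat|].
    replace (r / c * (/ r * Rabs z)) with (Rabs z / c) by (field; lra).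
    replace (r / c * c) with r by (field; lra). easy. }
  assert (Sp := small (b0 p) (al p) Ap ltac:(lra)).
  assert (Sq := small (b0 q) (- al q) ltac:(lra) ltac:(lra)).
  apply Rabs_def2 in Sp. apply Rabs_def2 in Sq.
  destruct (zero_between (fun x => / r * b0 x - al x) p q) as [x1 H1]; [ck|lra|lra|].
  destruct (zero_between (fun x => / r * b0 x + al x) q p) as [x2 H2]; [ck|lra|lra|].
  apply (zoll_no_opposite_circles g a (fun x => / r * b0 x) x1 x2); try easy.
  - split; [intros n; ck|]. intros x. now rewrite Pb.
  - now apply Hz.
  - unfold al in H1. lra.
  - unfold al in H2. lra.
Qed.

(** * Fourier coefficients *)

Notation R2 := (prod_NormedModule R_AbsRing R_NormedModule R_NormedModule).

Lemma Ck_slice_r n (f : R2 -> R) (z : R) : Ck n f -> Ck n (fun t : R => f (z, t)).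
Proof.
  intros Hf. apply (Ck_ext n (fun t : R => f (plus ((0, t) : R2) ((z, 0) : R2)))).
  - intros t. f_equal. change ((0 + z, t + 0) = (z, t)). now rewrite Rplus_0_l, Rplus_0_r.
  - apply (Ck_precomp_affine n (fun t : R => (0, t) : R2)); [|easy].
    apply (is_linear_prod (U := R_NormedModule) (V := R_NormedModule) (fun _ => zero) (fun t => t));
      [apply is_linear_zero|apply is_linear_id].
Qed.

Lemma Ck1_partial (f : R2 -> R) :
  Ck 1 f -> exists g : R2 -> R, Ck 0 g /\
    forall z t, is_derive (fun z => f (z, t)) z (g (z, t)).
Proof.
  intros [df [Hd Hc]]. exists (fun p => df p (1, 0)). split; [apply Hc|].
  intros z t.
  assert (L : filterdiff (fun z : R => (z, t) : R2) (locally z) (fun v => (v, 0) : R2)).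
  { apply (filterdiff_ext (fun z : R => plus ((z, 0) : R2) ((0, t) : R2))).
    - intros y. change ((y + 0, 0 + t) = (y, t)). now rewrite Rplus_0_l, Rplus_0_r.
    - apply filterdiff_ext_lin with (fun v : R => plus ((v, 0) : R2) zero).
      + apply (filterdiff_plus_fct (fun z : R => (z, 0) : R2) (fun _ => ((0, t) : R2))
          (fun z : R => (z, 0) : R2) (fun _ => zero)).
        * apply filterdiff_linear.
          apply (is_linear_prod (U := R_NormedModule) (V := R_NormedModule) (fun t => t) (fun _ => zero));
            [apply is_linear_id|apply is_linear_zero].
        * apply filterdiff_const.
      + intros v. apply plus_zero_r. }
  apply filterdiff_ext_lin with (fun v : R => df (z, t) (v, 0)).
  - apply (filterdiff_comp' (fun z : R => (z, t) : R2) f z (fun v => (v, 0) : R2) (df (z, t)) L (Hd (z, t))).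
  - intros v. destruct (Hd (z, t)) as [Hl _].
    rewrite <- (linear_scal _ Hl v). f_equal. change ((v, 0) = (v * 1, v * 0)). now rewrite Rmult_1_r, Rmult_0_r.
Qed.

Lemma is_derive_RInt_slice (f g : R2 -> R) a b z :
  Ck 0 g -> (forall z t, is_derive (fun z => f (z, t)) z (g (z, t))) ->
  (forall z, Ck 0 (fun t => f (z, t))) ->
  is_derive (fun z => RInt (fun t => f (z, t)) a b) z (RInt (fun t => g (z, t)) a b).
Proof.
  intros Hg Hd Hf.
  rewrite <- (RInt_ext (fun t => Derive (fun u => f (u, t)) z))
    by (intros; apply is_derive_unique, Hd).
  apply (is_derive_RInt_param (fun z t => f (z, t)) a b z).
  - apply filter_forall. intros y t _. eexists. apply Hd.
  - intros t _. apply continuity_2d_pt_ext with (fun u v => g (u, v)).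
    + intros u v. symmetry. apply is_derive_unique, Hd.
    + apply continuity_2d_pt_filterlim.
      assert (C : Ck 0 (fun q : R2 => g (fst q, snd q))) by (apply (Ck_ext 0 g); [now intros [u v]|easy]).
      exact (C (z, t)).
  - apply filter_forall. intros y. now apply Ck0_ex_RInt.
Qed.

Lemma Ck_swap n (f : R2 -> R) : Ck n f -> Ck n (fun p : R2 => f (snd p, fst p)).
Proof.
  intros Hf. apply (Ck_ext n (fun p : R2 => f (plus ((snd p, fst p) : R2) zero))).
  - intros p. f_equal. apply plus_zero_r.
  - apply (Ck_precomp_affine n (fun p : R2 => (snd p, fst p) : R2)); [|easy].
    apply is_linear_prod; [apply is_linear_snd|apply is_linear_fst].
Qed.

Lemma Ck0_RInt_slice (f : R2 -> R) a b : Ck 1 f -> Ck 0 (fun z => RInt (fun t => f (z, t)) a b).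
Proof.
  intros Hf. destruct (Ck1_partial f Hf) as [g [Hg Hd]]. intros z.
  apply (ex_derive_continuous (fun z => RInt (fun t => f (z, t)) a b)).
  eexists. apply is_derive_RInt_slice; [exact Hg|exact Hd|].
  intros y. apply (Ck_le 0). now apply Ck_slice_r.
Qed.

(* Fubini: both iterated integrals have the same derivative in the upper bound of z. *)
Lemma RInt_swap_order (f : R2 -> R) a b c d :
  Ck 1 f ->
  RInt (fun z => RInt (fun t => f (z, t)) a b) c d
  = RInt (fun t => RInt (fun z => f (z, t)) c d) a b.
Proof.
  intros Hf. pose proof (Ck_le 0 f Hf) as Hf0.
  set (g := fun z => RInt (fun t => f (z, t)) a b).
  assert (Hg : Ck 0 g) by now apply Ck0_RInt_slice.
  set (F := fun p : R2 => RInt (fun z => f (z, snd p)) c (fst p)).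
  set (G := fun s => RInt (fun t => F (s, t)) a b).
  assert (DG : forall s, is_derive G s (g s)).
  { intros s. apply (is_derive_RInt_slice F f); [easy| |].
    - intros z t. apply (is_derive_primitive (fun z => f (z, t)) c z).
      apply (Ck_slice (V := R_NormedModule) 0 f t Hf0).
    - intros z. apply (Ck0_RInt_slice (fun p : R2 => f (snd p, fst p)) c z).
      now apply (Ck_swap 1 f). }
  assert (E : RInt g c d - G d = RInt g c c - G c).
  { apply (derive_zero_const (fun s => RInt g c s - G s) (fun s => g s - g s)).
    - intros s. apply (is_derive_minus (fun s => RInt g c s) G); [now apply is_derive_primitive|apply DG].
    - intros s. ring. }
  assert (G c = 0).
  { unfold G. rewrite (RInt_ext _ (fun _ => 0)).
    - rewrite RInt_const. apply (Rmult_0_r (b - a)).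
    - intros t _. apply (RInt_point c (fun z => f (z, t))). }
  assert (RInt g c c = 0) by apply (RInt_point c g).
  change (RInt g c d = G d). real_eq. lra.
Qed.

(** Integrate the hypothesis against [cos (k z + w)] and exchange the integrals. Substituting
    [z - r sin t] for [z] leaves [A cos (k r sin t) + B sin (k r sin t)] under the remaining
    integral, weighted by [sin t]; the [A] term integrates to 0 by antiperiodicity and [B] is
    multiplied by the Bessel integral. The phase [w] treats sine and cosine coefficients
    together. *)
Lemma fourier_coefficient_zero (p : R -> R) r k w :
  smooth p -> (forall x, p (x + 2 * PI) = p x) ->
  (forall z, RInt (fun t => sin t * p (z + r * sin t)) 0 (2 * PI) = 0) ->
  RInt (fun t => sin t * sin (INR k * r * sin t)) 0 (2 * PI) <> 0 ->
  RInt (fun z => sin (INR k * z + w) * p z) 0 (2 * PI) = 0.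
Proof.
  intros Hp Pp Hz HB.
  set (f := fun q : R2 => cos (INR k * fst q + w) * (sin (snd q) * p (fst q + r * sin (snd q)))).
  assert (Hf : Ck 1 f).
  { assert (H1 : Ck 1 (fun q : R2 => fst q : R)) by apply (Ck_linear 1 (fun q : R2 => fst q)), is_linear_fst.
    assert (H2 : Ck 1 (fun q : R2 => snd q : R)) by apply (Ck_linear 1 (fun q : R2 => snd q)), is_linear_snd.
    apply Ck_mult.
    - apply Ck_cos, Ck_Rplus; [|apply Ck_const]. apply Ck_mult; [apply Ck_const|easy].
    - apply Ck_mult; [now apply Ck_sin|]. apply (Ck_comp 1 p); [easy|].
      apply Ck_Rplus; [easy|]. apply Ck_mult; [apply Ck_const|now apply Ck_sin]. }
  pose proof (RInt_swap_order f 0 (2 * PI) 0 (2 * PI) Hf) as E. unfold f in E. cbn [fst snd] in E.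
  set (A := RInt (fun z => cos (INR k * z + w) * p z) 0 (2 * PI)).
  set (B := RInt (fun z => sin (INR k * z + w) * p z) 0 (2 * PI)).
  rewrite (RInt_ext _ (fun _ => 0)) in E.
  2: { intros z _. rewrite RInt_Rmult by ck. rewrite Hz. real_eq. ring. }
  rewrite RInt_const in E. change (scal (2 * PI - 0) 0) with ((2 * PI - 0) * 0) in E.
  rewrite Rmult_0_r in E.
  rewrite (RInt_ext _ (fun t => A * (sin t * cos (INR k * r * sin t)) + B * (sin t * sin (INR k * r * sin t)))) in E.
  2: { intros t _. set (c := r * sin t).
       assert (Per : forall x, cos (INR k * (x + 2 * PI - c) + w) * p (x + 2 * PI)
         = cos (INR k * (x - c) + w) * p x).
       { intros x. rewrite Pp. f_equal.
         replace (INR k * (x + 2 * PI - c) + w) with (INR k * (x - c) + w + 2 * INR k * PI) by ring.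
         apply cos_period. }
       set (h := fun x => cos (INR k * (x - c) + w) * p x).
       assert (Hh : Ck 0 h) by (unfold h; ck).
       assert (Hhc : Ck 0 (fun z => h (c + z))) by (unfold h; ck).
       transitivity (sin t * RInt h 0 (2 * PI)).
       { rewrite <- (RInt_periodic h c Hh Per), <- RInt_Rmult by easy.
         apply RInt_ext. intros z _. real_eq. unfold h.
         replace (c + z - c) with z by ring. rewrite (Rplus_comm c z). ring. }
       rewrite (RInt_ext h (fun z => cos (INR k * c) * (cos (INR k * z + w) * p z)
         + sin (INR k * c) * (sin (INR k * z + w) * p z))).
       2: { intros z _. unfold h. real_eq.
            replace (INR k * (z - c) + w) with (INR k * z + w - INR k * c) by ring.
            rewrite cos_minus. ring. }
       rewrite RInt_Rplus, !RInt_Rmult by ck. fold A B. real_eq. unfold c.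
       rewrite <- Rmult_assoc. ring. }
  rewrite RInt_Rplus, !RInt_Rmult in E by ck.
  rewrite (RInt_antiperiodic (fun t => sin t * cos (INR k * r * sin t))) in E.
  - symmetry in E. rewrite Rmult_0_r, Rplus_0_l in E. apply Rmult_integral in E. now destruct E.
  - ck.
  - intros t. rewrite sin_shift_PI.
    replace (INR k * r * - sin t) with (- (INR k * r * sin t)) by ring. rewrite cos_neg. ring.
Qed.

(** * Completeness of the trigonometric system *)

Lemma Ck_pow {V : NormedModule R_AbsRing} n (f : V -> R) k : Ck n f -> Ck n (fun x => f x ^ k).
Proof.
  intros Hf. induction k as [|k IH]; [exact (Ck_const n 1)|]. now apply (Ck_mult n f).
Qed.

(* A nonnegative trigonometric polynomial whose powers concentrate at 0. *)
Definition peak (y : R) : R := (1 + cos y) / 2.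

Lemma Ck_peak {V : NormedModule R_AbsRing} n (f : V -> R) : Ck n f -> Ck n (fun x => peak (f x)).
Proof.
  intros Hf. apply (Ck_mult n (fun x => 1 + cos (f x)) (fun _ => / 2)); [|apply Ck_const].
  apply Ck_Rplus; [apply Ck_const|now apply Ck_cos].
Qed.

(** Multiplication by [peak] sends frequency [k] to a combination of [k - 1], [k] and [k + 1], so
    powers of [peak] stay in the span of the test functions. *)
Lemma peak_moment_zero (p : R -> R) x0 :
  Ck 0 p -> (forall k w, RInt (fun z => sin (INR k * z + w) * p z) 0 (2 * PI) = 0) ->
  forall n k w, RInt (fun z => peak (z - x0) ^ n * (sin (INR k * z + w) * p z)) 0 (2 * PI) = 0.
Proof.
  intros Hp H0. induction n as [|n IH]; intros k w.
  - eapply eq_trans; [|exact (H0 k w)]. apply RInt_ext. intros z _. real_eq. ring.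
  - assert (C : forall k w, Ck 0 (fun z => peak (z - x0) ^ n * (sin (INR k * z + w) * p z))).
    { intros k' w'. apply Ck_mult; [|ck]. apply Ck_pow, Ck_peak. ck. }
    assert (Hk : exists k' w' s, forall z,
      sin (INR k * z + w - (z - x0)) = s * sin (INR k' * z + w')).
    { destruct k as [|k].
      - exists 1%nat, (- x0 - w), (-1). intros z. simpl.
        replace (0 * z + w - (z - x0)) with (- (1 * z + (- x0 - w))) by ring. rewrite sin_neg. ring.
      - exists k, (w + x0), 1. intros z. rewrite S_INR.
        replace ((INR k + 1) * z + w - (z - x0)) with (INR k * z + (w + x0)) by ring. ring. }
    destruct Hk as [k' [w' [s Hs]]].
    rewrite (RInt_ext _ (fun z =>
      / 2 * (peak (z - x0) ^ n * (sin (INR k * z + w) * p z))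
      + (/ 4 * (peak (z - x0) ^ n * (sin (INR (S k) * z + (w - x0)) * p z))
         + s / 4 * (peak (z - x0) ^ n * (sin (INR k' * z + w') * p z))))).
    + specialize (C k w) as C1. specialize (C (S k) (w - x0)) as C2. specialize (C k' w') as C3.
      rewrite RInt_Rplus; [|ck|apply Ck_Rplus; (apply Ck_mult; [ck|easy])].
      rewrite RInt_Rplus; [|apply Ck_mult; [ck|easy]..].
      rewrite !RInt_Rmult by easy. rewrite !IH. real_eq. ring.
    + intros z _. real_eq.
      assert (E : peak (z - x0) * sin (INR k * z + w)
        = / 2 * sin (INR k * z + w) + (/ 4 * sin (INR (S k) * z + (w - x0))
          + / 4 * sin (INR k * z + w - (z - x0)))).
      { rewrite S_INR.
        replace ((INR k + 1) * z + (w - x0)) with (INR k * z + w + (z - x0)) by ring.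
        generalize (INR k * z + w) (z - x0). intros th al.
        rewrite sin_plus, sin_minus. unfold peak. field. }
      rewrite Hs in E. simpl pow.
      transitivity (peak (z - x0) ^ n * p z * (peak (z - x0) * sin (INR k * z + w))); [ring|].
      rewrite E. field.
Qed.

Lemma bernoulli_contradiction (q Q c C : R) :
  0 < q < Q -> 0 < c -> (forall n, c * Q ^ n <= C * q ^ n) -> False.
Proof.
  intros [Hq HQ] Hc H. set (x := Q / q - 1).
  assert (Hx : 0 < x).
  { unfold x. apply Rlt_0_minus. apply Rmult_lt_reg_r with q; [easy|].
    replace (Q / q * q) with Q by (field; lra). lra. }
  assert (HP : forall n, c * (1 + INR n * x) <= C).
  { intros n. pose proof (poly n x Hx) as HB. specialize (H n).
    replace (1 + x) with (Q / q) in HB by (unfold x; ring).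
    unfold Rdiv in HB. rewrite Rpow_mult_distr, pow_inv in HB.
    assert (Hqn : 0 < q ^ n) by now apply pow_lt.
    apply Rmult_le_reg_r with (q ^ n); [easy|].
    apply Rle_trans with (c * Q ^ n); [|easy].
    rewrite Rmult_assoc. apply Rmult_le_compat_l; [lra|].
    apply Rmult_le_compat_r with (r := q ^ n) in HB; [|lra].
    replace (Q ^ n * / q ^ n * q ^ n) with (Q ^ n) in HB by (field; lra). easy. }
  destruct (INR_unbounded (C / (c * x))) as [n Hn].
  specialize (HP n).
  assert (0 < c * x) by now apply Rmult_lt_0_compat.
  apply Rmult_lt_compat_r with (r := c * x) in Hn; [|easy].
  replace (C / (c * x) * (c * x)) with C in Hn by (field; lra). nra.
Qed.

Lemma cos_le_of_abs_ge e y : 0 <= e -> e <= Rabs y <= PI -> cos y <= cos e.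
Proof.
  intros He Hy. replace (cos y) with (cos (Rabs y)).
  - apply cos_decr_1; lra.
  - unfold Rabs. destruct Rcase_abs; [apply cos_neg|easy].
Qed.

(** On the interval [[- e / 2, e / 2]], of length [e], [peak] is at least [peak (e / 2)]. *)
Lemma peak_integral_ge (n : nat) e :
  0 < e < PI -> e * peak (e / 2) ^ n <= RInt (fun y => peak y ^ n) (- PI) PI.
Proof.
  intros He. set (f := fun y => peak y ^ n).
  assert (Hf : Ck 0 f) by (apply Ck_pow, (Ck_peak 0 (fun y => y)), Ck_id).
  set (H := fun x => RInt f 0 x).
  assert (DH : forall x, is_derive H x (f x)) by (intros; now apply is_derive_primitive).
  assert (P0 : forall y, 0 <= peak y) by (intros y; pose proof (COS_bound y); unfold peak; lra).
  assert (Inc : forall x y, x <= y -> H x <= H y).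
  { intros x y Hxy. pose proof (increment_ge H 0) as I.
    assert (0 * (y - x) <= H y - H x); [apply I; try easy|lra].
    - intros z. eexists. apply DH.
    - intros z. rewrite (is_derive_unique _ _ _ (DH z)). apply pow_le, P0. }
  rewrite (primitive_sub f) by easy. fold (H PI) (H (- PI)).
  destruct (MVT_gen H (- (e / 2)) (e / 2) f) as [c [Hc E]].
  - intros; apply DH.
  - intros z _. apply continuity_pt_filterlim, (ex_derive_continuous H z). eexists. apply DH.
  - rewrite Rmin_left, Rmax_right in Hc by lra.
    pose proof (Inc (e / 2) PI ltac:(lra)). pose proof (Inc (- PI) (- (e / 2)) ltac:(lra)).
    assert (peak (e / 2) ^ n <= f c).
    { unfold f. apply pow_incr. split; [apply P0|]. unfold peak.
      assert (cos (e / 2) <= cos c); [|lra].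
      replace (cos (e / 2)) with (cos (Rabs (e / 2))) by (rewrite Rabs_pos_eq by lra; easy).
      rewrite (Rabs_pos_eq (e / 2)) by lra.
      replace (cos c) with (cos (Rabs c)) by (unfold Rabs; destruct Rcase_abs; [apply cos_neg|easy]).
      assert (Rabs c <= e / 2) by (apply Rabs_le; lra). pose proof (Rabs_pos c).
      apply cos_decr_1; lra. }
    change (e * peak (e / 2) ^ n <= H PI - H (- PI)). nra.
Qed.

(** [f] is at least [d] for [|y| <= e]. The part of the integral near 0 is of order at least
    [Q ^ n], with [Q = peak (e / 2)], and the part outside at most of order [q ^ n], with
    [q = peak e < Q]; the two cannot cancel for all [n]. *)
Lemma peak_concentration (f : R -> R) :
  Ck 0 f -> 0 < f 0 -> (forall n, RInt (fun y => peak y ^ n * f y) (- PI) PI = 0) -> False.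
Proof.
  intros Hf H0 HI. pose proof PI_RGT_0 as Hpi. pose proof PI2_1 as Hpi1.
  set (d := f 0 / 2).
  destruct (proj1 (filterlim_locally f (f 0)) (Hf 0) (mkposreal d ltac:(unfold d; lra))) as [e0 He0].
  (* The bound 1 keeps [e] below [PI / 2], where the cosine is positive and decreasing; halving [e0]
     turns the closed condition on [y] into the open one of the ball. *)
  set (e := Rmin (e0 / 2) 1).
  assert (He : 0 < e /\ e <= e0 / 2 /\ e <= 1).
  { pose proof (cond_pos e0). unfold e. split; [apply Rmin_pos; lra|].
    split; [apply Rmin_l|apply Rmin_r]. }
  assert (Near : forall y, Rabs y <= e -> d <= f y).
  { intros y Hy. pose proof (cond_pos e0).
    assert (B : Rabs (f y - f 0) < d).
    { apply (He0 y). change (Rabs (y - 0) < e0). rewrite Rminus_0_r. lra. }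
    apply Rabs_def2 in B. unfold d in *. lra. }
  destruct (bounded_on f (- PI) PI Hf) as [M [HM0 HM]].
  set (q := peak e). set (Q := peak (e / 2)).
  assert (Hq : 0 < q < Q).
  { unfold q, Q, peak. assert (0 < cos e) by (apply cos_gt_0; lra).
    assert (cos e < cos (e / 2)) by (apply cos_decreasing_1; lra). lra. }
  apply (bernoulli_contradiction q Q (d * e) (2 * PI * (M + d))); [easy| |].
  { apply Rmult_lt_0_compat; unfold d; lra. }
  intros n.
  assert (P0 : forall y, 0 <= peak y) by (intros y; pose proof (COS_bound y); unfold peak; lra).
  (* One inequality for both regions: near 0 it follows from [f >= d], elsewhere from [f >= - M] and
     [peak y <= q]. *)
  assert (Pt : forall y, - PI < y < PI ->
    d * peak y ^ n - (M + d) * q ^ n <= peak y ^ n * f y).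
  { intros y Hy.
    assert (0 <= peak y ^ n) by apply pow_le, P0.
    assert (0 <= q ^ n) by (apply pow_le; lra).
    destruct (Rle_dec (Rabs y) e) as [Hye|Hye].
    - specialize (Near y Hye).
      assert (0 <= (M + d) * q ^ n) by (apply Rmult_le_pos; unfold d in *; lra). nra.
    - assert (peak y ^ n <= q ^ n).
      { apply pow_incr. split; [apply P0|]. unfold q, peak.
        assert (cos y <= cos e); [|lra]. apply cos_le_of_abs_ge; [lra|].
        split; [lra|]. apply Rabs_le; lra. }
      specialize (HM y ltac:(lra)). apply Rabs_le_between in HM.
      assert (0 < d) by (unfold d; lra). nra. }
  set (g := fun y => peak y ^ n).
  assert (Hg : Ck 0 g) by (apply Ck_pow, (Ck_peak 0 (fun y => y)), Ck_id).
  assert (L : RInt (fun y => d * g y - (M + d) * q ^ n) (- PI) PI <= RInt (fun y => g y * f y) (- PI) PI).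
  { apply RInt_le; [lra| | |exact Pt]; apply Ck0_ex_RInt; ck. }
  unfold g in L at 2. rewrite HI in L.
  rewrite RInt_Rminus, RInt_Rmult in L by ck.
  rewrite RInt_const in L. change (scal (PI - - PI) ((M + d) * q ^ n)) with ((PI - - PI) * ((M + d) * q ^ n)) in L.
  pose proof (peak_integral_ge n e ltac:(lra)) as I. fold g Q in I.
  assert (0 < d) by (unfold d; lra).
  assert (d * (e * Q ^ n) <= d * RInt g (- PI) PI) by (apply Rmult_le_compat_l; [lra|exact I]).
  lra.
Qed.

(** A point where [p] is positive is translated to 0, where the powers of [peak] concentrate;
    negative values are excluded by applying this to [- p]. *)
Lemma trigonometric_completeness (p : R -> R) :
  Ck 0 p -> (forall x, p (x + 2 * PI) = p x) ->
  (forall k w, RInt (fun z => sin (INR k * z + w) * p z) 0 (2 * PI) = 0) ->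
  forall x, p x = 0.
Proof.
  assert (Half : forall p, Ck 0 p -> (forall x, p (x + 2 * PI) = p x) ->
    (forall k w, RInt (fun z => sin (INR k * z + w) * p z) 0 (2 * PI) = 0) -> forall x, p x <= 0).
  { clear p. intros p Hp Pp H0 x0. apply Rnot_lt_le. intros Hx.
    apply (peak_concentration (fun y => p (x0 + y))).
    - intros y. apply (continuous_comp (fun y => x0 + y) p); [|apply Hp].
      apply (Ck_Rplus 0 (fun _ => x0) (fun y => y)); [apply Ck_const|apply Ck_id].
    - now rewrite Rplus_0_r.
    - intros n. set (h := fun z => peak (z - x0) ^ n * p z).
      assert (Hh : Ck 0 h).
      { apply Ck_mult; [|easy]. apply Ck_pow, Ck_peak. ck. }
      assert (Ph : forall z, h (z + 2 * PI) = h z).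
      { intros z. unfold h. rewrite Pp. do 2 f_equal. unfold peak.
        replace (z + 2 * PI - x0) with (z - x0 + 2 * INR 1 * PI) by (simpl; ring).
        now rewrite cos_period. }
      transitivity (RInt (fun y => h (x0 + y)) (- PI) PI).
      { apply RInt_ext. intros y _. unfold h. now replace (x0 + y - x0) with y by ring. }
      rewrite RInt_translate by easy.
      replace (x0 + PI) with (x0 + - PI + 2 * PI) by ring.
      replace (RInt h (x0 + - PI) (x0 + - PI + 2 * PI))
        with (RInt h (x0 + - PI + 0) (x0 + - PI + 2 * PI)) by now rewrite Rplus_0_r.
      rewrite <- (RInt_translate h (x0 + - PI)), RInt_periodic by easy.
      (* Frequency 0 with phase [PI / 2] turns the sine factor into 1. *)
      eapply eq_trans; [|exact (peak_moment_zero p x0 Hp H0 n 0 (PI / 2))].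
      apply RInt_ext. intros z _. unfold h. simpl INR.
      replace (0 * z + PI / 2) with (PI / 2) by ring. rewrite sin_PI2. real_eq. ring. }
  intros Hp Pp H0 x. apply Rle_antisym; [now apply Half|].
  assert (- p x <= 0); [|lra]. apply (Half (fun x => - p x)).
  - now apply Ck_opp.
  - intros y. now rewrite Pp.
  - intros k w. rewrite (RInt_ext _ (fun z => -1 * (sin (INR k * z + w) * p z))).
    + rewrite RInt_Rmult by ck. rewrite H0. real_eq. ring.
    + intros z _. real_eq. ring.
Qed.

(** * Rigidity *)

(** The metric determines [a] only up to sign. Positive definiteness makes [a] nowhere zero, hence
    of constant sign, and replacing [a] by [- a] preserves the average condition. *)
Lemma rot_invariant_warped (g : metric) (b : point -> R) :
  rot_invariant g b -> exists a b0, circle_fun a /\ circle_fun b0 /\ (forall x, 0 < a x) /\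
    warped g a /\ (forall p, b p = b0 (fst p)) /\
    RInt (fun x => a x * b0 x) 0 (2 * PI) = RInt a 0 (2 * PI).
Proof.
  intros [a [b0 [Ha [Hb [Hg [Hbp HI]]]]]].
  assert (Nz : forall x, a x <> 0).
  { intros x E. pose proof (comp_pos g (x, 0) (0, 1)) as P.
    unfold bilin, sum_axis in P; cbn [coord fst snd] in P.
    destruct (Hg (x, 0)) as [E1 [E2 E3]]. cbn [fst] in E3. rewrite E3, E in P.
    assert (K : 0 < 0) by (eapply Rlt_le_trans; [apply P; intros F; injection F; lra|right; ring]). lra. }
  assert (Ca : Ck 0 a) by apply (proj1 Ha).
  destruct (Rlt_le_dec 0 (a 0)) as [H0|H0].
  - exists a, b0. repeat split; try easy; try apply Ha; try apply Hb; try apply Hg.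
    intros x. destruct (Rtotal_order (a x) 0) as [H|[H|H]]; [|now apply Nz in H|easy].
    destruct (zero_between a x 0 Ca H H0) as [z Hz]. now apply Nz in Hz.
  - assert (H0' : a 0 < 0) by (specialize (Nz 0); lra).
    exists (fun x => - a x), b0. split; [|split; [easy|split; [|split; [|split; [easy|]]]]].
    + split; [intros n; apply Ck_opp, (proj1 Ha)|]. intros x. f_equal. apply Ha.
    + intros x. destruct (Rtotal_order (a x) 0) as [H|[H|H]]; [lra|now apply Nz in H|].
      destruct (zero_between a 0 x Ca H0' H) as [z Hz]. now apply Nz in Hz.
    + intros p. destruct (Hg p) as [E1 [E2 E3]]. repeat split; try easy. rewrite E3. ring.
    + assert (Cb : Ck 0 b0) by apply (proj1 Hb).
      rewrite (RInt_ext _ (fun x => -1 * (a x * b0 x))) by (intros; real_eq; ring).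
      rewrite (RInt_ext (fun x => - a x) (fun x => -1 * a x)) by (intros; real_eq; ring).
      rewrite !RInt_Rmult by ck. now rewrite HI.
Qed.

Lemma gauss_curvature_const (g : metric) p :
  (forall i j p q, Defs.comp g i j p = Defs.comp g i j q) -> gauss_curvature g p = 0.
Proof.
  intros H.
  assert (R0 : forall l k i j, riemann g l k i j p = 0).
  { intros l k i j. unfold riemann, sum_axis.
    assert (P : forall i k j m, partial m (christoffel g k i j) p = 0).
    { intros i' k' j' m. unfold partial.
      destruct m; rewrite (Derive_ext _ (fun _ => 0)) by (intros; now apply christoffel_const);
        apply Derive_const. }
    rewrite !P, !(christoffel_const g H). ring. }
  unfold gauss_curvature, sum_axis. rewrite !R0. unfold Rdiv. ring.
Qed.

Lemma mean_value (f : R -> R) a b :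
  a < b -> Ck 0 f -> exists c, a <= c <= b /\ RInt f a b = f c * (b - a).
Proof.
  intros Hab Hf.
  destruct (MVT_gen (fun x => RInt f 0 x) a b f) as [c [Hc E]].
  - intros; now apply is_derive_primitive.
  - intros x _. apply continuity_pt_filterlim, (ex_derive_continuous (fun x => RInt f 0 x) x).
    eexists. now apply is_derive_primitive.
  - rewrite Rmin_left, Rmax_right in Hc by lra. exists c. split; [easy|].
    rewrite (primitive_sub f) by easy. exact E.
Qed.

Lemma circle_fun_positive_min (f : R -> R) :
  circle_fun f -> (forall x, 0 < f x) -> exists m, 0 < m /\ forall x, m <= f x.
Proof.
  intros [Sf Pf] Hpos. pose proof PI_RGT_0.
  assert (C : Ck 0 (fun x => / f x)).
  { apply Ck_inv; [intros x; apply Rgt_not_eq, Hpos|apply Sf]. }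
  destruct (bounded_on (fun x => / f x) 0 (2 * PI) C) as [M [HM0 HM]].
  exists (/ (M + 1)). split; [apply Rinv_0_lt_compat; lra|]. intros x.
  destruct (translate_into_period 0 x) as [k Hk].
  replace (f x) with (f (x + 2 * PI * IZR k)).
  2: { rewrite (quasi_periodic_Z f (2 * PI) 0); [ring|]. intros z. rewrite Pf. ring. }
  specialize (HM (x + 2 * PI * IZR k) ltac:(lra)). specialize (Hpos (x + 2 * PI * IZR k)).
  set (y := f (x + 2 * PI * IZR k)) in *.
  rewrite <- (Rinv_inv y). apply Rinv_le_contravar; [now apply Rinv_0_lt_compat|].
  pose proof (Rle_abs (/ y)). lra.
Qed.

(* In the angle phi of the velocity the orbit is x = X (z0 + r sin phi), so its
   y-displacement over n turns is n r / A times the integral below. *)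
Lemma flat_orbit_displacement (g : metric) (A r : R) (b0 beta X : R -> R) (c : R -> point) T z0 :
  0 < A -> 0 < r -> warped g (fun _ => A) -> (forall x, 0 < b0 x) -> smooth b0 -> smooth X ->
  (forall x, is_derive beta x (b0 x)) -> (forall x, X (beta x) = x) ->
  (forall z, Derive X z = / b0 (X z)) -> (forall z, beta (X z) = z) ->
  magnetic_geodesic g (fun p => / r * b0 (fst p)) c ->
  tangent_lift c 0 = ((X z0, 0), (1, 0)) -> velocity c T = (1, 0) -> 0 < T ->
  exists K, 0 < K /\
    snd (c T) = K * RInt (fun t => sin t * Derive X (z0 + r * sin t)) 0 (2 * PI).
Proof.
  intros HA Hr Hg Hpos Sb SX Db Xb DX bX Hc Hc0 HcT HT.
  assert (Sc : smooth (fun _ : R => A)) by (intros n; apply Ck_const).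
  pose proof (warped_geodesic_ode g (fun _ => A) _ c Hg Sc (fun _ => HA) Hc) as Hode. cbv zeta in Hode.
  set (x := fun t => fst (c t)) in *. set (u := fun t => fst (velocity c t)) in *.
  set (q := fun t => A * snd (velocity c t)) in *.
  set (F := fun t => / r * b0 (x t)).
  assert (Dx : forall t, is_derive x t (u t)) by (intros t; exact (proj1 (Hode t))).
  assert (Dy : forall t, is_derive (fun t => snd (c t)) t (q t / A))
    by (intros t; exact (proj1 (proj2 (Hode t)))).
  assert (Du : forall t, is_derive u t (- q t * F t)).
  { intros t. replace (- q t * F t) with (- q t * (/ r * b0 (fst (c t)) - Derive (fun _ => A) (x t) / A * q t))
      by (rewrite Derive_const; unfold F, x; field; lra).
    exact (proj1 (proj2 (proj2 (Hode t)))). }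
  assert (Dq : forall t, is_derive q t (u t * F t)).
  { intros t. replace (u t * F t) with (u t * (/ r * b0 (fst (c t)) - Derive (fun _ => A) (x t) / A * q t))
      by (rewrite Derive_const; unfold F, x; field; lra).
    exact (proj1 (proj2 (proj2 (proj2 (Hode t))))). }
  assert (x0 : x 0 = X z0) by exact (f_equal (fun v => fst (fst v)) Hc0).
  assert (y0 : snd (c 0) = 0) by exact (f_equal (fun v => snd (fst v)) Hc0).
  assert (u0 : u 0 = 1) by exact (f_equal (fun v => fst (snd v)) Hc0).
  assert (q0 : q 0 = 0).
  { unfold q. replace (snd (velocity c 0)) with 0; [ring|].
    symmetry. exact (f_equal (fun v => snd (snd v)) Hc0). }
  assert (uT : u T = 1) by exact (f_equal fst HcT).
  assert (CF : Ck 0 F).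
  { unfold F. apply Ck_mult; [apply Ck_const|]. apply (Ck_comp 0 b0); [easy|].
    intros t. apply (ex_derive_continuous x). eexists. apply Dx. }
  set (phi := fun t => RInt F 0 t).
  assert (Dphi : forall t, is_derive phi t (F t)) by (intros; now apply is_derive_primitive).
  assert (phi0 : phi 0 = 0) by apply (RInt_point 0 F).
  assert (Dcos : forall t, is_derive (fun t => cos (phi t)) t (F t * - sin (phi t))).
  { intros t. apply (is_derive_comp cos phi); [apply is_derive_cos|apply Dphi]. }
  assert (Dsin : forall t, is_derive (fun t => sin (phi t)) t (F t * cos (phi t))).
  { intros t. apply (is_derive_comp sin phi); [apply is_derive_sin|apply Dphi]. }
  assert (Mul : forall f g df dg t, is_derive f t df -> is_derive g t dg ->
    is_derive (fun t => f t * g t) t (df * g t + f t * dg)).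
  { intros f g' df dg t Hf Hg'. apply (is_derive_mult f g'); [easy|easy|exact Rmult_comm]. }
  (* [G1] and [G2] say that [(u, q)] rotated back by [phi] remains [(1, 0)], which identifies the
     integral [phi] of the turning rate as the velocity angle without choosing branches. *)
  assert (G1 : forall t, u t * cos (phi t) + q t * sin (phi t) = 1).
  { intros t. transitivity (u 0 * cos (phi 0) + q 0 * sin (phi 0)).
    2: { rewrite u0, q0, phi0, cos_0. ring. }
    apply (derive_zero_const (fun t => u t * cos (phi t) + q t * sin (phi t))
      (fun t => (- q t * F t * cos (phi t) + u t * (F t * - sin (phi t)))
                + (u t * F t * sin (phi t) + q t * (F t * cos (phi t))))).
    - intros s. apply (is_derive_plus (fun t => u t * cos (phi t)) (fun t => q t * sin (phi t))).
      + now apply (Mul u (fun t => cos (phi t)) (- q s * F s) (F s * - sin (phi s))).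
      + now apply (Mul q (fun t => sin (phi t)) (u s * F s) (F s * cos (phi s))).
    - intros s. ring. }
  assert (G2 : forall t, q t * cos (phi t) - u t * sin (phi t) = 0).
  { intros t. transitivity (q 0 * cos (phi 0) - u 0 * sin (phi 0)).
    2: { rewrite q0, phi0, sin_0. ring. }
    apply (derive_zero_const (fun t => q t * cos (phi t) - u t * sin (phi t))
      (fun t => (u t * F t * cos (phi t) + q t * (F t * - sin (phi t)))
                - (- q t * F t * sin (phi t) + u t * (F t * cos (phi t))))).
    - intros s. apply (is_derive_minus (fun t => q t * cos (phi t)) (fun t => u t * sin (phi t))).
      + now apply (Mul q (fun t => cos (phi t)) (u s * F s) (F s * - sin (phi s))).
      + now apply (Mul u (fun t => sin (phi t)) (- q s * F s) (F s * cos (phi s))).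
    - intros s. ring. }
  assert (Hq : forall t, q t = sin (phi t)).
  { intros t. specialize (G1 t). specialize (G2 t).
    pose proof (sin2_cos2 (phi t)) as S. unfold Rsqr in S.
    pose proof (f_equal (Rmult (q t)) S). pose proof (f_equal (Rmult (cos (phi t))) G2).
    pose proof (f_equal (Rmult (sin (phi t))) G1). lra. }
  assert (Hx : forall t, x t = X (z0 + r * sin (phi t))).
  { intros t. rewrite <- (Xb (x t)). f_equal. rewrite <- Hq.
    (* The conserved center of the orbit; here the turning rate is exactly [b0 / r]. *)
    assert (E : beta (x t) - r * q t = beta (x 0) - r * q 0).
    { apply (derive_zero_const (fun t => beta (x t) - r * q t)
        (fun t => u t * b0 (x t) - r * (u t * F t))).
      - intros s. apply (is_derive_minus (fun t => beta (x t)) (fun t => r * q t)).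
        + apply (is_derive_comp beta x); [apply Db|apply Dx].
        + now apply (is_derive_scal q).
      - intros s. unfold F. field. lra. }
    rewrite x0, q0, bX in E. lra. }
  set (h := fun t => sin t * Derive X (z0 + r * sin t)).
  pose proof (smooth_derive X SX) as SX'.
  assert (Ch : Ck 0 h) by (unfold h; ck).
  set (Y := fun s => RInt h 0 s).
  assert (HY : forall t, snd (c t) = r / A * Y (phi t)).
  { intros t.
    assert (E : snd (c t) - r / A * Y (phi t) = snd (c 0) - r / A * Y (phi 0)).
    { apply (derive_zero_const (fun t => snd (c t) - r / A * Y (phi t))
        (fun t => q t / A - r / A * (F t * h (phi t)))).
      - intros s. apply (is_derive_minus (fun t => snd (c t)) (fun t => r / A * Y (phi t))); [easy|].
        apply (is_derive_scal (fun t => Y (phi t))).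
        apply (is_derive_comp Y phi); [now apply is_derive_primitive|apply Dphi].
      - intros s. unfold h. rewrite DX, <- Hx, <- Hq. unfold F.
        field. split; [apply Rgt_not_eq, Hpos|lra]. }
    rewrite y0, phi0 in E. assert (Y0 : Y 0 = 0) by apply (RInt_point 0 h).
    rewrite Y0 in E. lra. }
  assert (phiT : 0 < phi T).
  { destruct (mean_value F 0 T HT CF) as [s [_ E]]. fold (phi T) in E. rewrite E.
    apply Rmult_lt_0_compat; [|lra]. unfold F.
    apply Rmult_lt_0_compat; [now apply Rinv_0_lt_compat|apply Hpos]. }
  (* The velocity has returned to [(1, 0)], so its angle has made a whole number of turns, positive
     because [b0 > 0]. *)
  assert (Hn : exists n : Z, phi T = 2 * PI * IZR n).
  { apply cos_eq_1_iff. specialize (G1 T). specialize (G2 T). rewrite uT in G1, G2.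
    pose proof (sin2_cos2 (phi T)) as S. unfold Rsqr in S.
    pose proof (f_equal (Rmult (cos (phi T))) G1). pose proof (f_equal (Rmult (sin (phi T))) G2). lra. }
  destruct Hn as [n Hn]. pose proof PI_RGT_0 as Hpi.
  assert (Hn0 : 0 < IZR n).
  { rewrite Hn in phiT. apply Rmult_lt_reg_l with (2 * PI); lra. }
  exists (r / A * IZR n). split.
  { apply Rmult_lt_0_compat; [|easy]. now apply Rdiv_lt_0_compat. }
  rewrite HY, Hn. rewrite <- (Rplus_0_l (2 * PI * IZR n)).
  rewrite (quasi_periodic_Z Y (2 * PI) (RInt h 0 (2 * PI))).
  - assert (Y0 : Y 0 = 0) by apply (RInt_point 0 h). rewrite Y0. unfold Y. ring.
  - intros s. unfold Y.
    assert (Ph : forall t, h (t + 2 * PI) = h t) by (intros t; unfold h; now rewrite sin_periodic).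
    rewrite <- (RInt_periodic h s Ch Ph), RInt_translate by easy.
    rewrite Rplus_0_r, (primitive_sub h s) by easy. lra.
Qed.

Lemma constant_of_derive_zero (f : R -> R) :
  smooth f -> (forall x, Derive f x = 0) -> forall x y, f x = f y.
Proof. intros Sf. apply derive_zero_const. intros x. now apply smooth_is_derive. Qed.

(** All Fourier coefficients of [X' - 1] vanish: frequency 0 because [X] increases by 2 pi over a
    period, frequency [k >= 1] because [J1 (k r)] is not 0 for [r] outside [R_N]. *)
Lemma resonant_kernel_trivial (X : R -> R) r :
  smooth X -> (forall z, X (z + 2 * PI) = X z + 2 * PI) -> resonant X r ->
  0 < r -> ~ R_N r -> forall z, Derive X z = 1.
Proof.
  intros SX HXp Hres Hr HN. pose proof (smooth_derive X SX) as SX'.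
  set (p := fun z => Derive X z - 1).
  assert (Sp : smooth p) by (intros n; unfold p; ck).
  assert (Pp : forall x, p (x + 2 * PI) = p x).
  { intros x. unfold p. now rewrite (derive_quasi_periodic X (2 * PI) (2 * PI)). }
  assert (Z : forall z, p z = 0).
  2: { intros z. specialize (Z z). unfold p in Z. lra. }
  apply trigonometric_completeness; [apply Sp|easy|].
  intros [|k] w.
  - rewrite (RInt_ext _ (fun z => sin w * (Derive X z - 1))).
    2: { intros z _. simpl. real_eq. unfold p. do 2 f_equal. ring. }
    rewrite RInt_Rmult, RInt_Rminus by ck.
    rewrite (RInt_Derive X);
      [|intros x _; eexists; now apply smooth_is_derive|intros x _; apply (SX' O)].
    rewrite <- (Rplus_0_l (2 * PI)) at 1. rewrite HXp, RInt_const.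
    change (scal (2 * PI - 0) 1) with ((2 * PI - 0) * 1). real_eq. ring.
  - apply (fourier_coefficient_zero p r (S k) w Sp Pp).
    + intros z. rewrite (RInt_ext _ (fun t => sin t * Derive X (z + r * sin t) - sin t)).
      * rewrite RInt_Rminus by ck. rewrite Hres.
        rewrite (RInt_antiperiodic sin); [real_eq; ring|apply smooth_sin_cos|apply sin_shift_PI].
      * intros t _. unfold p. real_eq. ring.
    + intros E. apply HN. exists (S k). split; [lia|].
      assert (HS : 0 < INR (S k)) by (apply lt_0_INR; lia).
      exists (INR (S k) * r). split; [|field; lra].
      split; [now apply Rmult_lt_0_compat|]. now apply J1_eq_0_iff.
Qed.

Lemma zoll_flat_resonant (g : metric) (A r : R) (b0 beta X : R -> R) :
  0 < A -> 0 < r -> warped g (fun _ => A) -> (forall x, 0 < b0 x) -> smooth b0 -> smooth X ->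
  (forall x, is_derive beta x (b0 x)) -> (forall x, X (beta x) = x) ->
  (forall z, Derive X z = / b0 (X z)) -> (forall z, beta (X z) = z) ->
  (forall z, X (z + 2 * PI) = X z + 2 * PI) ->
  zoll g (fun p => / r * b0 (fst p)) -> resonant X r.
Proof.
  intros HA Hr Hg Hpos Sb SX Db Xb DX bX HXp Hz.
  pose proof (smooth_derive X SX) as SX'. pose proof PI_RGT_0 as Hpi.
  destruct (zoll_displacement g _ Hz) as [T [D [HT HD]]].
  set (v := fun x => ((x, 0), (1, 0)) : tangent).
  assert (Hv : forall x, unit_tangent g (v x)).
  { intros x. apply (unit_tangent_warped g (fun _ => A) _ _ _ Hg). ring. }
  assert (ED : forall x, D (v x) = D (v 0)).
  { intros x. apply (HD v); [|easy].
    apply (Ck_pair 0 (fun x : R => (x, 0)) (fun _ => (1, 0) : R2)); [|apply Ck_const].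
    apply (Ck_pair 0 (fun x : R => x) (fun _ => 0)); ck. }
  set (E := fun z => RInt (fun t => sin t * Derive X (z + r * sin t)) 0 (2 * PI)).
  (* The factor depends on [z] through the number of turns of the orbit, so the constant
     displacement determines only the sign of [E z]. *)
  assert (K : forall z, exists K, 0 < K /\ D (v 0) = K * E z).
  { intros z. destruct (HT _ (Hv (X z))) as [Tpos [c [Hc [Hc0 [Hy HcT]]]]].
    destruct (flat_orbit_displacement g A r b0 beta X c (T (v (X z))) z) as [K [HK EK]]; try easy.
    exists K. split; [easy|]. rewrite <- (ED (X z)). unfold E. rewrite <- EK, Hy.
    change (snd (fst (v (X z)))) with 0. ring. }
  (* A primitive of [E] with equal values at 0 and 2 pi, since the shift of [X] by 2 pi contributes
     only a multiple of the integral of [sin]. Hence [E] has a zero, and then the constant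
     displacement is 0. *)
  set (Et := fun z => RInt (fun t => sin t * X (z + r * sin t)) 0 (2 * PI)).
  assert (DEt : forall z, is_derive Et z (E z)).
  { intros z. apply (is_derive_RInt_slice (fun q : R2 => sin (snd q) * X (fst q + r * sin (snd q)))
      (fun q : R2 => sin (snd q) * Derive X (fst q + r * sin (snd q)))).
    - assert (H1 : Ck 0 (fun q : R2 => fst q : R)) by apply (Ck_linear 0 (fun q : R2 => fst q)), is_linear_fst.
      assert (H2 : Ck 0 (fun q : R2 => snd q : R)) by apply (Ck_linear 0 (fun q : R2 => snd q)), is_linear_snd.
      apply Ck_mult; [now apply Ck_sin|]. apply (Ck_comp 0 (Derive X)); [easy|].
      apply Ck_Rplus; [easy|]. apply Ck_mult; [apply Ck_const|now apply Ck_sin].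
    - intros y t. cbn [fst snd].
      apply (is_derive_scal (fun y => X (y + r * sin t))).
      apply (is_derive_shift X). now apply smooth_is_derive.
    - intros y. cbn [fst snd]. ck. }
  assert (Eper : Et (2 * PI) = Et 0).
  { unfold Et. rewrite (RInt_ext _ (fun t => sin t * X (0 + r * sin t) + 2 * PI * sin t)).
    - rewrite RInt_Rplus, RInt_Rmult by ck.
      rewrite (RInt_antiperiodic sin); [real_eq; ring|apply smooth_sin_cos|apply sin_shift_PI].
    - intros t _. real_eq. replace (2 * PI + r * sin t) with (0 + r * sin t + 2 * PI) by ring.
      rewrite HXp. ring. }
  destruct (MVT_gen Et 0 (2 * PI) E) as [z0 [_ Hz0]].
  { intros; apply DEt. }
  { intros z _. apply continuity_pt_filterlim, (ex_derive_continuous Et z). eexists. apply DEt. }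
  assert (Ez0 : E z0 = 0) by (rewrite Eper in Hz0; nra).
  assert (D0 : D (v 0) = 0).
  { destruct (K z0) as [K0 [_ ->]]. rewrite Ez0. ring. }
  intros z. change (E z = 0). destruct (K z) as [K0 [HK0 EK]]. rewrite D0 in EK. nra.
Qed.

Lemma rigid_off_scaled_zeros (Rs : R -> Prop) :
  (forall r, Rs r -> 0 < r) -> ~ bound Rs -> ~ (forall r, Rs r -> R_N r) ->
  zoll_rigid rot_invariant Rs.
Proof.
  intros HRs Hub HN g b HM Hz. pose proof PI_RGT_0 as Hpi.
  destruct (rot_invariant_warped g b HM) as [a [b0 [Ha [Hb [Hpos [Hg [Eb HI]]]]]]].
  assert (Hz' : forall r, Rs r -> zoll g (fun p => / r * b0 (fst p))).
  { intros r Hr. replace (fun p : point => / r * b0 (fst p)) with (fun p => / r * b p); [now apply Hz|].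
    apply functional_extensionality. intros p. now rewrite Eb. }
  assert (Da : forall x, Derive a x = 0) by now apply (zoll_weak_field_constant g a b0 Rs).
  set (A := a 0). assert (EA : forall x, a x = A).
  { intros x. apply constant_of_derive_zero; [apply Ha|easy]. }
  assert (HA : 0 < A) by apply Hpos.
  assert (HgA : warped g (fun _ => A)).
  { intros p. rewrite <- (EA (fst p)). apply Hg. }
  split.
  { exists 0. intros p. apply gauss_curvature_const. intros i j p1 p2.
    destruct (HgA p1) as [X1 [Y1 Z1]], (HgA p2) as [X2 [Y2 Z2]].
    destruct i, j; rewrite ?(comp_sym g dir_y dir_x); congruence. }
  assert (exists r, Rs r /\ ~ R_N r) as [r [Hr HrN]].
  { destruct (excluded_middle_informative (exists r, Rs r /\ ~ R_N r)) as [H|H]; [easy|].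
    exfalso. apply HN. intros r Hr. destruct (excluded_middle_informative (R_N r)) as [H'|H']; [easy|].
    exfalso. apply H. now exists r. }
  pose proof (HRs r Hr) as Hr0. pose proof (Hz' r Hr) as Hzr.
  destruct Hb as [Sb Pb]. assert (Cb : Ck 0 b0) by apply Sb.
  (* With [a' = 0] both conditions on the opposite circles become [b0 = 0], so one zero serves as
     [x1] and as [x2]. *)
  assert (Nz : forall x, b0 x <> 0).
  { intros x E. apply (zoll_no_opposite_circles g a (fun x => / r * b0 x) x x); try easy.
    - split; [intros n; ck|]. intros z. now rewrite Pb.
    - rewrite E, Da. unfold Rdiv. ring.
    - rewrite E, Da. unfold Rdiv. ring. }
  (* The average condition with the constant [A] cancelled. It fixes the sign of [b0] and makes
     [beta] increase by exactly 2 pi over a period. *)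
  assert (Ib : RInt b0 0 (2 * PI) = 2 * PI).
  { rewrite (RInt_ext _ (fun x => A * b0 x)) in HI by (intros; now rewrite EA).
    rewrite (RInt_ext a (fun x => A)) in HI by (intros; apply EA).
    rewrite RInt_Rmult, RInt_const in HI by easy.
    change (scal (2 * PI - 0) A) with ((2 * PI - 0) * A) in HI.
    apply Rmult_eq_reg_l with A; [lra|lra]. }
  assert (Bpos : forall x, 0 < b0 x).
  { destruct (mean_value b0 0 (2 * PI) ltac:(lra) Cb) as [c [_ Ec]]. rewrite Ib in Ec.
    assert (0 < b0 c) by nra.
    intros x. destruct (Rtotal_order (b0 x) 0) as [H'|[H'|H']]; [|now apply Nz in H'|easy].
    destruct (zero_between b0 x c Cb H' H) as [z Hz0]. now apply Nz in Hz0. }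
  destruct (circle_fun_positive_min b0 (conj Sb Pb) Bpos) as [m [Hm Hbm]].
  set (beta := fun x => RInt b0 0 x).
  assert (Db : forall x, is_derive beta x (b0 x)) by (intros; now apply is_derive_primitive).
  assert (Sbeta : smooth beta).
  { intros n. apply Ck_le. apply Ck_of_derive with b0; [exact Db|apply Sb]. }
  assert (Ebeta : forall x, Derive beta x = b0 x) by (intros; apply is_derive_unique, Db).
  destruct (smooth_inverse beta m Hm Sbeta) as [X [Xb [bX [DX SX]]]].
  { intros x. rewrite Ebeta. apply Hbm. }
  assert (Hbp : forall x, beta (x + 2 * PI) = beta x + 2 * PI).
  { intros x. pose proof (RInt_periodic b0 x Cb Pb) as E.
    rewrite Ib, RInt_translate, Rplus_0_r, (primitive_sub b0 x) in E by easy. unfold beta. lra. }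
  assert (HXp : forall z, X (z + 2 * PI) = X z + 2 * PI).
  { intros z. rewrite <- (bX z) at 1. now rewrite <- Hbp, Xb. }
  assert (EDX : forall z, Derive X z = / b0 (X z)).
  { intros z. rewrite <- Ebeta. apply is_derive_unique, DX. }
  assert (Hres : resonant X r).
  { apply (zoll_flat_resonant g A r b0 beta X); easy. }
  exists 1. intros p. rewrite Eb.
  pose proof (resonant_kernel_trivial X r SX HXp Hres Hr0 HrN (beta (fst p))) as E.
  rewrite EDX, Xb in E. rewrite <- (Rinv_inv (b0 (fst p))), E. apply Rinv_1.
Qed.

Theorem theorem1p11 :
  (forall Rs : R -> Prop,
     (forall r, Rs r -> 0 < r) ->
     ~ bound Rs ->
     ~ (forall r, Rs r -> R_N r) ->
     zoll_rigid rot_invariant Rs) /\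
  (forall k : nat, (1 <= k)%nat ->
     zoll_flexible rot_invariant (scale_set (/ INR k) R_star)).
Proof.
  split.
  - intros Rs. apply rigid_off_scaled_zeros.
  - apply flexible_at_scaled_zeros.
Qed.
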